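(* Let $F=K_1\nabla F^{\bullet}$, where each connected component of $F^{\bullet}$ is either a tree with at least two vertices or an even cycle, and let $F^{o}$ be an odd-ballooning of $F$ in which every substituted odd cycle has length at least five. Then for all sufficiently large $n$: (1) if each component of $F^{\bullet}$ is an even cycle, then ${\rm EX}(n,F^{o})=\{(M_{\frac{1}{2}|F^{\bullet}|-1}\cup K_1)\nabla T_{n-|F^{\bullet}|+1,2}\}$; (2) if each component of $F^{\bullet}$ is a single edge, then ${\rm EX}(n,F^{o})=\{K_{e(F^{\bullet})}\nabla T_{n-e(F^{\bullet}),2}\}$; (3) otherwise, ${\rm EX}(n,F^{o})=\{E_{e(F^{\bullet})}\nabla T_{n-e(F^{\bullet}),2}\}$.
   Context: For a graph $H$, $|H|$ is its number of vertices and $e(H)$ its number of edges. $K_k$, $E_k$ denote the complete and the empty (edgeless) graph on $k$ vertices; $M_t$ is a matching consisting of $t$ vertex-disjoint edges ($2t$ vertices); $T_{m,2}$ is the complete bipartite graph on $m$ vertices with part sizes $\lfloor m/2\rfloor,\lceil m/2\rceil$. $G\nabla H$ is the join (disjoint union plus all edges between them) and $G\cup H$ the disjoint union. A graph is $F^{o}$-free if it has no subgraph isomorphic to $F^{o}$; ${\rm EX}(n,F^{o})$ is the set of $n$-vertex $F^{o}$-free graphs with the maximum possible number of edges. The odd-ballooning $F^{o}$ of $F$ is obtained by replacing each edge $uv$ of $F$ with an odd cycle through the edge $uv$ (adding a new $u$–$v$ path of even length with new internal vertices), all new vertices of different cycles being distinct; different edges may receive odd cycles of different lengths, all here of length at least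 $5$. *)

(* Defs.v *)
From HB Require Import structures.
From mathcomp Require Import all_boot.

Set Implicit Arguments.
Unset Strict Implicit.
Unset Printing Implicit Defensive.

Record sgraph := SGraph {
  svertex :> finType;
  adj : rel svertex;
  adj_sym : symmetric adj;
  adj_irr : irreflexive adj }.

Section SymmetricClosure.
Variables (T : finType) (r : rel T).

Definition sclosure : rel T := fun x y => (x != y) && (r x y || r y x).

Lemma sclosure_sym : symmetric sclosure.
Proof. by move=> x y; rewrite /sclosure eq_sym orbC. Qed.

Lemma sclosure_irr : irreflexive sclosure.
Proof. by move=> x; rewrite /sclosure eqxx. Qed.

Definition graph_of_rel : sgraph := SGraph sclosure_sym sclosure_irr.
End SymmetricClosure.

Definition gorder (G : sgraph) : nat := #|svertex G|.

Definition edges (G : sgraph) : {set {set G}} :=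
  [set [set p.1; p.2] | p : G * G & adj p.1 p.2].

Definition nedges (G : sgraph) : nat := #|edges G|.

Definition isomorphic (G H : sgraph) : Prop :=
  exists f : G -> H, bijective f /\ forall x y, adj (f x) (f y) = adj x y.

(* G has a (not necessarily induced) subgraph isomorphic to F. *)
Definition contains (G F : sgraph) : Prop :=
  exists f : F -> G, injective f /\ forall x y, adj x y -> adj (f x) (f y).

Definition free (F G : sgraph) : Prop := ~ contains G F.

Definition EX (n : nat) (F G : sgraph) : Prop :=
  [/\ gorder G = n, free F G &
      forall G' : sgraph, gorder G' = n -> free F G' -> nedges G' <= nedges G].

(* Sets of graphs are taken up to isomorphism, so that "EX(n, F) = {H}" says
   that the members of EX(n, F) are exactly the graphs isomorphic to H. *)
Definition EX_is_singleton (n : nat) (F H : sgraph) : Prop :=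
  forall G : sgraph, EX n F G <-> isomorphic G H.

Definition complete (k : nat) : sgraph :=
  graph_of_rel (fun _ _ : 'I_k => true).

Definition edgeless (k : nat) : sgraph :=
  graph_of_rel (fun _ _ : 'I_k => false).

(* The two ends of the i-th edge are (i, false) and (i, true). *)
Definition matching (t : nat) : sgraph :=
  graph_of_rel (fun x y : 'I_t * bool => x.1 == y.1).

Definition cycle_graph (k : nat) : sgraph :=
  graph_of_rel (fun x y : 'I_k => y == ordS x).

Definition gjoin (G H : sgraph) : sgraph :=
  graph_of_rel (fun x y : G + H =>
    match x, y with
    | inl u, inl v => adj u v
    | inr u, inr v => adj u v
    | inl _, inr _ | inr _, inl _ => true
    end).

Definition gunion (G H : sgraph) : sgraph :=
  graph_of_rel (fun x y : G + H =>
    match x, y with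
    | inl u, inl v => adj u v
    | inr u, inr v => adj u v
    | inl _, inr _ | inr _, inl _ => false
    end).

Definition complete_bipartite (a b : nat) : sgraph :=
  gjoin (edgeless a) (edgeless b).

Definition turan2 (m : nat) : sgraph := complete_bipartite m./2 (uphalf m).

Definition induced (G : sgraph) (A : {set G}) : sgraph :=
  graph_of_rel (fun x y : {v : G | v \in A} => adj (val x) (val y)).

Definition components (G : sgraph) : {set {set G}} :=
  [set [set y | connect (@adj G) x y] | x : G].

Definition connected (G : sgraph) : Prop :=
  0 < gorder G /\ forall x y : G, connect (@adj G) x y.

Definition acyclic (G : sgraph) : Prop :=
  forall s : seq G, 3 <= size s -> ~ ucycle (@adj G) s.

Definition tree (G : sgraph) : Prop := connected G /\ acyclic G.

Definition even_cycle (G : sgraph) : Prop :=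
  exists k : nat, 2 <= k /\ isomorphic G (cycle_graph k.*2).

Definition single_edge (G : sgraph) : Prop := isomorphic G (complete 2).

Definition each_component (P : sgraph -> Prop) (G : sgraph) : Prop :=
  forall C : {set G}, C \in components G -> P (induced C).

(* Each edge of G occurs here exactly once, as the pair of its ends listed in
   the order of the enumeration of the vertices. *)
Definition oedge (G : sgraph) : finType :=
  {p : G * G | adj p.1 p.2 && (enum_rank p.1 < enum_rank p.2)}.

(* The odd-ballooning of F in which the edge p = uv is replaced with a cycle
   of length l p: the l p - 2 new vertices (p, 0), ..., (p, l p - 3) are the
   internal vertices of a new path from u to v of length l p - 1, which forms a
   cycle with the edge uv.  It is an odd-ballooning when every l p is odd and
   at least 3. *)
Section Ballooning.
Variables (F : sgraph) (l : oedge F -> nat).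

Definition new_vertex : finType := {p : oedge F & 'I_(l p - 2)}.

Definition balloon_rel (x y : F + new_vertex) : bool :=
  match x, y with
  | inl u, inl v => adj u v
  | inl u, inr w =>
      let p := tag w in let i := nat_of_ord (tagged w) in
      ((u == (val p).1) && (i == 0)) || ((u == (val p).2) && (i == l p - 3))
  | inr w, inr z => (tag w == tag z) && ((tagged w).+1 == tagged z :> nat)
  | inr _, inl _ => false
  end.

Definition ballooning : sgraph := graph_of_rel balloon_rel.
End Ballooning.

(* Main.v *)
(** A graph with at least as many edges as the extremal candidate may be assumed
    to have minimum degree at least n/2: deleting a vertex of smaller degree
    increases the surplus, and this cannot be repeated too often.  Such a graph
    that contains no ballooning contains no large complete tripartite graph,
    hence few triangles, and splitting it at the neighbourhood of a suitable
    vertex shows that it is almost complete bipartite.  Fix a partition with the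
    fewest inner edges.

    A ballooning is embedded by first placing F and then joining the ends of
    every edge of F by a path of even length.  Between two vertices on the same
    side such a path runs through typical vertices; between opposite sides it has
    to change parity once, by means of a heavy vertex (one with linearly many
    neighbours on both sides) or of an edge inside a part.  As the cycles have
    length at least five, these parity gadgets can be kept away from the vertices
    of F.  Choosing which vertices of F are themselves heavy bounds the number of
    heavy vertices by k, forces exactly k of them, all of almost full degree, by
    counting edges, excludes all other inner edges, and restricts the graph induced
    on the heavy vertices.  Comparing edge numbers then leaves only the extremal
    graph.  Conversely, in the extremal graph the vertices of the small part would
    have to meet every cycle of an embedded ballooning, and there are too few of
    them. *)

Require Import Defs.
From mathcomp Require Import all_boot zify.

Set Implicit Arguments.
Unset Strict Implicit.
Unset Printing Implicit Defensive.

(** * Arcs and edges *)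

(** Let [k] be the number of heavy vertices and [e] the number of edges of [Fb]. Put the centre of
    the join on a heavy vertex and an independent set [U] of [Fb] on heavy neighbours of it. Then
    only the edges of [Fb] avoiding [U], in number [e] minus the degrees in [U], still change sides,
    and each consumes one more heavy vertex. So an embedding exists once [k] plus the degrees in [U]
    is at least [e + 1 + |U|]. The three cases come from this inequality. [U] empty gives [k <= e].
    If all degrees are 1, it never holds for [k = e], and the heavy vertices may form a clique. A
    vertex of degree at least 2 forbids every edge among [e] heavy vertices. For even cycles, one
    colour class on heavy vertices leaves only the spokes to the other class, so [e] heavy vertices
    are already too many and [k = e - 1]; two nonadjacent vertices of degree 2 then limit the heavy
    graph to maximum degree 1, and [k] is odd. In the candidate the inequality is also necessary,
    since its small part meets all cycles. Heaviness has several scales because a gadget needs only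
    some neighbours on each side, while a centre must leave room for all of [F]. *)

Section Basics.
Variable G : sgraph.

Definition nbr (v : G) : {set G} := [set u | adj v u].

(** Ordered pairs are counted, so an edge inside both sets counts twice. This makes the count
    symmetric and additive over disjoint unions; edge numbers appear doubled throughout. *)
Definition arcs (A B : {set G}) : nat := \sum_(v in A) #|nbr v :&: B|.

Lemma in_nbr v u : (u \in nbr v) = adj v u.
Proof. by rewrite inE. Qed.

Lemma adj_neq (u v : G) : adj u v -> u != v.
Proof. by apply: contraTneq => ->; rewrite adj_irr. Qed.

Lemma arcs_sum A B : arcs A B = \sum_(v in A) \sum_(u in B) adj v u.
Proof.
apply: eq_bigr => v _; rewrite -sum1_card big_mkcond [RHS]big_mkcond /=.
by apply: eq_bigr => u _; rewrite !inE; case: (adj v u); case: (u \in B).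
Qed.

Lemma arcsC A B : arcs A B = arcs B A.
Proof.
rewrite !arcs_sum exchange_big /=; apply: eq_bigr => v _.
by apply: eq_bigr => u _; rewrite adj_sym.
Qed.

Lemma arcsDl (A1 A2 B : {set G}) : [disjoint A1 & A2] ->
  arcs (A1 :|: A2) B = arcs A1 B + arcs A2 B.
Proof.
by move=> dis; rewrite /arcs -bigU //=; apply: eq_bigl => v; rewrite !inE.
Qed.

Lemma arcsDr (A B1 B2 : {set G}) : [disjoint B1 & B2] ->
  arcs A (B1 :|: B2) = arcs A B1 + arcs A B2.
Proof. by move=> dis; rewrite arcsC arcsDl // !(arcsC A). Qed.

Lemma arcsSl (A1 A2 B : {set G}) : A1 \subset A2 -> arcs A1 B <= arcs A2 B.
Proof.
move=> /setIidPr sA; rewrite -[A2](setID _ A1) arcsDl ?sA ?leq_addr //.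
by apply/pred0P=> x /=; rewrite !inE; case: (x \in A1).
Qed.

Lemma arcsSr (A B1 B2 : {set G}) : B1 \subset B2 -> arcs A B1 <= arcs A B2.
Proof. by move=> sB; rewrite !(arcsC A) arcsSl. Qed.

Lemma leq_arcs_mul A B : arcs A B <= #|A| * #|B|.
Proof. by rewrite -sum_nat_const leq_sum // => v _; rewrite subset_leq_card ?subsetIr. Qed.

Lemma sum_degE : \sum_(v : G) #|nbr v| = arcs setT setT.
Proof. by apply: eq_big => [v|v _]; rewrite ?inE ?setIT. Qed.

Lemma card_pairs (B : rel G) :
  #|[set q : G * G | B q.1 q.2]| = \sum_(v : G) \sum_(u : G) B v u.
Proof.
rewrite -sum1_card big_mkcond /= pair_big /=; apply: eq_bigr => -[u v] _.
by rewrite inE /=; case: (B u v).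
Qed.

Lemma oedge_count (B : rel G) : symmetric B ->
  #|[set p : oedge G | B (val p).1 (val p).2]|.*2
  = #|[set q : G * G | adj q.1 q.2 && B q.1 q.2]|.
Proof.
move=> symB; set E := [set p | _]; set A := [set q | _].
pose lo := [set q : G * G | enum_rank q.1 < enum_rank q.2].
pose sw (q : G * G) := (q.2, q.1).
have swI : injective sw by move=> [a b] [c d] [-> ->].
have EA : val @: E = A :&: lo.
  apply/setP=> -[a b]; rewrite !inE /=; apply/imsetP/idP.
    by case=> -[[x y] /= hp]; case/andP: (hp) => hxy lxy; rewrite inE /= => Bxy [-> ->]; rewrite Bxy hxy.
  case/andP=> /andP[ab Bab] lab.
  have h : adj (a, b).1 (a, b).2 && (enum_rank (a, b).1 < enum_rank (a, b).2) by rewrite /= ab.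
  by exists (Sub (a, b) h); rewrite ?inE ?SubK.
have cE : #|E| = #|A :&: lo| by rewrite -EA card_imset //; apply: val_inj.
have cD : #|A :\: lo| = #|E|.
  rewrite cE -(card_imset (A :&: lo) swI); congr #|pred_of_set _|.
  apply/setP=> -[a b]; rewrite !inE /=; apply/idP/imsetP => [|[[c d]]].
    case/and3P => nl ab Bab; exists (b, a) => //; rewrite !inE /= adj_sym ab symB Bab /=.
    rewrite ltn_neqAle leqNgt nl andbT; apply: contraTneq ab => /val_inj/enum_rank_inj->.
    by rewrite adj_irr.
  rewrite !inE /= => /andP[/andP[cd Bcd] lt] [-> ->].
  by rewrite adj_sym cd symB Bcd -leqNgt ltnW.
by rewrite -addnn -{2}cD cE cardsID.
Qed.

Lemma card_oedge : #|oedge G| = nedges G.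
Proof.
rewrite /nedges /edges.
pose h (p : oedge G) := [set (val p).1; (val p).2].
have hI : injective h.
  move=> p q; case: (andP (valP p)) => _ lp; case: (andP (valP q)) => _ lq eh.
  apply: val_inj; rewrite /h in eh.
  case: (val p) (val q) lp lq eh => [a b] [c d] /= lab lcd /setP eh.
  have := eh a; have := eh b; have := eh c; rewrite !inE !eqxx !orbT /=.
  move=> /orP hc /esym/orP hb /esym/orP ha.
  by case: ha; case: hb; case: hc => /eqP ? /eqP ? /eqP ?; subst=> //;
    rewrite ?ltnn // in lab lcd; move: (ltn_trans lab lcd); rewrite ltnn.
rewrite -cardsT -(card_imset _ hI); congr #|pred_of_set _|; apply/setP=> X.
apply/imsetP/imsetP => [[[[a b] /= hab] _ ->]|[[a b]]].
  by case/andP: (hab) => ab _; exists (a, b); rewrite ?inE.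
rewrite inE /= => ab ->; case: (ltngtP (enum_rank a) (enum_rank b)) => lab.
- have h1 : adj (a, b).1 (a, b).2 && (enum_rank (a, b).1 < enum_rank (a, b).2) by rewrite /= ab.
  by exists (Sub (a, b) h1); rewrite ?inE // /h SubK.
- have h1 : adj (b, a).1 (b, a).2 && (enum_rank (b, a).1 < enum_rank (b, a).2) by rewrite /= adj_sym ab.
  by exists (Sub (b, a) h1); rewrite ?inE // /h SubK setUC.
- by move/val_inj/enum_rank_inj: lab ab => ->; rewrite adj_irr.
Qed.

Lemma card_adj_pairs : #|[set q : G * G | adj q.1 q.2]| = arcs setT setT.
Proof.
rewrite card_pairs arcs_sum; apply: eq_big => [v|v _]; rewrite ?inE //.
by apply: eq_bigl => u; rewrite inE.
Qed.

Lemma arcsTT : arcs setT setT = (nedges G).*2.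
Proof.
have -> : nedges G = #|[set p : oedge G | true]|.
  by rewrite -card_oedge -cardsT; congr #|pred_of_set _|; apply/setP=> p; rewrite !inE.
rewrite (@oedge_count (fun _ _ => true)) // -card_adj_pairs.
by congr #|pred_of_set _|; apply/setP=> p; rewrite !inE andbT.
Qed.

End Basics.

(** * Stability *)

Lemma exists_subset_card (T : finType) (A : {set T}) m :
  m <= #|A| -> exists2 B : {set T}, B \subset A & #|B| = m.
Proof.
move=> hm; exists [set x in take m (enum A)].
  by apply/subsetP=> x; rewrite inE => /mem_take; rewrite mem_enum.
have u : uniq (take m (enum A)) by apply: take_uniq; apply: enum_uniq.
by rewrite cardsE (card_uniqP u) size_takel // -cardE.
Qed.

Lemma pigeonhole (T Z : finType) (A : {set T}) (B : {set Z}) (f : T -> Z) :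
  0 < #|A| -> (forall y, y \in A -> f y \in B) ->
  exists2 t, t \in B & #|A| <= #|B| * #|[set y in A | f y == t]|.
Proof.
case/card_gt0P => y0 y0A fB.
pose t := [arg max_(t > f y0 in B) #|[set y in A | f y == t]|].
have [tB tmax] : t \in B /\ forall t', t' \in B ->
    #|[set y in A | f y == t']| <= #|[set y in A | f y == t]|.
  by rewrite /t; case: arg_maxnP => [|i iB imax]; [apply: fB | split].
exists t => //; rewrite -sum1_card (partition_big f (mem B)) //= -sum_nat_const.
apply: leq_sum => t' t'B; apply: leq_trans (tmax t' t'B).
by rewrite -sum1_card; apply: eq_leq; apply: eq_bigl => y; rewrite inE.
Qed.

Lemma sum_rel_card (X Y : finType) (r : X -> Y -> bool) (A : {set X}) (B : {set Y}) :
  \sum_(x in A) #|[set y in B | r x y]| = \sum_(y in B) #|[set x in A | r x y]|.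
Proof.
have E (T : finType) (C : {set T}) (p : pred T) :
    #|[set y in C | p y]| = \sum_(y in C) p y.
  rewrite -sum1_card big_mkcond [RHS]big_mkcond; apply: eq_bigr => y _.
  by rewrite inE; case: (y \in C); case: (p y).
under eq_bigr do rewrite E; rewrite exchange_big /=.
by apply: eq_bigr => y _; rewrite E.
Qed.

(** A reverse Markov inequality: the points with [c * d x < D] contribute at most [D * #|A|] to the
    left side, each other point at most [c * D]. It turns a large average into many large values. *)
Lemma sum_threshold (T : finType) (A : {set T}) (d : T -> nat) (D c : nat) :
  (forall x, x \in A -> d x <= D) ->
  c * (\sum_(x in A) d x) <= c * (D * #|[set x in A | D <= c * d x]|) + D * #|A|.
Proof.
move=> dD; rewrite (big_setID [set x | D <= c * d x]) /= mulnDr.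
apply: leq_add.
  rewrite leq_mul2l; apply/orP; right; rewrite mulnC -sum_nat_const.
  have -> : A :&: [set x | D <= c * d x] = [set x in A | D <= c * d x].
    by apply/setP=> x; rewrite !inE.
  by apply: leq_sum => x; rewrite inE => /andP[/dD].
rewrite big_distrr /= mulnC; apply: leq_trans (_ : #|A :\: [set x | D <= c * d x]| * D <= _).
  rewrite -sum_nat_const; apply: leq_sum => x; rewrite !inE -ltnNge => /andP[/ltnW //].
by rewrite leq_mul2r subset_leq_card ?orbT // subsetDl.
Qed.

(* Restrict the dense side to a bounded set of vertices of large degree and
   apply the pigeonhole principle to the traces on that set. *)
Lemma dense_complete_pair (X Y : finType) (r : X -> Y -> bool) (q s : nat) :
  0 < q -> 0 < s -> 2 * q * (4 * q * s) <= #|X| ->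
  #|X| * #|Y| <= q * \sum_(x : X) #|[set y | r x y]| ->
  exists2 S : {set X}, s <= #|S| &
    #|Y| <= 4 * q * 2 ^ (4 * q * s) * #|[set y | [forall x in S, r x y]]|.
Proof.
(* With this [m], a trace of relative size [1 / (4 * q)] still has [s] elements. *)
move=> q0 s0; set m := 4 * q * s => Xbig dense.
have m0 : 0 < m by rewrite /m; nia.
have [Y0|Y0] := posnP #|Y|.
  exists setT; last by rewrite Y0.
  by rewrite cardsT; apply: leq_trans Xbig; rewrite /m; nia.
have dT (x : X) : #|[set y | r x y]| = #|[set y in [set: Y] | r x y]|.
  by congr #|pred_of_set _|; apply/setP=> y; rewrite !inE.
pose d x := #|[set y in [set: Y] | r x y]|.
have dY x : d x <= #|Y| by apply: max_card.
pose Xp := [set x in [set: X] | #|Y| <= 2 * q * d x].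
have Xp_big : m <= #|Xp|.
  have := @sum_threshold X setT d #|Y| (2 * q) (fun x _ => dY x).
  rewrite -/Xp cardsT => hth.
  have e1 : \sum_(x in [set: X]) d x = \sum_(x : X) #|[set y | r x y]|.
    by apply: eq_big => [x|x _]; rewrite ?inE ?dT.
  rewrite e1 in hth.
  have h2 : #|Y| * #|X| <= #|Y| * (2 * q * #|Xp|) by nia.
  rewrite leq_pmul2l // in h2.
  by have := leq_trans Xbig h2; rewrite leq_pmul2l // muln_gt0.
have [X0 /subsetP sX0 cX0] := exists_subset_card Xp_big.
pose tr y := [set x in X0 | r x y].
have trm y : #|tr y| <= m by rewrite -cX0 subset_leq_card //; apply/subsetP=> x; rewrite inE => /andP[].
pose Ys := [set y in [set: Y] | m <= 4 * q * #|tr y|].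
have Ys_big : #|Y| <= 4 * q * #|Ys|.
  have hth : 4 * q * (\sum_(x in X0) d x) <= 4 * q * (m * #|Ys|) + m * #|Y|.
    have := @sum_threshold Y setT (fun y => #|tr y|) m (4 * q) (fun y _ => trm y).
    by rewrite cardsT -(sum_rel_card r X0 setT).
  have low : m * #|Y| <= 2 * q * \sum_(x in X0) d x.
    rewrite big_distrr /= -cX0 -sum_nat_const; apply: leq_sum => x /sX0.
    by rewrite !inE.
  set sd := \sum_(x in X0) _ in hth low.
  have h2 : m * #|Y| <= m * (4 * q * #|Ys|) by nia.
  by rewrite leq_pmul2l // in h2.
have Ys0 : 0 < #|Ys| by move: Ys_big Y0; case: #|Ys| => //; lia.
have [|S Sp hS] := @pigeonhole Y _ Ys (powerset X0) tr Ys0.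
  by move=> y _; rewrite powersetE; apply/subsetP=> x; rewrite inE => /andP[].
rewrite card_powerset cX0 in hS.
exists S.
  have : 0 < #|[set y in Ys | tr y == S]| by move: hS Ys0; case: #|[set _ in _ | _]| => //; lia.
  case/card_gt0P=> y; rewrite !inE /= => /andP[+ /eqP <-].
  by rewrite /m leq_pmul2l // muln_gt0.
apply: (leq_trans Ys_big); rewrite -(mulnA (4 * q)) leq_mul2l.
apply/orP; right; apply: (leq_trans hS).
rewrite leq_mul2l; apply/orP; right; apply: subset_leq_card.
apply/subsetP=> y; rewrite !inE => /andP[_ /eqP <-].
by apply/'forall_implyP=> x; rewrite inE => /andP[].
Qed.

Definition complete_tripartite (G : sgraph) (A : 'I_3 -> {set G}) :=
  forall i j x y, i != j -> x \in A i -> y \in A j -> adj x y.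

(** The pair lemma is used twice: between vertices and the pairs forming a triangle with them, then
    on the graph of the pairs complete to the first set. [q1] and [q2] are the inverse densities
    left after each round. *)
Lemma dense_triangles_tripartite q s : 0 < q -> 0 < s ->
  exists n0, forall G : sgraph, n0 <= #|G| ->
  #|G| ^ 3 <= q * \sum_(x : G) arcs (nbr x) (nbr x) ->
  exists2 A : 'I_3 -> {set G}, complete_tripartite A & forall i, s <= #|A i|.
Proof.
move=> q0 s0; pose q1 := 4 * q * 2 ^ (4 * q * s); pose q2 := 4 * q1 * 2 ^ (4 * q1 * s).
have q10 : 0 < q1 by rewrite !muln_gt0 q0 expn_gt0.
have q20 : 0 < q2.
  by apply: leq_trans (leq_pmulr _ _); rewrite ?expn_gt0 // (leq_trans q10) ?leq_pmull.
exists (2 * q * (4 * q * s) + 2 * q1 * (4 * q1 * s) + q2 * s) => G Gbig dense.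
pose r (x : G) (p : G * G) := [&& adj x p.1, adj x p.2 & adj p.1 p.2].
have cr x : arcs (nbr x) (nbr x) = #|[set p | r x p]|.
  rewrite arcs_sum (@card_pairs _ (fun y z => r x (y, z))) big_mkcond /=.
  apply: eq_bigr => y _; rewrite inE /r /=; case: (adj x y) => /=; last by rewrite big1.
  by rewrite big_mkcond; apply: eq_bigr => z _; rewrite inE; case: (adj x z).
have [||||S Ss YS] := @dense_complete_pair _ _ r q s; rewrite ?q0 //.
- lia.
- by rewrite card_prod; under eq_bigr do rewrite -cr; rewrite mulnn -expnS.
pose r2 (y z : G) := [forall x in S, r x (y, z)].
have [||||S2 S2s YS2] := @dense_complete_pair _ _ r2 q1 s; rewrite ?q10 //.
- lia.
- rewrite -card_prod; apply: (leq_trans YS); rewrite leq_mul2l; apply/orP; right.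
  apply: eq_leq; transitivity #|[set p : G * G | r2 p.1 p.2]|.
    by apply: eq_card => p; rewrite !inE.
  rewrite (@card_pairs _ r2); apply: eq_bigr => y _; rewrite -sum1_card [RHS]big_mkcond /=; apply: eq_bigr => z _.
  by rewrite inE; case: (r2 y z).
pose S3 := [set z | [forall y in S2, r2 y z]].
have S3s : s <= #|S3|.
  have : q2 * s <= q2 * #|S3| by apply: leq_trans YS2; lia.
  by rewrite leq_pmul2l.
have tri x y z : x \in S -> y \in S2 -> z \in S3 -> r x (y, z).
  by move=> xS yS2; rewrite inE => /'forall_implyP/(_ y yS2)/'forall_implyP/(_ x xS).
have [x0 x0S] : exists x, x \in S by apply/card_gt0P; apply: leq_trans Ss.
have [y0 y0S] : exists x, x \in S2 by apply/card_gt0P; apply: leq_trans S2s.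
have [z0 z0S] : exists x, x \in S3 by apply/card_gt0P; apply: leq_trans S3s.
exists (fun i : 'I_3 => if i == 0 :> nat then S else if i == 1 :> nat then S2 else S3).
  move=> [[|[|[|//]]] ?] [[|[|[|//]]] ?] x y //= _ xA yA.
  - by case/and3P: (tri _ _ _ xA yA z0S).
  - by case/and3P: (tri _ _ _ xA y0S yA).
  - by rewrite adj_sym; case/and3P: (tri _ _ _ yA xA z0S).
  - by case/and3P: (tri _ _ _ x0S xA yA).
  - by rewrite adj_sym; case/and3P: (tri _ _ _ yA y0S xA).
  - by rewrite adj_sym; case/and3P: (tri _ _ _ x0S yA xA).
by move=> [[|[|[|//]]] ?].
Qed.

Lemma contains_tripartite (H G : sgraph) (k : H -> 'I_3) (A : 'I_3 -> {set G}) :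
  (forall x y, adj x y -> k x != k y) ->
  complete_tripartite A -> (forall i, #|H| <= #|A i|) -> contains G H.
Proof.
move=> kP cA Abig; pose g0 (v : H) := enum_val (widen_ord (Abig (k v)) (enum_rank v)).
have g0A v : g0 v \in A (k v) by apply: enum_valP.
exists g0; split=> [u v e|u v /kP ne]; last exact: cA (g0A u) (g0A v).
have [ek|nk] := eqVneq (k u) (k v); last first.
  by have := cA _ _ _ _ nk (g0A u) (g0A v); rewrite e adj_irr.
apply: enum_rank_inj; apply: val_inj; move: e.
rewrite /g0; move: (Abig (k u)); rewrite ek => bu; rewrite (bool_irrelevance bu (Abig (k v))).
by move/enum_val_inj => /(congr1 val).
Qed.

Section Stability.
Variable G : sgraph.

Definition inner_arcs (P : {set G}) := arcs P P + arcs (~: P) (~: P).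

Lemma disjointC (P : {set G}) : [disjoint P & ~: P].
Proof. by rewrite disjoints_subset setCK. Qed.

Lemma inner_arcsD1 (P : {set G}) v : v \in P ->
  inner_arcs (P :\ v) + (#|nbr v :&: P|).*2 = inner_arcs P + (#|nbr v :&: ~: P|).*2.
Proof.
move=> vP; rewrite /inner_arcs.
have cv : ~: (P :\ v) = v |: ~: P by apply/setP=> x; rewrite !inE; case: eqP => //= ->; rewrite vP.
have d1 : [disjoint [set v] & P :\ v] by rewrite disjoints1 !inE eqxx.
have d2 : [disjoint [set v] & ~: P] by rewrite disjoints1 !inE vP.
have a1 B : arcs [set v] B = #|nbr v :&: B| by rewrite /arcs big_set1.
have n0 (B : {set G}) : v \notin B -> #|nbr v :&: (v |: B)| = #|nbr v :&: B|.
  move=> vB; congr #|pred_of_set _|; apply/setP=> x; rewrite !inE.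
  by case: eqP => // ->; rewrite adj_irr.
have nP : #|nbr v :&: P| = #|nbr v :&: (P :\ v)|.
  by rewrite -{1}(setD1K vP) n0 // !inE eqxx.
have e1 : arcs P P = arcs (P :\ v) (P :\ v) + (#|nbr v :&: P|).*2.
  rewrite -{1 2}(setD1K vP) arcsDl // !arcsDr // -!(arcsC [set v]) !a1 nP -addnn.
  rewrite (_ : #|nbr v :&: [set v]| = 0); first lia.
  by apply/eqP; rewrite cards_eq0; apply/eqP/setP=> x; rewrite !inE; case: eqP=> [->|]; rewrite ?andbF ?adj_irr.
have e2 : arcs (~: (P :\ v)) (~: (P :\ v)) = arcs (~: P) (~: P) + (#|nbr v :&: ~: P|).*2.
  rewrite cv arcsDl // !arcsDr // -!(arcsC [set v]) !a1 -addnn.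
  rewrite (_ : #|nbr v :&: [set v]| = 0); first lia.
  by apply/eqP; rewrite cards_eq0; apply/eqP/setP=> x; rewrite !inE; case: eqP=> [->|]; rewrite ?andbF ?adj_irr.
by rewrite e1 e2; lia.
Qed.

Lemma inner_arcsC (P : {set G}) : inner_arcs (~: P) = inner_arcs P.
Proof. by rewrite /inner_arcs setCK addnC. Qed.

Lemma min_inner_partition (P0 : {set G}) : exists P : {set G},
  [/\ inner_arcs P <= inner_arcs P0,
      forall v, v \in P -> #|nbr v :&: P| <= #|nbr v :&: ~: P|
    & forall v, v \notin P -> #|nbr v :&: ~: P| <= #|nbr v :&: P|].
Proof.
pose P := [arg min_(P < P0) inner_arcs P].
have Pmin Q : inner_arcs P <= inner_arcs Q by rewrite /P; case: arg_minnP => // i _; apply.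
exists P; split=> // v vP.
  by have := inner_arcsD1 vP; have := Pmin (P :\ v); rewrite -!muln2; lia.
have vC : v \in ~: P by rewrite inE.
have := inner_arcsD1 vC; have := Pmin (~: P :\ v).
by rewrite setCK inner_arcsC -!muln2; lia.
Qed.

(* Furedi's argument: split at the neighbourhood of a vertex that has maximum
   degree among those contained in few triangles. *)
Lemma nbr_partition_inner R :
  0 < #|G| -> (forall v : G, #|G| <= 2 * #|nbr v|) ->
  R * #|[set x : G | #|G| ^ 2 <= R * arcs (nbr x) (nbr x)]| < #|G| ->
  exists x : G, R * inner_arcs (nbr x) <= 4 * #|G| ^ 2.
Proof.
move=> n0 hdeg; set Bad := [set x | _] => hBad; set n := #|G| in hdeg hBad n0 *.
have [->|R0] := posnP R; first by have [x _] := card_gt0P n0; exists x.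
have [x0 x0B] : exists x, x \in ~: Bad.
  by apply/card_gt0P; have := cardsC Bad; rewrite -/n; nia.
pose x := [arg max_(x > x0 in ~: Bad) #|nbr x|].
have [xB xmax] : x \in ~: Bad /\ forall y, y \in ~: Bad -> #|nbr y| <= #|nbr x|.
  by rewrite /x; case: arg_maxnP => // i iB imax; split.
exists x; rewrite /inner_arcs; set N := nbr x.
have cN : #|~: N| + #|N| = n by rewrite addnC cardsC.
have tx : R * arcs N N < n ^ 2 by move: xB; rewrite !inE -ltnNge.
have aG : n * n <= 2 * @arcs G setT setT.
  rewrite -sum_degE big_distrr /= {1}/n -sum1_card big_distrl /=; apply: leq_sum => v _.
  by rewrite mul1n.
have dsj := disjointC N.
have aT B : arcs setT B = arcs N B + arcs (~: N) B by rewrite -{1}(setUCr N) arcsDl.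
have aT' A : arcs A setT = arcs A N + arcs A (~: N) by rewrite -{1}(setUCr N) arcsDr.
(* By the choice of [x], a vertex outside [N] has degree at most [#|N|] unless it is bad. *)
have aA : arcs (~: N) setT <= #|~: N| * #|N| + n * #|Bad|.
  have -> : arcs (~: N) setT = \sum_(v in ~: N) #|nbr v| by apply: eq_bigr => v _; rewrite setIT.
  rewrite (big_setID Bad) /= addnC; apply: leq_add.
    apply: leq_trans (_ : \sum_(v in ~: N :\: Bad) #|N| <= _).
      by apply: leq_sum => v; rewrite !inE => /andP[vB _]; apply: xmax; rewrite !inE.
    by rewrite sum_nat_const leq_mul2r subset_leq_card ?orbT // subsetDl.
  apply: leq_trans (_ : \sum_(v in ~: N :&: Bad) n <= _).
    by apply: leq_sum => v _; apply: max_card.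
  by rewrite sum_nat_const mulnC leq_mul2l subset_leq_card ?orbT // subsetIr.
have eG : @arcs G setT setT = arcs N N + arcs (~: N) (~: N) + 2 * arcs (~: N) N.
  by rewrite aT !aT' (arcsC N (~: N)); lia.
have eA := aT' (~: N).
have sq : 4 * (#|~: N| * #|N|) <= n * n by rewrite -cN mulnn; case: (nat_AGM2 #|~: N| #|N|).
have hb : R * (n * #|Bad|) <= n * n by nia.
(* Twice [aA] is compared with the total number of arcs, which is at least [n ^ 2 / 2], hence at
   least [2 * #|~: N| * #|N|]; the product cancels. *)
have key : arcs (~: N) (~: N) <= 2 * (n * #|Bad|) + arcs N N by lia.
by nia.
Qed.
End Stability.

Lemma stability s R : 0 < s -> 0 < R ->
  exists n0, forall G : sgraph, n0 <= #|G| ->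
  (forall v : G, #|G| <= 2 * #|nbr v|) ->
  (forall A : 'I_3 -> {set G}, complete_tripartite A -> ~ (forall i, s <= #|A i|)) ->
  exists P : {set G},
  [/\ R * inner_arcs P <= #|G| ^ 2,
      forall v, v \in P -> #|nbr v :&: P| <= #|nbr v :&: ~: P|
    & forall v, v \notin P -> #|nbr v :&: ~: P| <= #|nbr v :&: P|].
Proof.
(* The 4 pays for the loss in [nbr_partition_inner]. Too many bad vertices would give triangle
   density [1 / (R' * R')], hence a large complete tripartite graph. *)
move=> s0 R0; pose R' := 4 * R.
have R'0 : 0 < R' * R' by rewrite /R'; nia.
have [n0 hn0] := dense_triangles_tripartite R'0 s0.
exists n0.+1 => G Gbig hdeg noT.
have hBad : R' * #|[set x : G | #|G| ^ 2 <= R' * arcs (nbr x) (nbr x)]| < #|G|.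
  rewrite ltnNge; apply/negP=> hB; set Bad := [set x | _] in hB.
  have [//||A cA Ab] := hn0 G; [exact: ltnW| |exact: (noT A cA)].
  have h1 : #|Bad| * #|G| ^ 2 <= R' * \sum_(x : G) arcs (nbr x) (nbr x).
    rewrite big_distrr /= -sum_nat_const; apply: leq_trans (_ : \sum_(x in Bad) R' * arcs (nbr x) (nbr x) <= _).
      by apply: leq_sum => x; rewrite inE.
    by rewrite [X in _ <= X](bigID (mem Bad)) /= leq_addr.
  rewrite expnS; apply: leq_trans (_ : (R' * #|Bad|) * #|G| ^ 2 <= _).
    by rewrite leq_mul2r hB orbT.
  by rewrite -(mulnA R') -(mulnA R') leq_mul2l h1 orbT.
have [|x hx] := nbr_partition_inner _ hdeg hBad; first by apply: leq_trans Gbig.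
have [P [Pm P1 P2]] := min_inner_partition (nbr x).
exists P; split=> //; move: hx; rewrite /R' -mulnA leq_pmul2l //.
by apply: leq_trans; rewrite leq_mul2l Pm orbT.
Qed.

(** * Embedding a ballooning *)

Lemma card_bigcup_leq (I T : finType) (P : pred I) (B : I -> {set T}) :
  #|\bigcup_(i | P i) B i| <= \sum_(i | P i) #|B i|.
Proof.
elim/big_rec2: _ => [|i m A _ h]; first by rewrite cards0.
by rewrite (leq_trans (leq_card_setU _ _)) // leq_add2l.
Qed.

Lemma exists_notin (T : finType) (A B : {set T}) :
  #|B| < #|A| -> exists2 x, x \in A & x \notin B.
Proof.
move=> lt; have /card_gt0P[x] : 0 < #|A :\: B|.
  by have := subset_leq_card (subsetIr A B); rewrite cardsD; lia.
by rewrite inE => /andP[]; exists x.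
Qed.

(** Vertices outside [X] are placed one by one. Each vertex already placed rules out itself and at
    most [m] further candidates, whence [#|F| * m.+1]. Adjacency to the images of [X] is not
    concluded; it has to be built into the candidate sets. *)
Lemma greedy_embedding (F G : sgraph) (X : {set F}) (C : F -> {set G}) (m : nat)
    (phi0 : F -> G) :
  (forall u v, u \notin X -> v \notin X -> adj u v ->
     forall x, x \in C u -> #|C v :\: nbr x| <= m) ->
  (forall u, u \notin X -> #|F| * m.+1 <= #|C u|) ->
  exists phi : F -> G,
  [/\ forall u, u \in X -> phi u = phi0 u,
      forall u, u \notin X -> phi u \in C u,
      {in ~: X &, injective phi}
    & forall u v, u \notin X -> v \notin X -> adj u v -> adj (phi u) (phi v)].
Proof.
move=> hm hC.
have : forall s : seq F, uniq s -> {subset s <= ~: X} ->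
    exists phi : F -> G,
    [/\ forall u, u \in X -> phi u = phi0 u,
        forall u, u \in s -> phi u \in C u, {in s &, injective phi}
      & forall u v, u \in s -> v \in s -> adj u v -> adj (phi u) (phi v)].
  elim=> [_ _|u s IH /= /andP[us uns] hs]; first by exists phi0.
  have [v vs|phi [p0 p1 p2 p3]] := IH uns; first by apply: hs; rewrite inE vs orbT.
  have uX : u \notin X by have := hs u (mem_head _ _); rewrite inE.
  have sX v : v \in s -> v \notin X.
    by move=> vs; have := hs v; rewrite !inE vs orbT => /(_ isT).
  pose bad v := phi v |: (if adj v u then C u :\: nbr (phi v) else set0).
  have [|x xC xB] := @exists_notin _ (C u) (\bigcup_(v in s) bad v).
    apply: leq_trans (hC u uX); apply: leq_ltn_trans (card_bigcup_leq _ _) _.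
    apply: leq_ltn_trans (_ : \sum_(v in s) m.+1 < _).
      apply: leq_sum => v vs; rewrite /bad cardsU1 -add1n leq_add ?leq_b1 //.
      by case: ifP => [/hm|]; rewrite ?cards0 // => -> //; [apply: sX| apply: p1].
    rewrite sum_nat_const ltn_pmul2r //; apply: proper_card; apply/properP; split.
      by apply/subsetP.
    by exists u.
  have xN v : v \in s -> x != phi v /\ (adj v u -> adj (phi v) x).
    move=> vs; have : x \notin bad v.
      by apply: contra xB => xb; apply/bigcupP; exists v.
    rewrite /bad !inE negb_or => /andP[-> xb]; split=> // vu.
    by move: xb; rewrite vu !inE xC andbT negbK.
  exists (fun v => if v == u then x else phi v); split.
  - by move=> v vX; case: eqP => [e|_]; [rewrite -e vX in uX | apply: p0].
  - by move=> v; rewrite inE; case: eqP => [-> //|_ /= /p1].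
  - move=> v w; rewrite !inE; case: eqP => [->|_]; case: eqP => [->|_] //=.
    + by move=> _ /xN[ne _] e; rewrite e eqxx in ne.
    + by move=> /xN[ne _] _ e; rewrite e eqxx in ne.
    + exact: p2.
  - move=> v w; rewrite !inE; case: eqP => [->|_]; case: eqP => [->|_] //=.
    + by rewrite adj_irr.
    + by move=> _ /xN[_ +]; rewrite adj_sym (adj_sym x).
    + by move=> /xN[_ +] _.
    + exact: p3.
case/(_ (enum (~: X)) (enum_uniq _)) => [u|phi [p0 p1 p2 p3]]; first by rewrite mem_enum.
exists phi; split=> //.
- by move=> u uX; apply: p1; rewrite mem_enum inE.
- by move=> u v uX vX; apply: p2; rewrite mem_enum.
- by move=> u v uX vX; apply: p3; rewrite mem_enum inE.
Qed.

Definition route (G : sgraph) (a c : G) (L : nat) (Z : {set G}) : Prop :=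
  exists s : seq G, [/\ size s = L, uniq s, path (@adj G) a (rcons s c)
    & forall x, x \in s -> x \notin Z].

Lemma route_sym (G : sgraph) (a c : G) L Z : route a c L Z -> route c a L Z.
Proof.
case=> s [sz us ps sZ]; exists (rev s); split; rewrite ?size_rev ?rev_uniq //.
  move: ps; rewrite -(eq_path (fun x y => adj_sym y x)) -(rev_path (@adj G)).
  by rewrite last_rcons belast_rcons rev_cons.
by move=> x; rewrite mem_rev => /sZ.
Qed.

Section Ballooning.
Variables (F : sgraph) (l : oedge F -> nat).

Lemma card_ballooning : #|ballooning l| = #|F| + \sum_(p : oedge F) (l p - 2).
Proof.
rewrite card_sum; congr (_ + _); rewrite card_tagged sumnE big_map big_enum /=.
by apply: eq_bigr => p _; rewrite card_ord.
Qed.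

Variable G : sgraph.

(** [g p] is the gadget reserved for the route of [p]. Routes are chosen one after the other,
    avoiding the image of [F], the gadgets of other edges and all earlier routes. As every new path
    has an inner vertex, at most [3 * #|ballooning l|] vertices are avoided. *)
Lemma embed_ballooning (phi : F -> G) (g : oedge F -> {set G}) :
  (forall p, 3 <= l p) -> injective phi ->
  (forall u v, adj u v -> adj (phi u) (phi v)) ->
  (forall p q, p != q -> [disjoint g p & g q]) ->
  (forall p u, phi u \notin g p) -> (forall p, #|g p| <= 2) ->
  (forall p (Z : {set G}), #|Z| <= 3 * #|ballooning l| -> [disjoint Z & g p] ->
     route (phi (val p).1) (phi (val p).2) (l p - 2) Z) ->
  contains G (ballooning l).
Proof.
move=> l3 phiI phiA gD gphi g2 routes.
have : forall es : seq (oedge F), uniq es -> exists sg : oedge F -> seq G,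
    [/\ forall p, p \in es -> [/\ size (sg p) = l p - 2, uniq (sg p),
          path (@adj G) (phi (val p).1) (rcons (sg p) (phi (val p).2))
        & forall x, x \in sg p -> (forall u, phi u != x) /\
            forall q, q != p -> x \notin g q]
    & forall p q x, p \in es -> q \in es -> p != q -> x \in sg p -> x \notin sg q].
  elim=> [_|p es IH /= /andP[pes ues]]; first by exists (fun _ => [::]).
  have [sg [sg1 sg2]] := IH ues.
  pose Z := (phi @: setT) :|: (\bigcup_(q | q != p) g q)
            :|: (\bigcup_(q in es) [set x in sg q]).
  have cZ : #|Z| <= 3 * #|ballooning l|.
    rewrite card_ballooning; apply: leq_trans (leq_card_setU _ _) _.
    apply: leq_trans (_ : #|F| + (\sum_(q : oedge F) 2) + \sum_(q : oedge F) (l q - 2) <= _).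
      apply: leq_add; first apply: leq_trans (leq_card_setU _ _) _; first apply: leq_add.
      - by rewrite -cardsT leq_imset_card.
      - apply: leq_trans (card_bigcup_leq _ _) _; rewrite [X in _ <= X](bigID (fun q => q != p)) /=.
        by apply: leq_trans (leq_addr _ _); apply: leq_sum => q _; apply: g2.
      apply: leq_trans (card_bigcup_leq _ _) _; rewrite [X in _ <= X](bigID (mem es)) /=.
      apply: leq_trans (leq_addr _ _); apply: leq_sum => q qes.
      by have [<- _ _ _] := sg1 q qes; rewrite cardsE card_size.
    have : \sum_(q : oedge F) 2 <= 2 * \sum_(q : oedge F) (l q - 2).
      rewrite big_distrr /=; apply: leq_sum => q _; have := l3 q; lia.
    lia.
  have dZ : [disjoint Z & g p].
    rewrite disjoints_subset; apply/subsetP=> x; rewrite !inE => /orP[/orP[]|].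
    - by case/imsetP=> u _ ->; apply: gphi.
    - by case/bigcupP=> q /gD /pred0P/(_ x) /= + xq; rewrite xq /= => ->.
    case/bigcupP=> q qes; rewrite inE => xq; have [_ _ _ /(_ x xq)[_]] := sg1 q qes.
    by apply; apply: contraNneq pes => ->.
  have [s [s1 s2 s3 s4]] := routes p Z cZ dZ.
  exists (fun q => if q == p then s else sg q); split.
    move=> q; rewrite inE; case: eqP => [-> _|_ /= /sg1 //]; split=> // x xs.
    have := s4 x xs; rewrite !inE !negb_or => /andP[/andP[h1 h2] _]; split.
      by move=> u; apply: contra h1 => /eqP <-; apply: imset_f.
    by move=> q' q'p; apply: contra h2 => xg; apply/bigcupP; exists q'.
  have sN q x : q \in es -> x \in s -> x \notin sg q.
    move=> qes xs; have := s4 x xs; rewrite !inE !negb_or => /andP[_ h].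
    by apply: contra h => xq; apply/bigcupP; exists q; rewrite ?inE.
  move=> q q' x; rewrite !inE; case: eqP => [->|_]; case: eqP => [->|_] //=.
  - by rewrite eqxx.
  - by move=> _ q'es _; apply: sN.
  - by move=> qes _ _ xq; apply/negP=> /(sN _ _ qes); rewrite xq.
  - exact: sg2.
case/(_ (enum (oedge F)) (enum_uniq _)) => sg [sg1 sg2].
have es p : p \in enum (oedge F) by rewrite mem_enum.
have {}sg1 p := sg1 p (es p); have {}sg2 p q x := sg2 p q x (es p) (es q).
pose h (x : F + new_vertex l) : G := match x with
  | inl u => phi u
  | inr w => nth (phi (val (tag w)).1) (sg (tag w)) (tagged w)
  end.
have hin (w : new_vertex l) : h (inr w) \in sg (tag w).
  by apply: mem_nth; have [-> _ _ _] := sg1 (tag w); apply: ltn_ord.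
have hphi (w : new_vertex l) u : phi u != h (inr w).
  by have [_ _ _ /(_ _ (hin w))[]] := sg1 (tag w).
have hI : injective h.
  move=> [u|w] [v|z] /= e.
  - by rewrite (phiI _ _ e).
  - by have := hphi z u; rewrite /= e eqxx.
  - by have := hphi w v; rewrite /= -e eqxx.
  case: w z e => [p i] [q j] /= e.
  have [epq|npq] := eqVneq p q; last first.
    have := sg2 _ _ _ npq (hin (Tagged (fun p => 'I_(l p - 2)) i)); rewrite /= e.
    by have := hin (Tagged (fun p => 'I_(l p - 2)) j); rewrite /= => ->.
  move: j e; rewrite -epq => j e; suff -> : i = j by []; apply: val_inj => /=.
  have [sz us _ _] := sg1 p.
  by apply/eqP; rewrite -(nth_uniq (phi (val p).1) _ _ us) ?sz ?e.
have hA x y : balloon_rel x y -> adj (h x) (h y).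
  case: x y => [u|w] [v|z] //=; first exact: phiA.
  - case: z => [p i] /=; have [sz us /(pathP (phi (val p).1)) pp _] := sg1 p.
    rewrite size_rcons sz in pp.
    case/orP=> /andP[/eqP -> /eqP ->].
      have lt0 : 0 < l p - 2 by have := l3 p; lia.
      by have := pp 0 isT; rewrite nth_rcons sz lt0.
    rewrite adj_sym; have /pp : l p - 2 < (l p - 2).+1 by [].
    rewrite [X in adj _ X]nth_rcons sz ltnn eqxx.
    have -> : l p - 2 = (l p - 3).+1 by have := l3 p; lia.
    have lt1 : l p - 3 < l p - 2 by have := l3 p; lia.
    by rewrite /= nth_rcons sz lt1.
  - case: w z => [p i] [q j] /= /andP[/eqP epq]; move: j; rewrite -epq => j /eqP eij.
    have [sz us /(pathP (phi (val p).1)) pp _] := sg1 p; rewrite size_rcons sz in pp.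
    have := pp j (leqW (ltn_ord j)); rewrite -eij /= !nth_rcons sz eij.
    by rewrite ltn_ord ltnW //.
exists h; split=> // x y /andP[_ /orP[|] /hA //].
by rewrite adj_sym.
Qed.

End Ballooning.

(** * Paths of prescribed parity *)

Lemma card_nbrI (G : sgraph) (v : G) (A : {set G}) :
  #|nbr v :&: A| + #|A :\: nbr v| = #|A|.
Proof. by rewrite setIC cardsID. Qed.

Section BalloonBounds.
Variables (F : sgraph) (l : oedge F -> nat) (f : nat).
Hypothesis hl : forall p, odd (l p) /\ 5 <= l p.

Lemma balloon_bounds : #|ballooning l| <= f ->
  #|F| + #|oedge F| <= f /\ forall p, l p - 2 <= f.
Proof.
rewrite card_ballooning => hs; split=> [|p].
  apply: leq_trans hs; rewrite leq_add2l -sum1_card; apply: leq_sum => p _.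
  by have [_] := hl p; lia.
by apply: leq_trans hs; rewrite (bigD1 p) //=; lia.
Qed.

(** Here the length at least five enters: a new path has three inner vertices, enough to contain a
    parity gadget, plus an even number of further ones. *)
Lemma odd_length p : l p - 2 = ((l p - 5)./2).*2 + 3.
Proof.
have [op l5] := hl p; have := odd_double_half (l p - 5).
by rewrite oddB // op /= add0n => ->; lia.
Qed.

End BalloonBounds.

Section Core.
Variables (G : sgraph) (P : {set G}).

Definition part (b : bool) : {set G} := [set v | (v \in P) == b].
Definition inn (v : G) : nat := #|nbr v :&: part (v \in P)|.
Definition crs (v : G) : nat := #|nbr v :&: part (~~ (v \in P))|.
Definition heavy (t : nat) : {set G} := [set v | t <= inn v].
Definition typical (t : nat) (b : bool) : {set G} := part b :\: heavy t.

Lemma in_part v b : (v \in part b) = ((v \in P) == b).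
Proof. by rewrite inE. Qed.

Lemma card_part b : #|part b| + #|part (~~ b)| = #|G|.
Proof.
rewrite -(cardsC (part b)); congr (_ + _); apply: eq_card => v.
by rewrite !inE; case: (v \in P); case: b.
Qed.

Lemma inn_crs v : inn v + crs v = #|nbr v|.
Proof.
rewrite -(cardsID (part (v \in P)) (nbr v)); congr (_ + _); apply: eq_card => u.
by rewrite !inE; case: (u \in P); case: (v \in P); rewrite ?andbT ?andbF.
Qed.

(* [t3] bounds the inner degree of a typical vertex and the number of vertices
   that are not typical; vertices of inner degree at least [t2] or [t1] act as
   vertices of the small set joined to both parts. *)
Variables (t1 t2 t3 f : nat).
Hypothesis hdeg : forall v : G, #|G| <= 2 * #|nbr v|.
Hypothesis hcut : forall v, inn v <= crs v.
Hypothesis hheavy : #|heavy t3| <= t3.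
Hypothesis f0 : 0 < f.
Hypothesis ft3 : 100 * f <= t3.
Hypothesis ft2 : 100 * (f * t3) <= t2.
Hypothesis ft1 : 100 * (f * t2) <= t1.
Hypothesis ftn : 100 * (f * t1) <= #|G|.

Local Notation Q := (typical t3).

Lemma scale : [/\ 100 <= t3, 100 * t3 <= t2, 100 * t2 <= t1 & 100 * t1 <= #|G|].
Proof. by clear -f0 ft3 ft2 ft1 ftn; split; nia. Qed.

Lemma typical_part v b : v \in Q b -> (v \in P) = b.
Proof. by rewrite !inE => /andP[_ /eqP]. Qed.

Lemma part_typical b : #|part b| <= #|Q b| + t3.
Proof.
rewrite -(cardsID (heavy t3) (part b)) addnC leq_add2l.
by apply: leq_trans hheavy; rewrite subset_leq_card ?subsetIr.
Qed.

Lemma typical_crs v : inn v < t3 -> #|G| <= 2 * #|part (~~ (v \in P))| + 2 * t3.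
Proof.
move=> hv; have := hdeg v; rewrite -inn_crs.
have : crs v <= #|part (~~ (v \in P))| by rewrite subset_leq_card ?subsetIr.
lia.
Qed.

(** A vertex that is not heavy sends almost all of its at least [#|G| / 2] edges across, so the part
    opposite to it is large. Such a vertex exists because few are heavy; the large part opposite to
    it contains another, which bounds the remaining part. *)
Lemma part_lb b : #|G| <= 2 * #|part b| + 2 * t3.
Proof.
have [h3 h2 h1 hn] := scale.
suff [v vb hv] : exists2 v, (v \in P) = ~~ b & inn v < t3.
  by have := typical_crs hv; rewrite vb negbK.
have [|v _] := @exists_notin _ setT (heavy t3); first by rewrite cardsT; lia.
rewrite inE -ltnNge => hv; have [e|ne] := eqVneq (v \in P) (~~ b); first by exists v.
have [|u uP] := @exists_notin _ (part (~~ b)) (heavy t3).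
  have := typical_crs hv; have -> : ~~ (v \in P) = ~~ b by case: (v \in P) ne; case: b.
  by lia.
by rewrite inE -ltnNge => hu; exists u => //; apply/eqP; rewrite -in_part.
Qed.

Lemma part_ub b : 2 * #|part b| <= #|G| + 2 * t3.
Proof. by have := part_lb (~~ b); have := card_part b; lia. Qed.

Lemma typical_lb b : #|G| <= 2 * #|Q b| + 4 * t3.
Proof. by have := part_lb b; have := part_typical b; lia. Qed.

(** The degree is at least half the order, fewer than [t] edges stay inside, and no part exceeds
    half the order by more than [t3]. *)
Lemma part_miss v t : inn v < t -> #|part (~~ (v \in P)) :\: nbr v| <= t + t3.
Proof.
move=> hv; have := card_nbrI v (part (~~ (v \in P))); rewrite -/(crs v).
by have := part_ub (~~ (v \in P)); have := hdeg v; rewrite -inn_crs; lia.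
Qed.

Lemma typical_miss v b t : inn v < t -> (v \in P) = b -> #|Q (~~ b) :\: nbr v| <= t + t3.
Proof.
move=> hv <-; apply: leq_trans (part_miss hv); apply: subset_leq_card.
by apply: setSD; apply: subsetDl.
Qed.

Lemma typical_miss2 v b : v \in Q b -> #|Q (~~ b) :\: nbr v| <= 2 * t3.
Proof.
move=> vQ; have vb := typical_part vQ; move: vQ; rewrite !inE -ltnNge => /andP[hv _].
by have := typical_miss hv vb; lia.
Qed.

(** By [hcut] the cross degree is at least the inner degree, so a heavy vertex sees many vertices on
    both sides. *)
Lemma heavy_typical z t b : z \in heavy t -> t <= #|nbr z :&: Q b| + t3.
Proof.
rewrite inE => hz; have hzb : t <= #|nbr z :&: part b|.
  have := hcut z; rewrite /crs; move: hz; rewrite /inn.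
  by case: (z \in P); case: b => //=; apply: leq_trans.
apply: leq_trans hzb _; rewrite -(cardsID (heavy t3) (nbr z :&: part b)) addnC leq_add //.
  by rewrite subset_leq_card // setIDA.
by apply: leq_trans hheavy; rewrite subset_leq_card ?subsetIr.
Qed.

Lemma pick_outside (A Z : {set G}) m : m < #|A| -> #|Z| <= m ->
  exists2 x, x \in A & x \notin Z.
Proof. by move=> h1 h2; apply: exists_notin; apply: leq_ltn_trans h1. Qed.

Lemma route_cons2 a p q c L (Z : {set G}) :
  adj a p -> adj p q -> p \notin Z -> q \notin Z ->
  route q c L (Z :|: [set p; q]) -> route a c L.+2 Z.
Proof.
move=> ap pq pZ qZ [s [sz us ps sZ]].
have sN x : x \in s -> [&& x \notin Z, x != p & x != q].
  by move/sZ; rewrite !inE !negb_or.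
exists [:: p, q & s]; split=> /=; first by rewrite sz.
- rewrite !inE negb_or us (adj_neq pq) andbT /=; apply/andP; split.
    by apply/negP=> /sN; rewrite eqxx andbF.
  by apply/negP=> /sN; rewrite eqxx !andbF.
- by rewrite ap pq.
by move=> x; rewrite !inE => /or3P[/eqP->|/eqP->|/sN/and3P[]].
Qed.

(** One extension by two vertices: [a] is replaced by a typical [q] on side [~~ b], adjacent to
    almost all of [Q b]. [Y] protects vertices needed later, such as the ends of a parity edge. *)
Lemma route_ext b a c L (Z Y : {set G}) :
  #|Z| + #|Y| <= 2 * t3 -> 4 * t3 <= #|nbr a :&: Q b| ->
  (forall p q, q \in Q (~~ b) -> p \notin Y -> q \notin Y ->
     route q c L (Z :|: [set p; q])) ->
  route a c L.+2 Z.
Proof.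
move=> hZ ha hr; have [h3 h2 h1 hn] := scale.
have cZY : #|Z :|: Y| <= 2 * t3 by apply: leq_trans (leq_card_setU _ _) hZ.
have [|p] := @pick_outside (nbr a :&: Q b) _ (2 * t3) _ cZY; first by apply: leq_trans ha; lia.
rewrite inE in_nbr => /andP[ap pQ]; rewrite inE negb_or => /andP[pZ pY].
have [|q] := @pick_outside (nbr p :&: Q (~~ b)) _ (2 * t3) _ cZY.
  have := card_nbrI p (Q (~~ b)); have := typical_miss2 pQ.
  by have := typical_lb (~~ b); lia.
rewrite inE in_nbr => /andP[pq qQ]; rewrite inE negb_or => /andP[qZ qY].
by apply: (route_cons2 ap pq) => //; apply: hr.
Qed.

Lemma card_setU2 (Z : {set G}) p q : #|Z :|: [set p; q]| <= #|Z| + 2.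
Proof.
apply: leq_trans (leq_card_setU _ _) _; rewrite leq_add2l cards2.
by case: (p != q).
Qed.

(** The shortest case is [a], [x], [m], [y], [c] with [x] and [y] typical on side [b] and [m] a
    common typical neighbour on the other side. *)
Lemma route_same b k a c (Z : {set G}) :
  4 * t3 <= #|nbr a :&: Q b| -> 4 * t3 <= #|nbr c :&: Q b| ->
  #|Z| + k.*2 <= t3 -> route a c (k.*2 + 3) Z.
Proof.
have [h3 h2 h1 hn] := scale.
elim: k a Z => [|k IH] a Z ha hc hZ.
  have [||x] := @pick_outside (nbr a :&: Q b) Z t3; [lia|lia|].
  rewrite inE in_nbr => /andP[ax xQ] xZ.
  have [||y] := @pick_outside (nbr c :&: Q b) (x |: Z) t3.+1; first lia.
    by rewrite cardsU1; lia.
  rewrite !inE !negb_or => /andP[cy yQ] /andP[yx yZ].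
  have {}yQ : y \in Q b by rewrite !inE.
  have [||m] := @pick_outside (nbr x :&: (nbr y :&: Q (~~ b))) Z t3; [|lia|].
    have := card_nbrI y (Q (~~ b)); have := typical_miss2 yQ.
    have := card_nbrI x (nbr y :&: Q (~~ b)); have := typical_miss2 xQ.
    have : #|(nbr y :&: Q (~~ b)) :\: nbr x| <= #|Q (~~ b) :\: nbr x|.
      by rewrite subset_leq_card // setSD ?subsetIr.
    by have := typical_lb (~~ b); lia.
  rewrite !in_setI !in_nbr => /and3P[xm ym mQ] mZ.
  exists [:: x; m; y]; split=> //=.
  - by rewrite !inE !negb_or (adj_neq xm) (eq_sym x) yx eq_sym (adj_neq ym).
  - by rewrite ax xm (adj_sym m) ym adj_sym cy.
  - by move=> z; rewrite !inE => /or3P[] /eqP->.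
rewrite doubleS !addSn; apply: (@route_ext b a c _ Z set0) => //; first by rewrite cards0; lia.
move=> p q qQ _ _; apply: IH => //; last by have := card_setU2 Z p q; lia.
have := typical_miss2 qQ; rewrite negbK => hq.
by have := card_nbrI q (Q b); have := typical_lb b; lia.
Qed.

(** The shortest case is [a], [m], [x], [y], [c]; when [x] and [y] lie on one side, the edge between
    them changes the parity. The bound [6 * t3] leaves [4 * t3] common neighbours once [a] is
    replaced by a typical vertex, which misses at most [2 * t3]. *)
Lemma route_edge b k a c x y (Z : {set G}) :
  4 * t3 <= #|nbr x :&: (nbr a :&: Q b)| -> 6 * t3 <= #|nbr x :&: Q b| ->
  adj x y -> adj y c -> x \notin Z -> y \notin Z ->
  #|Z| + k.*2 <= t3 -> route a c (k.*2 + 3) Z.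
Proof.
have [h3 h2 h1 hn] := scale.
elim: k a Z => [|k IH] a Z ha hx xy yc xZ yZ hZ.
  have [||m] := @pick_outside (nbr x :&: (nbr a :&: Q b)) (y |: Z) t3.+1; first lia.
    by rewrite cardsU1; lia.
  rewrite in_setI in_nbr in_setI in_nbr => /and3P[xm am mQ].
  rewrite !inE negb_or => /andP[my mZ].
  exists [:: m; x; y]; split=> //=.
  - by rewrite !inE !negb_or (eq_sym m x) (adj_neq xm) my (adj_neq xy).
  - by rewrite am (adj_sym m) xm xy yc.
  - by move=> z; rewrite !inE => /or3P[] /eqP->.
rewrite doubleS !addSn; apply: (@route_ext b a c _ Z [set x; y]).
- by rewrite cards2; case: (x != y); lia.
- by apply: leq_trans ha _; rewrite subset_leq_card ?subsetIr.
move=> p q qQ; rewrite !inE !negb_or => /andP[px py] /andP[qx qy].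
apply: IH => //; last by have := card_setU2 Z p q; lia.
- have := typical_miss2 qQ; rewrite negbK => hq.
  have := card_nbrI q (nbr x :&: Q b).
  have : #|(nbr x :&: Q b) :\: nbr q| <= #|Q b :\: nbr q|.
    by rewrite subset_leq_card // setSD ?subsetIr.
  by rewrite setICA; clear -hx hq; lia.
- by rewrite !inE !negb_or xZ !(eq_sym x) px qx.
- by rewrite !inE !negb_or yZ !(eq_sym y) py qy.
Qed.

(** A heavy [z] has neighbours on both sides: it is entered from side [b] and left, through [y], on
    the other side. *)
Lemma route_vertex b k a c z (Z : {set G}) :
  4 * t3 <= #|nbr z :&: (nbr a :&: Q b)| -> 6 * t3 <= #|nbr z :&: Q b| ->
  4 * t3 <= #|nbr z :&: (nbr c :&: Q (~~ b))| -> z \notin Z ->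
  #|Z| + k.*2 <= t3 -> route a c (k.*2 + 3) Z.
Proof.
move=> ha hz hc zZ hZ; have [h3 h2 h1 hn] := scale.
have [||y] := @pick_outside (nbr z :&: (nbr c :&: Q (~~ b))) Z t3; [lia|lia|].
rewrite in_setI in_nbr in_setI in_nbr => /and3P[zy cy yQ] yZ.
by apply: (route_edge ha hz zy _ zZ yZ hZ); rewrite adj_sym.
Qed.

(** * Embedding all of F together with its parity gadgets *)

Section Embedding.
Variables (F : sgraph) (l : oedge F -> nat).
Hypothesis hl : forall p, odd (l p) /\ 5 <= l p.
Hypothesis hf : #|ballooning l| <= f.

Local Notation e1 p := (val p).1.
Local Notation e2 p := (val p).2.

(** [phi0] places the vertices of [X] in advance, those of [D] on heavy vertices. [c] is the
    intended side of the vertices outside [D], and [T] bounds the inner degrees of the ends of a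
    gadget edge. *)
Variables (X D : {set F}) (c : F -> bool) (phi0 : F -> G) (T : nat).

Definition gadget_set (g : G * G) : {set G} := [set g.1; g.2].

(* A gadget changes the parity of a path between the two parts: it is either a
   heavy vertex, coded as a pair [(z, z)], or an edge inside a part. *)
Definition gadget (g : G * G) : Prop :=
  [/\ g.1 = g.2, g.1 \in heavy t2 & X = D] \/
  [/\ adj g.1 g.2, (g.1 \in P) = (g.2 \in P), inn g.1 < T, inn g.2 < T
    & forall u, u \in X -> u \notin D -> c u = (g.1 \in P)].

(** The new path along an edge has even length, so it must change parity when its ends go to
    opposite sides and neither is heavy. *)
Definition parity_edges : {set oedge F} :=
  [set p | [&& e1 p \notin D, e2 p \notin D & c (e1 p) != c (e2 p)]].

Definition candidates (u : F) : {set G} :=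
  [set x in Q (c u) | [forall v in X, adj u v ==> adj (phi0 v) x]].

(** A gadget edge is left directly towards the end on the opposite side, so that end must be
    adjacent to it. This is arranged when the free vertices are chosen, and is the reason why the
    vertices of [X] outside [D] have to lie on the side of the gadget edges. *)
Lemma embed_with_gadgets (gs : seq (G * G)) :
  T <= t1 -> D \subset X ->
  (forall u v, adj u v -> u \notin X -> v \notin D -> c u != c v) ->
  {in X &, injective phi0} ->
  (forall u v, u \in X -> v \in X -> adj u v -> adj (phi0 u) (phi0 v)) ->
  (forall u, u \in D -> phi0 u \in heavy t2) ->
  (forall u, u \in X -> u \notin D -> (phi0 u \in P) = c u /\ inn (phi0 u) < t1) ->
  (forall g, g \in gs -> gadget g) ->
  (forall g u, g \in gs -> u \in X -> phi0 u \notin gadget_set g) ->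
  pairwise (fun g h => [disjoint gadget_set g & gadget_set h]) gs ->
  #|parity_edges| <= size gs ->
  (forall u, u \notin X -> f * (T + 7 * t3) <= #|candidates u|) ->
  contains G (ballooning l).
Proof.
move=> hT /subsetP hDX hc phi0I phi0A hD hXD hgs hgX hpw hsz hcand.
have [h3 h2 h1 hn] := scale; have [hF hlp] := balloon_bounds hl hf.
set E := parity_edges in hsz.
(* Gadgets are assigned by position in the list of parity edges; for these the default value is
   never reached, since there are enough gadgets. *)
pose ga p := nth (phi0 (e1 p), phi0 (e1 p)) gs (index p (enum E)).
have idx p : p \in E -> index p (enum E) < size gs.
  by move=> pE; apply: leq_trans hsz; rewrite cardE index_mem mem_enum.
have gaIn p : p \in E -> ga p \in gs by move=> pE; apply: mem_nth; apply: idx.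
have gaD p q : p \in E -> q \in E -> p != q -> [disjoint gadget_set (ga p) & gadget_set (ga q)].
  have aux p' q' : p' \in E -> q' \in E -> index p' (enum E) < index q' (enum E) ->
      [disjoint gadget_set (ga p') & gadget_set (ga q')].
    move=> pE qE lt; have := pairwiseP (phi0 (e1 p'), phi0 (e1 p')) hpw.
    move=> /(_ _ _ (idx p' pE) (idx q' qE) lt); rewrite /ga.
    by rewrite (set_nth_default (phi0 (e1 p'), phi0 (e1 p')) _ (idx q' qE)).
  move=> pE qE npq; case: (ltngtP (index p (enum E)) (index q (enum E))) => h.
  - exact: aux.
  - by rewrite disjoint_sym; apply: aux.
  - by case/eqP: npq; rewrite -(nth_index p (s := enum E) (x := p)) ?mem_enum // h nth_index ?mem_enum.
pose used := phi0 @: X :|: \bigcup_(p in E) gadget_set (ga p).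
(* Besides the vertices in use, a free vertex on side [c u] avoids the nonneighbours of the second
   end of every gadget edge on the opposite side. *)
pose bad u := used :|: \bigcup_(p in E | ((ga p).1 != (ga p).2) &&
   (((ga p).2 \in P) == ~~ c u)) (part (c u) :\: nbr (ga p).2).
pose C u := candidates u :\: bad u.
have gset2 g : #|gadget_set g| <= 2 by rewrite cards2; case: (_ != _).
have cbad u : #|bad u| <= f * (T + t3 + 3).
  have cE : #|E| <= #|oedge F| by apply: max_card.
  apply: leq_trans (leq_card_setU _ _) _.
  have u1 : #|used| <= #|F| + 2 * #|E|.
    apply: leq_trans (leq_card_setU _ _) _; apply: leq_add.
      by apply: leq_trans (leq_imset_card _ _) _; apply: max_card.
    apply: leq_trans (card_bigcup_leq _ _) _; rewrite mulnC -sum_nat_const.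
    by apply: leq_sum => p _; apply: gset2.
  set B := \bigcup_(p in E | _) _.
  have u2 : #|B| <= #|E| * (T + t3).
    apply: leq_trans (card_bigcup_leq _ _) _; rewrite -sum_nat_const big_mkcondr /=.
    apply: leq_sum => p pE; case: ifP => // /andP[ne /eqP sd].
    case: (hgs _ (gaIn _ pE)) => [[e _ _]|[_ _ _ hy _]]; first by rewrite e eqxx in ne.
    by have := part_miss hy; rewrite sd negbK.
  by nia.
have CQ u x : x \in C u -> x \in Q (c u) by rewrite !inE => /andP[_ /andP[]].
have cF : #|F| <= f by lia.
(* At most [f * (T + t3 + 3)] candidates are lost and [#|F| * (2 * t3).+1] must remain;
   [f * (T + 7 * t3)] covers both. *)
have [u v uX vX uv x xC|u uX|phi [p0 p1 p2 p3]] := @greedy_embedding F G X C (2 * t3) phi0.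
- have vD : v \notin D by apply: contra vX; apply: hDX.
  have ncv : c v = ~~ c u by have := hc u v uv uX vD; case: (c u); case: (c v).
  apply: leq_trans (typical_miss2 (CQ _ _ xC)); apply: subset_leq_card.
  by rewrite -ncv; apply: setSD; apply/subsetP=> y; apply: CQ.
- have := hcand u uX; rewrite -(cardsID (bad u)) -/(C u) => hcu.
  have := cbad u; have : #|candidates u :&: bad u| <= #|bad u| by rewrite subset_leq_card ?subsetIr.
  by nia.
have phiN u : u \notin X -> phi u \notin used.
  by move=> /p1; rewrite !inE !negb_or => /andP[/andP[/andP[-> ->]]].
have phiY u p : u \notin X -> p \in E -> (ga p).1 != (ga p).2 ->
    ((ga p).2 \in P) = ~~ c u -> adj (ga p).2 (phi u).
  move=> uX pE ne sd; have := p1 u uX; rewrite inE => /andP[hb hca].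
  have uP : phi u \in part (c u) by rewrite in_part (typical_part (CQ _ _ (p1 u uX))).
  move: hb; rewrite inE negb_or => /andP[_]; apply: contraNT => na; apply/bigcupP.
  by exists p; rewrite ?pE ?ne ?sd ?eqxx // inE in_nbr na.
have phiI : injective phi.
  move=> u v; case: (boolP (u \in X)) (boolP (v \in X)) => uX [] vX.
  - by rewrite !p0 //; apply: phi0I.
  - rewrite (p0 u uX) => e; have := phiN v vX; rewrite -e !inE negb_or.
    by rewrite imset_f.
  - rewrite (p0 v vX) => e; have := phiN u uX; rewrite e !inE negb_or.
    by rewrite imset_f.
  - by apply: p2; rewrite inE.
have phiA u v : adj u v -> adj (phi u) (phi v).
  have XN u' v' : adj u' v' -> u' \in X -> v' \notin X -> adj (phi u') (phi v').
    move=> uv uX vX; have := p1 v' vX; rewrite inE => /andP[_].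
    rewrite inE => /andP[_ /'forall_implyP/(_ u' uX)].
    by rewrite (adj_sym v') uv (p0 u').
  move=> uv; case: (boolP (u \in X)) (boolP (v \in X)) => uX [] vX.
  - by rewrite !p0 //; apply: phi0A.
  - exact: XN.
  - by rewrite adj_sym; apply: XN => //; rewrite adj_sym.
  - exact: p3.
have gX p u : p \in E -> phi u \notin gadget_set (ga p).
  move=> pE; case: (boolP (u \in X)) => uX; first by rewrite p0 // hgX // gaIn.
  apply: contra (phiN u uX) => h; rewrite inE; apply/orP; right.
  by apply/bigcupP; exists p.
have phiD u b : u \in D -> 6 * t3 <= #|nbr (phi u) :&: Q b|.
  move=> uD; have := heavy_typical b (hD u uD); rewrite (p0 u (hDX u uD)); clear -h2 h3; lia.
have phiS u : u \notin D -> (phi u \in P) = c u /\ inn (phi u) < t1.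
  move=> uD; case: (boolP (u \in X)) => uX; first by rewrite p0 //; apply: hXD.
  have := CQ _ _ (p1 u uX) => hq; split; first exact: typical_part hq.
  by move: hq; rewrite !inE -ltnNge => /andP[h _]; lia.
have phiM u : u \notin D -> #|Q (~~ c u) :\: nbr (phi u)| <= t1 + t3.
  by move=> /phiS[sd hi]; apply: typical_miss.
have phiL u : u \notin D -> 6 * t3 <= #|nbr (phi u) :&: Q (~~ c u)|.
  move=> /phiM; have := card_nbrI (phi u) (Q (~~ c u)); have := typical_lb (~~ c u); clear -h1 h2 h3 hn; lia.
have phiQ u : u \notin X -> phi u \in Q (c u) by move=> uX; apply: CQ; apply: p1.
pose g p := if p \in E then gadget_set (ga p) else set0.
apply: (@embed_ballooning F l G phi g) => //.
- by move=> p; have [_] := hl p; lia.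
- move=> p q npq; rewrite /g; case: (boolP (p \in E)) => pE; last by rewrite disjoints_subset sub0set.
  case: (boolP (q \in E)) => qE; last by rewrite disjoint_sym disjoints_subset sub0set.
  exact: gaD.
- by move=> p u; rewrite /g; case: ifP => [pE|_]; [apply: gX|rewrite inE].
- by move=> p; rewrite /g; case: ifP; rewrite ?cards0.
move=> p Z cZ dZ; rewrite (odd_length hl).
have {}cZ : #|Z| + ((l p - 5)./2).*2 <= t3.
  have := odd_length hl p; have := hlp p; have := hf; clear -cZ ft3; lia.
have leq46 m : 6 * t3 <= m -> 4 * t3 <= m by clear; lia.
case: (boolP (p \in E)) dZ => pE; rewrite /g ?pE ?(negbTE pE); last first.
  move=> _; suff [b b1 b2] : exists2 b, 4 * t3 <= #|nbr (phi (e1 p)) :&: Q b|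
      & 4 * t3 <= #|nbr (phi (e2 p)) :&: Q b| by apply: (route_same b1 b2).
  case: (boolP (e1 p \in D)) => d1; case: (boolP (e2 p \in D)) => d2.
  - by exists true; [have := phiD _ true d1|have := phiD _ true d2]; apply: leq46.
  - by exists (~~ c (e2 p)); [have := phiD _ (~~ c (e2 p)) d1|have := phiL _ d2]; apply: leq46.
  - by exists (~~ c (e1 p)); [have := phiL _ d1|have := phiD _ (~~ c (e1 p)) d2]; apply: leq46.
  - have ce : c (e1 p) = c (e2 p) by move: pE; rewrite inE d1 d2 /= negbK => /eqP.
    by exists (~~ c (e1 p)); [have := phiL _ d1|have := phiL _ d2; rewrite ce]; apply: leq46.
move=> dZ; have [z1 z2] : (ga p).1 \notin Z /\ (ga p).2 \notin Z.
  by move/pred0P: dZ => dZ; split; apply/negP=> hz;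
    [have := dZ (ga p).1|have := dZ (ga p).2]; rewrite /= hz !inE eqxx ?orbT.
have /and3P[d1 d2 ne] : [&& e1 p \notin D, e2 p \notin D & c (e1 p) != c (e2 p)].
  by move: pE; rewrite inE.
case: (hgs _ (gaIn p pE)) => [[ez hz eX]|[xy sxy hx hy hXc]].
  (* For a heavy gadget [X = D], so both ends are free and therefore typical; each misses few of the
     gadget's neighbours on the opposite side. *)
  rewrite -eX in d1 d2.
  have c2 : c (e2 p) = ~~ c (e1 p) by case: (c _) (c _) ne => [] [].
  have m1 := typical_miss2 (phiQ _ d1); have m2 := typical_miss2 (phiQ _ d2).
  rewrite c2 negbK in m2.
  have cm a b' : #|Q b' :\: nbr a| <= 2 * t3 ->
      4 * t3 <= #|nbr (ga p).1 :&: (nbr a :&: Q b')|.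
    move=> hm; have := card_nbrI a (nbr (ga p).1 :&: Q b').
    have := heavy_typical b' hz; rewrite setICA.
    have : #|nbr (ga p).1 :&: Q b' :\: nbr a| <= #|Q b' :\: nbr a|.
      by rewrite subset_leq_card // setSD ?subsetIr.
    by clear -hm h2 h3; lia.
  apply: (@route_vertex (~~ c (e1 p)) _ _ _ (ga p).1) => //.
  - exact: cm.
  - by have := heavy_typical (~~ c (e1 p)) hz; clear -h2 h3; lia.
  - by rewrite negbK; apply: cm.
(* [u] is the end on the side of the gadget edge and [v] the opposite one, which is free and hence
   adjacent to the second end of the gadget. The other orientation of [p] is handled by reversing
   the route. *)
have key u v : u \notin D -> v \notin D -> c u = ((ga p).1 \in P) ->
    c v = ~~ ((ga p).1 \in P) -> route (phi u) (phi v) ((l p - 5)./2.*2 + 3) Z.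
  move=> uD vD cu cv.
  have vX : v \notin X by apply/negP=> vX; have := hXc v vX vD; rewrite cv; case: (_ \in _).
  have hxm := typical_miss hx (erefl _).
  apply: (@route_edge (~~ c u) _ _ _ (ga p).1 (ga p).2) => //.
  - have := phiM u uD; rewrite cu.
    have := card_nbrI (phi u) (nbr (ga p).1 :&: Q (~~ ((ga p).1 \in P))).
    have := card_nbrI (ga p).1 (Q (~~ ((ga p).1 \in P))).
    set Q' := Q _ in hxm *; rewrite (setICA (nbr (ga p).1)).
    have : #|nbr (ga p).1 :&: Q' :\: nbr (phi u)| <= #|Q' :\: nbr (phi u)|.
      by rewrite subset_leq_card // setSD ?subsetIr.
    have : #|G| <= 2 * #|Q'| + 4 * t3 by apply: typical_lb.
    by clear -hxm h1 h2 h3 hn hT; lia.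
  - rewrite cu; have := card_nbrI (ga p).1 (Q (~~ ((ga p).1 \in P))).
    by have := typical_lb (~~ ((ga p).1 \in P)); clear -hxm h1 h2 h3 hn hT; lia.
  - by apply: phiY => //; rewrite ?(adj_neq xy) // cv negbK.
have [ce|ce] := eqVneq (c (e1 p)) ((ga p).1 \in P).
  by apply: key => //; move: ne; rewrite ce; case: (_ \in _); case: (c _).
apply: route_sym; apply: key => //; move: ne ce.
all: by case: (c (e1 p)); case: (c (e2 p)); case: (_ \in _).
Qed.

End Embedding.

End Core.

(** * Forests and even cycles *)

(** All neighbours in [A] of the first vertex of a longest path in [A] lie on that path; one besides
    its successor would close a cycle. *)
Lemma acyclic_leaf (G : sgraph) (A : {set G}) : acyclic G -> A != set0 ->
  exists2 v, v \in A & #|nbr v :&: A| <= 1.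
Proof.
move=> acG /set0Pn[v0 v0A].
have [/existsP[v /andP[]]|] := boolP [exists v in A, #|nbr v :&: A| <= 1]; first by exists v.
rewrite negb_exists => /forallP nleaf; exfalso.
pose pth (s : seq G) := [&& uniq s, all (mem A) s & sorted (@adj G) s].
pose Pn n := [exists s : n.-tuple G, pth s].
have exP : exists n, Pn n by exists 1; apply/existsP; exists [tuple v0]; rewrite /pth /= v0A.
have ubP n : Pn n -> n <= #|G|.
  case/existsP=> s /and3P[us _ _]; rewrite -(size_tuple s) -(card_uniqP us); exact: max_card.
case: (ex_maxnP exP ubP) => N /existsP[s ps] Nmax.
have {}Nmax (s' : seq G) : pth s' -> size s' <= N.
  by move=> ps'; apply: Nmax; apply/existsP; exists (in_tuple s').
have szs : size s = N by rewrite size_tuple.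
case: (tval s) ps szs => [|x p]; first by move=> _ e; have := Nmax [:: v0]; rewrite /pth /= v0A -e => /(_ isT).
move=> /and3P[/= /andP[xp up] /andP[xA pA] pp] sz.
have nx : forall z, z \in nbr x :&: A -> z \in p.
  move=> z; rewrite !inE => /andP[xz zA]; apply: contraT => zp.
  have := Nmax [:: z, x & p]; rewrite /pth /= !inE (negbTE zp) xp up zA xA pA adj_sym xz pp sz.
  by rewrite orbF eq_sym (adj_neq xz) => /(_ isT); rewrite ltnn.
have c2 : 1 < #|nbr x :&: A| by have := nleaf x; rewrite xA /= -ltnNge.
case: p => [|y p] in xp up pA pp sz nx *.
  by have /card_gt0P[z /nx] : 0 < #|nbr x :&: A| by lia.
have /card_gt0P[z] : 0 < #|(nbr x :&: A) :\ y|.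
  by have := cardsD1 y (nbr x :&: A); lia.
rewrite in_setD1 => /andP[zy znx]; have := nx z znx; rewrite inE (negbTE zy) /= => zp.
case/splitPr: zp xp up pp => p1 p2 xp up pp.
apply: (acG (x :: y :: rcons p1 z)); first by rewrite /= size_rcons.
apply/andP; split.
  rewrite /= rcons_path last_rcons; move: pp; rewrite /= cat_path /= rcons_path.
  case/and4P=> -> -> -> _; rewrite /= adj_sym.
  by move: znx; rewrite !inE => /andP[].
have : uniq ((x :: y :: rcons p1 z) ++ p2) by rewrite /= cat_rcons xp.
by rewrite cat_uniq => /andP[].
Qed.

(** Removing a leaf proves both: the leaf takes the colour opposite to its only neighbour, and it
    contributes at most two arcs. *)
Lemma acyclic_induction (G : sgraph) (A : {set G}) : acyclic G ->
  (exists c : G -> bool, {in A &, forall u v, adj u v -> c u != c v}) /\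
  (A != set0 -> arcs A A + 2 <= 2 * #|A|).
Proof.
move=> acG; move: {2}#|A| (leqnn #|A|) => n; elim: n A => [|n IH] A.
  rewrite leqn0 cards_eq0 => /eqP ->; rewrite eqxx; split=> //.
  by exists xpredT => u v; rewrite inE.
have [-> _|A0] := eqVneq A set0; first by split=> //; exists xpredT => u v; rewrite inE.
move=> cA; have [v vA leaf] := acyclic_leaf acG A0.
have cA1 := cardsD1 v A; rewrite vA in cA1.
have [[c hc] ha] := IH (A :\ v) ltac:(lia); split=> [|_].
  exists (fun x => if x == v then
    (if [pick y in nbr v :&: A] is Some y then ~~ c y else false) else c x).
  have key u : u \in A -> adj v u ->
      (if [pick y in nbr v :&: A] is Some y then ~~ c y else false) = ~~ c u.
    move=> uA vu; case: pickP => [y hy|/(_ u)]; last by rewrite !inE vu uA.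
    suff -> : y = u by [].
    by apply: (card_le1_eqP leaf) => //; rewrite !inE vu uA.
  move=> u w uA wA; have [->|uv] := eqVneq u v; have [->|wv] := eqVneq w v.
  - by rewrite adj_irr.
  - by move=> /(key w wA) ->; case: (c w).
  - by rewrite adj_sym => /(key u uA) ->; case: (c u).
  - by apply: hc; rewrite !inE ?uv ?wv.
have nv : #|nbr v :&: A| = #|nbr v :&: (A :\ v)|.
  by apply: eq_card => x; rewrite !inE; case: eqP => // ->; rewrite adj_irr.
have e : arcs A A = arcs (A :\ v) (A :\ v) + 2 * #|nbr v :&: A|.
  have d1 : [disjoint [set v] & A :\ v] by rewrite disjoints1 !inE eqxx.
  have a1 B : arcs [set v] B = #|nbr v :&: B| by rewrite /arcs big_set1.
  rewrite -{1 2}(setD1K vA) arcsDl // !arcsDr // -!(arcsC [set v]) !a1 nv.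
  rewrite (_ : #|nbr v :&: [set v]| = 0); first lia.
  by apply: eq_card0 => x; rewrite !inE; case: eqP => [->|]; rewrite ?andbF ?adj_irr.
have [A1|A1] := eqVneq (A :\ v) set0.
  have : arcs A A = 0 by rewrite e nv A1 setI0 cards0 /arcs big_set0.
  by rewrite cA1; lia.
by have := ha A1; rewrite e; lia.
Qed.

Lemma iso_deg (G H : sgraph) (f : G -> H) : bijective f ->
  (forall x y, adj (f x) (f y) = adj x y) -> forall x, #|nbr (f x)| = #|nbr x|.
Proof.
move=> [g fK gK] fA x; rewrite -(card_imset (nbr x) (can_inj fK)); apply: eq_card => y.
rewrite inE; apply/idP/imsetP => [xy|[z]]; last by rewrite inE => xz ->; rewrite fA.
by exists (g y); rewrite ?gK // inE -fA gK.
Qed.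

Lemma induced_adj (G : sgraph) (C : {set G}) (x y : induced C) :
  adj x y = adj (val x) (val y).
Proof.
rewrite /= /sclosure (adj_sym (val y)) orbb; case: eqP => [->|_] //=.
by rewrite adj_irr.
Qed.

Lemma cycle_adj k (x y : cycle_graph k) :
  adj x y = (x != y) && ((y == ordS x) || (x == ordS y)).
Proof. by []. Qed.

Lemma cycle_deg k (x : cycle_graph k.*2) : 2 <= k -> #|nbr x| = 2.
Proof.
move=> k2; have -> : nbr x = [set ordS x; ord_pred x].
  apply/setP=> y; rewrite inE cycle_adj !inE.
  have -> : (x == ordS y) = (y == ord_pred x) by rewrite eq_sym (can2_eq (@ordSK _) (@ord_predK _)).
  case: eqP => [<-|//] /=; apply/esym/negbTE; rewrite negb_or -!val_eqE /=.
  apply/andP; split.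
    by have := ltn_ord x; case: (ltngtP x.+1 k.*2) => h _; rewrite ?(modn_small h); lia.
  have := ltn_ord x; case: (posnP x) => [->|x0 xk]; first by rewrite add0n modn_small; lia.
  by rewrite -subn1 -addnBAC // addnC modnDl modn_small; lia.
rewrite cards2; suff -> : ordS x != ord_pred x by [].
rewrite -val_eqE /=; have := ltn_ord x; case: (posnP x) => [-> _|x0 xk].
  by rewrite add0n !modn_small; lia.
have -> : (x + k.*2).-1 %% k.*2 = x.-1.
  by rewrite -subn1 -addnBAC // modnDr modn_small; lia.
case: (ltngtP x.+1 k.*2) => h; [rewrite modn_small //; lia|lia|].
by rewrite h modnn; lia.
Qed.

Lemma cycle_color k (x y : cycle_graph k.*2) : adj x y -> odd x != odd y.
Proof.
have aux (u v : 'I_k.*2) : v == ordS u -> odd v = ~~ odd u.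
  by move=> /eqP -> /=; rewrite odd_mod ?odd_double.
by rewrite cycle_adj => /andP[_ /orP[/aux|/aux] ->]; case: (odd _).
Qed.

Lemma complete2_deg (x : complete 2) : #|nbr x| = 1.
Proof.
have -> : nbr x = [set~ x].
  by apply/setP=> y; rewrite !inE /= /sclosure andbT eq_sym.
by rewrite cardsC1 card_ord.
Qed.

Section Components.
Variable G : sgraph.

Definition component (x : G) : {set G} := [set y | connect (@adj G) x y].

Lemma component_in x : component x \in components G.
Proof. by apply: imset_f. Qed.

Lemma adj_csym : connect_sym (@adj G).
Proof. by apply: sym_connect_sym; apply: adj_sym. Qed.

Lemma component_refl x : x \in component x.
Proof. by rewrite inE connect0. Qed.

Lemma component_eq x y : y \in component x -> component y = component x.
Proof.
rewrite inE => xy; apply/setP=> z; rewrite !inE; apply/idP/idP; first exact: connect_trans.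
by apply: connect_trans; rewrite adj_csym.
Qed.

Lemma component_eqE x y : (component y == component x) = (y \in component x).
Proof.
by apply/eqP/idP => [<-|]; [apply: component_refl|apply: component_eq].
Qed.

Lemma component_nbr x y : y \in component x -> nbr y \subset component x.
Proof.
rewrite inE => xy; apply/subsetP=> z; rewrite !inE => yz.
exact: connect_trans xy (connect1 yz).
Qed.

Lemma induced_deg x (u : induced (component x)) : #|nbr u| = #|nbr (val u)|.
Proof.
rewrite -(card_imset (nbr u) val_inj); apply: eq_card => y.
apply/imsetP/idP => [[v]|yu]; first by rewrite !inE induced_adj => uv ->.
have yC : y \in component x by apply: (subsetP (component_nbr (valP u))).
by exists (Sub y yC); rewrite ?SubK // inE induced_adj SubK -in_nbr.
Qed.

Lemma sum_components (F : G -> nat) :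
  \sum_(x : G) F x = \sum_(C in components G) \sum_(x in C) F x.
Proof.
rewrite (partition_big component (mem (components G))) => [|x _]; last exact: component_in.
apply: eq_bigr => C /imsetP[y _ ->]; apply: eq_bigl => x.
by rewrite -/(component y) component_eqE.
Qed.

Hypothesis hG : each_component
  (fun C => (tree C /\ 2 <= gorder C) \/ even_cycle C) G.

Lemma component_color x :
  exists c : G -> bool, {in component x &, forall u v, adj u v -> c u != c v}.
Proof.
suff [c hc] : exists c : induced (component x) -> bool, forall u v, adj u v -> c u != c v.
  exists (fun y => if insub y is Some u then c u else false) => u v uC vC uv.
  by rewrite !insubT; apply: hc; rewrite induced_adj.
case: (hG (component_in x)) => [[[_ ac] _]|[k [k2 [f [_ fA]]]]].
  have [[c hc] _] := acyclic_induction setT ac.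
  by exists c => u v uv; apply: hc; rewrite ?inE.
exists (fun u => odd (f u : 'I_k.*2)) => u v uv; apply: cycle_color; by rewrite fA.
Qed.

(** A colouring is picked for each component as a set, among finite functions, so that adjacent
    vertices are coloured by the same choice. *)
Lemma bipartite_color : exists c : G -> bool, forall u v, adj u v -> c u != c v.
Proof.
pose ok (C : {set G}) (c : {ffun G -> bool}) :=
  [forall u in C, forall v in C, adj u v ==> (c u != c v)].
pose col C := odflt [ffun=> false] [pick c | ok C c].
have colP x : ok (component x) (col (component x)).
  rewrite /col; case: pickP => [c //|no]; have [c hc] := component_color x.
  have := no [ffun y => c y]; suff -> : ok (component x) [ffun y => c y] by [].
  apply/'forall_implyP=> u uC; apply/'forall_implyP=> v vC; apply/implyP=> uv.
  by rewrite !ffunE; apply: hc.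
exists (fun x => col (component x) x) => u v uv.
have vu : v \in component u by rewrite inE connect1.
rewrite (component_eq vu).
have /'forall_implyP/(_ u (component_refl u))/'forall_implyP/(_ v vu) := colP u.
by rewrite uv.
Qed.

Lemma arcs_component x : tree (induced (component x)) \/ even_cycle (induced (component x)) ->
  \sum_(y in component x) #|nbr y| <= 2 * #|component x| /\
  (tree (induced (component x)) -> \sum_(y in component x) #|nbr y| < 2 * #|component x|).
Proof.
have cC : #|induced (component x)| = #|component x| by rewrite card_sig; apply: eq_card.
have e : \sum_(y in component x) #|nbr y| = \sum_(u : induced (component x)) #|nbr u|.
  under [RHS]eq_bigr do rewrite induced_deg.
  exact: (big_sub (component x)).
have tr : tree (induced (component x)) -> \sum_(y in component x) #|nbr y| < 2 * #|component x|.
  case=> _ ac; have [_] := acyclic_induction setT ac.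
  rewrite -sum_degE -e cardsT cC => /(_ _); rewrite addn2 => h; apply: ltnW; apply: h.
  by apply/set0Pn; exists (Sub x (component_refl x)); rewrite inE.
case=> [t|[k [k2 [f [fb fA]]]]]; first by split=> //; apply: ltnW; apply: tr.
split=> //; rewrite e mulnC -cC -sum_nat_const; apply: leq_sum => u _.
by rewrite -(iso_deg fb fA) cycle_deg.
Qed.

Lemma deg_gt0 (x : G) : 0 < #|nbr x|.
Proof.
pose u : induced (component x) := Sub x (component_refl x).
have -> : #|nbr x| = #|nbr u| by rewrite induced_deg SubK.
case: (hG (component_in x)) => [[[[_ conn] _] o2]|[k [k2 [f [fb fA]]]]]; last first.
  by rewrite -(iso_deg fb fA) cycle_deg.
have [v vu] : exists v, v != u.
  have /card_gt0P[v] : 0 < #|[set~ u]| by rewrite cardsC1; move: o2; rewrite /gorder; lia.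
  by rewrite !inE => vu; exists v.
case/connectP: (conn u v) => [[|w p] /= pw ev]; first by rewrite ev eqxx in vu.
by case/andP: pw => uw _; apply/card_gt0P; exists w; rewrite inE.
Qed.

Lemma even_cycle_deg (x : G) : each_component even_cycle G -> #|nbr x| = 2.
Proof.
case/(_ _ (component_in x)) => k [k2 [f [fb fA]]].
have := induced_deg (Sub x (component_refl x)); rewrite SubK => <-.
by rewrite -(iso_deg fb fA) cycle_deg.
Qed.

Lemma single_edge_deg (x : G) : each_component single_edge G -> #|nbr x| = 1.
Proof.
case/(_ _ (component_in x)) => f [fb fA].
have := induced_deg (Sub x (component_refl x)); rewrite SubK => <-.
by rewrite -(iso_deg fb fA) complete2_deg.
Qed.

(** A tree component has fewer edges than vertices and no component has more. Thus a small part with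
    [nedges Fb] vertices is smaller than [Fb], as needed to force the centre into it. *)
Lemma not_even_cycle_edges : ~ each_component even_cycle G -> nedges G < gorder G.
Proof.
move=> nev; rewrite ltnNge; apply/negP=> hle; apply: nev => C CG.
case: (hG CG) => [[tC _]|//]; exfalso; case/imsetP: CG tC => x _ -> tC.
have : \sum_(y : G) #|nbr y| < \sum_(y : G) 2.
  rewrite !sum_components (bigD1 (component x)) ?component_in //=.
  rewrite [X in _ < X](bigD1 (component x)) ?component_in //= -addSn; apply: leq_add.
    by have [_ /(_ tC)] := arcs_component (or_introl tC); rewrite sum_nat_const mulnC.
  apply: leq_sum => C' /andP[C'G _]; case/imsetP: (C'G) => z _ ez; rewrite ez.
  rewrite sum_nat_const mulnC; have := hG C'G; rewrite ez => hC.
  by have [] := @arcs_component z ltac:(by case: hC => [[]|]; [left|right]).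
rewrite sum_degE arcsTT sum_nat_const -[#|G|]/(gorder G) muln2 ltn_double.
by rewrite ltnNge hle.
Qed.

Lemma not_single_edge_deg : ~ each_component single_edge G -> exists x : G, 2 <= #|nbr x|.
Proof.
move=> nse; have [/existsP[x h]|] := boolP [exists x : G, 2 <= #|nbr x|]; first by exists x.
rewrite negb_exists => /forallP small; case: nse => C /imsetP[x _ ->]; rewrite -/(component x).
have /card_gt0P[y] := deg_gt0 x; rewrite inE => xy.
have uniqn (u v w : G) : adj u v -> adj u w -> v = w.
  have := small u; rewrite -leqNgt => /card_le1_eqP h uv uw.
  by apply: h; rewrite inE.
have Cxy z : (z \in component x) = (z == x) || (z == y).
  apply/idP/orP => [|[] /eqP ->]; [|exact: component_refl|by rewrite inE connect1].
  rewrite inE => /connectP[p]; elim/last_ind: p z => [|p w IH] z /=; first by move=> _ ->; left.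
  rewrite rcons_path last_rcons => /andP[pp lw] ->.
  case: (IH _ pp erefl) => /eqP e; rewrite e in lw.
    by right; apply/eqP; apply: uniqn lw xy.
  by left; apply/eqP; apply: (uniqn y) => //; rewrite adj_sym.
exists (fun u : induced (component x) => if val u == x then ord0 else ord_max : 'I_2); split.
  pose u0 : induced (component x) := Sub x (component_refl x).
  have yC : y \in component x by rewrite Cxy eqxx orbT.
  exists (fun i : 'I_2 => if i == ord0 then u0 else Sub y yC).
    move=> u; have [e|ne] := eqVneq (val u) x; rewrite /= ?eqxx; apply: val_inj; rewrite SubK //.
    by have := valP u; rewrite Cxy (negbTE ne) /= => /eqP.
  move=> i; have [->|ni] := eqVneq i ord0; rewrite SubK ?eqxx //.
  rewrite eq_sym (negbTE (adj_neq xy)); apply: val_inj => /=.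
  by case: i ni => [[|[|//]] hi].
move=> u v; rewrite induced_adj /= /sclosure andbT.
have := valP u; have := valP v; rewrite !Cxy.
have yx : (y == x) = false by rewrite eq_sym (negbTE (adj_neq xy)).
by case/orP=> /eqP -> /orP[] /eqP ->; rewrite ?eqxx ?yx ?adj_irr // ?xy // adj_sym xy.
Qed.

End Components.

(** * Three ways to embed the ballooning *)

Lemma common_nbrs (G : sgraph) (I : finType) (A : {set G}) (X : {set I}) (phi : I -> G) :
  #|A| <= #|[set x in A | [forall v in X, adj (phi v) x]]| + \sum_(v in X) #|A :\: nbr (phi v)|.
Proof.
rewrite -(cardsID [set x | [forall v in X, adj (phi v) x]] A) leq_add //.
  by apply: subset_leq_card; apply/subsetP=> x; rewrite !inE.
apply: leq_trans (card_bigcup_leq _ _); apply: subset_leq_card; apply/subsetP=> x.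
rewrite !inE negb_forall => /andP[/existsP[v]]; rewrite negb_imply => /andP[vX nvx] xA.
by apply/bigcupP; exists v; rewrite // !inE nvx.
Qed.

Lemma gjoin_adj (A B : sgraph) (x y : gjoin A B) : adj x y = match x, y with
  | inl u, inl v => adj u v
  | inr u, inr v => adj u v
  | _, _ => true end.
Proof.
case: x y => [i|u] [j|v] //=; rewrite /sclosure /= ?orbT ?andbT //.
  rewrite (adj_sym j) orbb; case: eqP => [[->]|//]; by rewrite adj_irr.
rewrite (adj_sym v) orbb; case: eqP => [[->]|//]; by rewrite adj_irr.
Qed.

Lemma complete_adj k (x y : complete k) : adj x y = (x != y).
Proof. by rewrite /= /sclosure andbT. Qed.

Lemma join_adj (Fb : sgraph) (x y : gjoin (complete 1) Fb) : adj x y = match x, y with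
  | inl _, inl _ => false
  | inr u, inr v => adj u v
  | _, _ => true end.
Proof.
by rewrite gjoin_adj; case: x y => [i|u] [j|v] //; rewrite complete_adj !ord1 eqxx.
Qed.

Section Instances.
Variables (G : sgraph) (P : {set G}) (t1 t2 t3 f : nat).
Hypothesis hdeg : forall v : G, #|G| <= 2 * #|nbr v|.
Hypothesis hcut : forall v, inn P v <= crs P v.
Hypothesis hheavy : #|heavy P t3| <= t3.
Hypothesis f0 : 0 < f.
Hypothesis ft3 : 100 * f <= t3.
Hypothesis ft2 : 100 * (f * t3) <= t2.
Hypothesis ft1 : 100 * (f * t2) <= t1.
Hypothesis ftn : 100 * (f * t1) <= #|G|.

Variables (Fb : sgraph) (cb : Fb -> bool).
Local Notation F := (gjoin (complete 1) Fb).
Variable l : oedge F -> nat.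
Hypothesis hl : forall p, odd (l p) /\ 5 <= l p.
Hypothesis hf : #|ballooning l| <= f.
Hypothesis hcb : forall u v, adj u v -> cb u != cb v.

Let scales := scale f0 ft3 ft2 ft1 ftn.

Definition parity_gadget (g : G * G) : Prop :=
  (g.1 = g.2 /\ g.1 \in heavy P t2) \/
  [/\ adj g.1 g.2, (g.1 \in P) = (g.2 \in P), inn P g.1 < t2 & inn P g.2 < t2].

Definition disjoint_gadgets := pairwise (fun g h : G * G => [disjoint gadget_set g & gadget_set h]).

(** With the centre and [U] on heavy vertices, only the edges of [Fb] that avoid [U] join free
    vertices on opposite sides; [arcs] counts them twice. *)
Lemma star_embedding (U : {set Fb}) (z0 : G) (psi : Fb -> G) (gs : seq (G * G)) :
  {in U &, forall u v, ~~ adj u v} -> {in U &, injective psi} ->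
  z0 \in heavy P t2 -> (forall u, u \in U -> psi u \in heavy P t2 /\ adj z0 (psi u)) ->
  (forall g, g \in gs -> parity_gadget g) ->
  (forall g, g \in gs -> z0 \notin gadget_set g /\
     forall u, u \in U -> psi u \notin gadget_set g) ->
  disjoint_gadgets gs -> arcs (~: U) (~: U) <= 2 * size gs ->
  (forall b, f * (t2 + 7 * t3) <=
     #|[set x in typical P t3 b | adj z0 x && [forall u in U, adj (psi u) x]]|) ->
  contains G (ballooning l).
Proof.
move=> Uind psiI hz0 hpsi hgs hgd hpw hsz hcand.
have [h3 h2 h1 hn] := scales.
pose X := [set x : F | if x is inr u then u \in U else true].
pose c (x : F) := if x is inr u then cb u else true.
pose phi0 (x : F) := if x is inr u then psi u else z0.
have Xr u : (inr u \in X) = (u \in U) by rewrite inE.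
have Xl i : (inl i \in X) by rewrite inE.
apply: (@embed_with_gadgets G P t1 t2 t3 f hdeg hcut hheavy f0 ft3 ft2 ft1 ftn
          F l hl hf X X c phi0 t2 gs) => //.
- by lia.
- move=> [i|u] [j|v]; rewrite ?Xl // join_adj !Xr => uv _ _; exact: hcb.
- move=> [i|u] [j|v]; rewrite ?Xl ?Xr /=.
  + by rewrite !ord1.
  + by move=> _ /hpsi[_ /adj_neq /eqP].
  + by move=> /hpsi[_ /adj_neq /eqP ne] _ e; case: ne.
  + by move=> uU vU /psiI ->.
- move=> [i|u] [j|v]; rewrite ?Xl ?Xr join_adj //=.
  + by move=> _ /hpsi[].
  + by move=> /hpsi[_ +] _ _; rewrite adj_sym.
  + by move=> uU vU; rewrite (negbTE (Uind u v uU vU)).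
- by move=> [i|u]; rewrite ?Xr //= => /hpsi[].
- by move=> u uX; rewrite uX.
- move=> g /hgs[[e1 e2]|[a1 a2 a3 a4]]; [by left|right; split=> //].
  by move=> u uX; rewrite uX.
- by move=> g [i|u] /hgd[z1 z2]; rewrite ?Xr //= => uU; apply: z2.
- rewrite -leq_double -(mul2n (size gs)); apply: leq_trans hsz.
  rewrite (@oedge_count F (fun a b => [&& a \notin X, b \notin X & c a != c b])); last first.
    by move=> a b; rewrite eq_sym; case: (a \in X); case: (b \in X).
  pose S := [set q : Fb * Fb | adj q.1 q.2 && ((q.1 \notin U) && (q.2 \notin U))].
  pose ir (q : Fb * Fb) : F * F := (inr q.1, inr q.2).
  apply: leq_trans (_ : #|ir @: S| <= _).
    apply: subset_leq_card; apply/subsetP=> -[a b]; rewrite inE /fst /snd join_adj.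
    case: a b => [i|u] [j|v]; rewrite ?Xl ?Xr ?andbF //.
    move=> /and4P[uv uU vU _]; apply/imsetP; exists (u, v) => //.
    by rewrite inE /= uv uU vU.
  apply: leq_trans (leq_imset_card _ _) _; rewrite (@card_pairs Fb (fun a b => adj a b && ((a \notin U) && (b \notin U)))).
  rewrite arcs_sum [X in _ <= X]big_mkcond /=; apply: leq_sum => u _; rewrite inE.
  case: (u \in U) => /=; first by rewrite big1 // => v _; rewrite andbF.
  rewrite [X in _ <= X]big_mkcond /=; apply: leq_sum => v _; rewrite inE.
  by case: (v \in U); rewrite /= ?andbF ?andbT.
- move=> [i|u]; rewrite ?Xl // Xr => uU; apply: leq_trans (hcand (cb u)) _.
  apply: subset_leq_card; apply/subsetP=> x; rewrite inE => /andP[xQ /andP[z0x /'forall_implyP hU]].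
  rewrite inE xQ /=; apply/'forall_implyP=> -[i|v]; rewrite ?Xr => vX; apply/implyP=> _ //=.
  exact: hU.
Qed.

(** With one colour class on heavy vertices every rim edge has a heavy end. The centre is free, on
    the side opposite to the other class, so only the spokes to that class need gadgets. *)
Lemma rim_embedding (x0 : G) (psi : Fb -> G) (gs : seq (G * G)) :
  {in [set u | cb u] &, injective psi} -> (forall u, cb u -> psi u \in heavy P t2) ->
  (forall g, g \in gs -> parity_gadget g) ->
  (forall g u, g \in gs -> cb u -> psi u \notin gadget_set g) ->
  disjoint_gadgets gs -> #|[set u | ~~ cb u]| <= size gs ->
  (forall b, f * (t2 + 7 * t3) <=
     #|[set x in typical P t3 b | [forall u in [set u | cb u], adj (psi u) x]]|) ->
  contains G (ballooning l).
Proof.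
move=> psiI hpsi hgs hgd hpw hsz hcand.
have [h3 h2 h1 hn] := scales.
pose X := [set x : F | if x is inr u then cb u else false].
pose c (x : F) := if x is inr u then cb u else true.
pose phi0 (x : F) := if x is inr u then psi u else x0.
have Xr u : (inr u \in X) = cb u by rewrite inE.
have Xl i : (inl i \in X) = false by rewrite inE.
have cbN u v : adj u v -> ~~ cb u -> ~~ cb v -> false.
  by move=> /hcb; case: (cb u); case: (cb v).
apply: (@embed_with_gadgets G P t1 t2 t3 f hdeg hcut hheavy f0 ft3 ft2 ft1 ftn
          F l hl hf X X c phi0 t2 gs) => //.
- by lia.
- move=> [i|u] [j|v]; rewrite join_adj ?Xr /= => uv cu cv //.
  + by rewrite (negbTE cu).
  + exact: hcb.
- move=> [i|u] [j|v]; rewrite ?Xl ?Xr //= => cu cv /psiI -> //; by rewrite inE.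
- move=> [i|u] [j|v]; rewrite ?Xl ?Xr // join_adj => cu cv /hcb; by rewrite cu cv.
- by move=> [i|u]; rewrite ?Xl ?Xr //; apply: hpsi.
- by move=> u uX; rewrite uX.
- move=> g /hgs[[e1 e2]|[a1 a2 a3 a4]]; [by left|right; split=> //].
  by move=> u uX; rewrite uX.
- by move=> g [i|u] gg; rewrite ?Xl ?Xr //=; apply: hgd.
- rewrite -leq_double.
  rewrite (@oedge_count F (fun a b => [&& a \notin X, b \notin X & c a != c b])); last first.
    by move=> a b; rewrite eq_sym; case: (a \in X); case: (b \in X).
  pose J := [set u | ~~ cb u].
  pose S1 : {set F * F} := [set (inl ord0, inr u) | u in J].
  pose S2 : {set F * F} := [set (inr u, inl ord0) | u in J].
  apply: leq_trans (_ : #|S1 :|: S2| <= _).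
    apply: subset_leq_card; apply/subsetP=> -[a b]; rewrite inE /fst /snd join_adj.
    case: a b => [i|u] [j|v]; rewrite ?Xr ?Xl //=.
    + move=> /andP[cv _]; rewrite inE; apply/orP; left; apply/imsetP; exists v; rewrite ?inE //.
      by rewrite ord1.
    + move=> /andP[cv _]; rewrite inE; apply/orP; right; apply/imsetP; exists u; rewrite ?inE //.
      by rewrite ord1.
    + by case/and4P=> uv cu cv; have := cbN u v uv cu cv.
  apply: leq_trans (leq_card_setU _ _) _; rewrite -addnn leq_add //.
    by apply: leq_trans (leq_imset_card _ _) hsz.
  by apply: leq_trans (leq_imset_card _ _) hsz.
- move=> u _; apply: leq_trans (hcand (c u)) _; apply: subset_leq_card; apply/subsetP=> x.
  rewrite inE => /andP[xQ /'forall_implyP hU]; rewrite inE xQ /=.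
  apply/'forall_implyP=> -[i|v]; rewrite ?Xl ?Xr // => cv; apply/implyP=> _ /=.
  by apply: hU; rewrite inE.
Qed.

(** No heavy vertex is used: the centre and one class lie in the same part, joined by inner edges,
    and the other class lies opposite. All remaining edges of [F] change sides and are served by
    disjoint inner edges; [f] exceeds the number of edges of [F]. *)
Lemma inner_star_embedding (x : G) (psi : Fb -> G) (gs : seq (G * G)) :
  (forall v, inn P v < t1) -> {in [set u | cb u] &, injective psi} ->
  (forall u, cb u -> adj x (psi u) /\ (psi u \in P) = (x \in P)) ->
  (forall g, g \in gs -> [/\ adj g.1 g.2, (g.1 \in P) = (x \in P) & (g.2 \in P) = (x \in P)]) ->
  (forall g, g \in gs -> x \notin gadget_set g /\ forall u, cb u -> psi u \notin gadget_set g) ->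
  disjoint_gadgets gs -> f <= size gs ->
  contains G (ballooning l).
Proof.
move=> hin psiI hpsi hgs hgd hpw hsz.
have [h3 h2 h1 hn] := scales; have [hF _] := balloon_bounds hl hf.
set b := x \in P in hpsi hgs.
pose X := [set y : F | if y is inr u then cb u else true].
pose c (y : F) := if y is inr u then if cb u then b else ~~ b else b.
pose phi0 (y : F) := if y is inr u then psi u else x.
have Xr u : (inr u \in X) = cb u by rewrite inE.
have Xl i : (inl i \in X) by rewrite inE.
have hX u : u \in X -> (phi0 u \in P) = b /\ c u = b.
  by case: u => [i|u] //; rewrite Xr /c /phi0 => cu; have [_ ->] := hpsi u cu; rewrite cu.
have nb : b != ~~ b by case: (b).
apply: (@embed_with_gadgets G P t1 t2 t3 f hdeg hcut hheavy f0 ft3 ft2 ft1 ftn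
          F l hl hf X set0 c phi0 t1 gs) => //.
- by apply/subsetP=> u; rewrite inE.
- move=> [i|u] [j|v]; rewrite join_adj ?Xl ?Xr //= => uv cu _.
    by rewrite (negbTE cu) eq_sym.
  have := hcb uv; rewrite (negbTE cu); case: (cb v) => //= _; by rewrite eq_sym.
- move=> [i|u] [j|v]; rewrite ?Xl ?Xr /=.
  + by rewrite !ord1.
  + by move=> _ /hpsi[/adj_neq /eqP].
  + by move=> /hpsi[xa _] _ e; rewrite e adj_irr in xa.
  + by move=> uU vU e; congr inr; apply: psiI; rewrite ?inE.
- move=> [i|u] [j|v]; rewrite ?Xl ?Xr join_adj //=.
  + by move=> _ /hpsi[].
  + by move=> /hpsi[+ _] _ _; rewrite adj_sym.
  + by move=> cu cv /hcb; rewrite cu cv.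
- by move=> u; rewrite inE.
- by move=> u /hX[-> ->] _.
- move=> g /hgs[a1 a2 a3]; right; split=> //; first by rewrite a2.
  by move=> u /hX[_ ->].
- by move=> g [i|u] /hgd[z1 z2]; rewrite ?Xr //= => uU; apply: z2.
- by apply: leq_trans (max_card _) _; lia.
move=> u uX; have cu : c u = ~~ b by case: u uX => [i|u]; rewrite ?Xl // Xr /c => /negbTE ->.
have cF : #|X| <= f by apply: leq_trans (max_card _) _; lia.
have := common_nbrs (typical P t3 (c u)) X phi0.
have : \sum_(v in X) #|typical P t3 (c u) :\: nbr (phi0 v)| <= f * (t1 + t3).
  apply: leq_trans (_ : #|X| * (t1 + t3) <= _); last by rewrite leq_mul2r cF orbT.
  rewrite -sum_nat_const; apply: leq_sum => v /hX[hv _]; rewrite cu.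
  exact: (typical_miss hdeg hheavy f0 ft3 ft2 ft1 ftn (hin _) hv).
have := typical_lb hdeg hheavy f0 ft3 ft2 ft1 ftn (c u).
set A := [set y in _ | _]; have : #|A| <= #|candidates P t3 X c phi0 u|.
  apply: subset_leq_card; apply/subsetP=> y; rewrite inE => /andP[yQ /'forall_implyP hU].
  by rewrite inE yQ /=; apply/'forall_implyP=> v vX; apply/implyP=> _; apply: hU.
move=> a1 a2 a3 a4; have a5 : 100 * (f * t3) <= t1 by nia.
have a6 : t3 <= f * t1 by nia.
by nia.
Qed.

End Instances.

(** * The heavy vertices *)

(** The ends of a matching that cannot be extended form the cover. *)
Lemma matching_or_cover (G : sgraph) (r : rel G) M :
  (exists gs : seq (G * G),
     [/\ size gs = M, forall g, g \in gs -> r g.1 g.2 & disjoint_gadgets gs]) \/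
  (exists2 K : {set G}, #|K| <= 2 * M & forall x y, r x y -> (x \in K) || (y \in K)).
Proof.
elim: M => [|M [[gs [sz gr pw]]|[K cK hK]]]; [by left; exists [::]| |right]; last first.
  by exists K => //; apply: leq_trans cK _; lia.
pose K := \bigcup_(g <- gs) gadget_set g.
have cK : #|K| <= 2 * M.
  rewrite -sz /K; elim: (gs) => [|g gs' IH]; first by rewrite big_nil cards0.
  rewrite big_cons; apply: leq_trans (leq_card_setU _ _) _.
  have : #|gadget_set g| <= 2 by rewrite cards2; case: (_ != _).
  by rewrite /=; lia.
have [/existsP[x /existsP[y /and3P[rxy xK yK]]]|] :=
  boolP [exists x, exists y, [&& r x y, x \notin K & y \notin K]]; last first.
  rewrite negb_exists => /forallP hK; right; exists K; first by lia.
  move=> x y rxy; have := hK x; rewrite negb_exists => /forallP/(_ y).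
  by rewrite rxy /= negb_and !negbK.
left; exists ((x, y) :: gs); split=> /=; first by rewrite sz.
  by move=> g; rewrite inE => /predU1P[->|/gr].
rewrite pw andbT; apply/allP=> g gg; rewrite disjoints_subset; apply/subsetP=> z.
have gK z' : z' \in gadget_set g -> z' \in K.
  by move=> zg; rewrite /K; elim: (gs) gg => // h hs IH; rewrite inE big_cons inE => /predU1P[<-|/IH ->]; rewrite ?zg ?orbT.
by rewrite !inE => /orP[] /eqP -> /=; rewrite -in_set2; [apply: contra xK|apply: contra yK]; apply: gK.
Qed.

Lemma arcs_cover (G : sgraph) (A K : {set G}) t :
  {in A &, forall x y, adj x y -> (x \in K) || (y \in K)} ->
  (forall x, x \in A -> #|nbr x :&: A| <= t) -> arcs A A <= 2 * (#|K| * t).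
Proof.
move=> hK ht; have bnd : arcs (A :&: K) A <= #|K| * t.
  apply: leq_trans (_ : #|A :&: K| * t <= _); last by rewrite leq_mul2r subset_leq_card ?orbT ?subsetIr.
  rewrite -sum_nat_const; apply: leq_sum => x; rewrite inE => /andP[xA _]; exact: ht.
have dis : [disjoint A :&: K & A :\: K].
  by apply/pred0P=> x /=; rewrite !inE; case: (x \in K); rewrite ?andbF.
rewrite -{1}(setID A K) arcsDl // mulSn mul1n leq_add //.
rewrite -{2}(setID A K) arcsDr // (_ : arcs (A :\: K) (A :\: K) = 0).
  by rewrite addn0 arcsC (leq_trans _ bnd) // arcsSr // subsetDl.
rewrite /arcs big1 // => x; rewrite inE => /andP[xK xA]; apply: eq_card0 => y.
rewrite !inE; apply/negP=> /and3P[xy yK yA].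
by have := hK x y xA yA xy; rewrite (negbTE xK) (negbTE yK).
Qed.

Lemma inj_into (T S : finType) (A : {set T}) (B : {set S}) : #|A| <= #|B| -> S ->
  exists psi : T -> S, {in A &, injective psi} /\ forall u, u \in A -> psi u \in B.
Proof.
move=> cAB s0; exists (fun u => nth s0 (enum B) (index u (enum A))).
have idx u : u \in A -> index u (enum A) < size (enum B).
  by move=> uA; rewrite -cardE; apply: leq_trans cAB; rewrite cardE index_mem mem_enum.
split=> [u v uA vA /eqP|u uA]; last by rewrite -mem_enum mem_nth // idx.
rewrite nth_uniq ?enum_uniq ?idx // => /eqP e.
by rewrite -(nth_index u (s := enum A) (x := u)) ?mem_enum // e nth_index ?mem_enum.
Qed.

Lemma disjoint_diag (G : sgraph) (A : {set G}) : disjoint_gadgets [seq (z, z) | z <- enum A].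
Proof.
rewrite /disjoint_gadgets pairwise_map; have := enum_uniq A; rewrite uniq_pairwise.
apply: sub_pairwise => x y /= ne; rewrite disjoints_subset; apply/subsetP=> z.
by rewrite !inE !orbb => /eqP ->.
Qed.

(** In the last clause the centre and [U] would occupy [1 + #|U|] vertices of [W], leaving
    [k - 1 - #|U|] as gadgets for the edges of [Fb] avoiding [U]; the inequality says that these are
    too few. It is the only clause restricting the edges inside [W]. *)
Definition join_structure (Fb : sgraph) (k : nat) (G : sgraph) (P W : {set G}) : Prop :=
  [/\ #|W| = k,
      forall x y, x \notin W -> y \notin W -> (x \in P) = (y \in P) -> ~~ adj x y
    & forall (U : {set Fb}) z0 psi, {in U &, forall u v, ~~ adj u v} ->
        {in U &, injective psi} -> z0 \in W ->
        (forall u, u \in U -> psi u \in W /\ adj z0 (psi u)) ->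
        k + \sum_(u in U) #|nbr u| < nedges Fb + 1 + #|U|].

Section Structure.
Variables (G : sgraph) (P : {set G}) (t1 t2 t3 f : nat).
Hypothesis hdeg : forall v : G, #|G| <= 2 * #|nbr v|.
Hypothesis hcut : forall v, inn P v <= crs P v.
Hypothesis hheavy : #|heavy P t3| <= t3.
Hypothesis f0 : 0 < f.
Hypothesis ft3 : 100 * f <= t3.
Hypothesis ft2 : 100 * (f * t3) <= t2.
Hypothesis ft1 : 100 * (f * t2) <= t1.
Hypothesis ftn : 100 * (f * t1) <= #|G|.

Variables (Fb : sgraph) (cb : Fb -> bool) (k : nat).
Local Notation F := (gjoin (complete 1) Fb).
Variable l : oedge F -> nat.
Hypothesis hl : forall p, odd (l p) /\ 5 <= l p.
Hypothesis hf : #|ballooning l| <= f.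
Hypothesis hcb : forall u v, adj u v -> cb u != cb v.
Hypothesis hfree : free (ballooning l) G.
Hypothesis hef : nedges Fb <= f.
Hypothesis hke : k <= nedges Fb.
Hypothesis hk0 : 0 < k.
Hypothesis hIk : #|[set u | cb u]| <= k.
Hypothesis hlow : #|G| ^ 2 + 2 * (k * #|G|) <= 2 * @arcs G setT setT + 3 * k ^ 2 + 1.

Let scales := scale f0 ft3 ft2 ft1 ftn.

Lemma part_disjoint b : [disjoint part P b & part P (~~ b)].
Proof. by apply/pred0P=> x /=; rewrite !inE; case: (x \in P); case: b. Qed.

Lemma partU b : part P b :|: part P (~~ b) = setT.
Proof. by apply/setP=> x; rewrite !inE; case: (x \in P); case: b. Qed.

(** Otherwise every inner degree is below [t1]. In a part, either all inner degrees are smaller than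
    a colour class, hence at most [k - 1], or some vertex carries an inner star, and then the inner
    edges off the star have no large matching, hence a bounded cover. Both make the total fall short
    of [hlow] by a linear amount. *)
Lemma some_heavy : heavy P t1 != set0.
Proof.
have [h3 h2 h1 hn] := scales.
apply/negP=> /eqP h0.
have hin v : inn P v < t1 by have := in_set0 v; rewrite -h0 inE ltnNge => ->.
have side b : arcs (part P b) (part P b) <= 8 * (f * t1) + k.-1 * #|part P b|.
  have innE v : v \in part P b -> #|nbr v :&: part P b| = inn P v.
    by rewrite in_part /inn => /eqP ->.
  have [/existsP[x /andP[xb hx]]|] := boolP [exists x in part P b, #|[set u | cb u]| <= inn P x]; last first.
    rewrite negb_exists => /forallP small; apply: leq_trans (leq_addl _ _).
    rewrite mulnC -sum_nat_const; apply: leq_sum => v vb; rewrite innE //.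
    by have := small v; rewrite vb /= -ltnNge; have := hIk; lia.
  rewrite -innE // in hx.
  have [psi [psiI psiB]] := inj_into hx x.
  pose Zx := x |: psi @: [set u | cb u].
  have cZ : #|Zx| <= 1 + k.
    rewrite cardsU1 leq_add ?leq_b1 //; apply: leq_trans (leq_imset_card _ _) hIk.
  pose A := part P b :\: Zx.
  pose r : rel G := fun u v => [&& adj u v, u \in A & v \in A].
  have [[gs [sz gr pw]]|[K cK hK]] := matching_or_cover r f.
    case: hfree; apply: (@inner_star_embedding G P t1 t2 t3 f hdeg hcut hheavy f0 ft3 ft2 ft1 ftn
      Fb cb l hl hf hcb x psi gs) => //.
    - move=> u cu; have : psi u \in nbr x :&: part P b by apply: psiB; rewrite inE.
      by rewrite inE in_nbr in_part => /andP[-> /eqP ->]; move: xb; rewrite in_part => /eqP ->.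
    - move=> g /gr /and3P[a1]; rewrite !inE => /andP[_ /eqP ->] /andP[_ /eqP ->].
      by move: xb; rewrite in_part => /eqP ->.
    - move=> g /gr /and3P[_]; rewrite !in_setD => /andP[n1 _] /andP[n2 _].
      have gN z : z \in Zx -> z \notin gadget_set g.
        by move=> zZ; rewrite !inE negb_or; apply/andP; split; apply: contraTneq zZ => ->.
      split=> [|u cu]; apply: gN; rewrite !inE ?eqxx //.
      by rewrite imset_f ?orbT // inE.
    - by rewrite sz.
  apply: leq_trans (leq_addr _ _).
  apply: leq_trans (_ : 2 * (#|K :|: Zx| * t1) <= _).
    apply: arcs_cover => [u v ub vb uv|u ub]; last by rewrite innE //; apply: ltnW.
    rewrite (in_setU u K Zx) (in_setU v K Zx); case: (boolP (u \in Zx)) => [|uZ]; first by rewrite orbT.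
    case: (boolP (v \in Zx)) => [|vZ]; first by rewrite !orbT.
    by rewrite !orbF; apply: hK; rewrite /r uv !in_setD uZ vZ ub vb.
  have : #|K :|: Zx| <= 4 * f.
    by apply: leq_trans (leq_card_setU _ _) _; lia.
  by nia.
have eT : @arcs G setT setT = arcs (part P true) (part P true)
    + arcs (part P false) (part P false) + 2 * arcs (part P true) (part P false).
  rewrite -{1 2}(partU true) arcsDl ?(part_disjoint true) //.
  by rewrite !arcsDr ?(part_disjoint true) // (arcsC (part P false) (part P true)) /=; lia.
have hx := leq_arcs_mul (part P true) (part P false).
have cp := card_part P true; rewrite /= in cp.
have [sq _] := nat_AGM2 #|part P true| #|part P false|; rewrite cp in sq.
have s1 := side true; have s2 := side false.
have e1 : k.-1 * #|part P true| + k.-1 * #|part P false| = k.-1 * #|G| by rewrite -mulnDr cp.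
have e2 : k.-1 * #|G| + #|G| = k * #|G| by rewrite -{2}(mul1n #|G|) -mulnDl addn1 prednK.
have k2 : k ^ 2 <= f * t1 by rewrite expnS expn1 leq_mul //; lia.
by move: hlow; rewrite -!mulnn in sq k2 *; lia.
Qed.

Lemma gadget_diag (A : {set G}) g : A \subset heavy P t2 ->
  g \in [seq (z, z) | z <- enum A] -> parity_gadget P t2 g.
Proof.
by move=> /subsetP sA /mapP[z]; rewrite mem_enum => /sA zh ->; left.
Qed.

Lemma in_gadget_diag (A : {set G}) g y : y \notin A ->
  g \in [seq (z, z) | z <- enum A] -> y \notin gadget_set g.
Proof.
move=> yA /mapP[z]; rewrite mem_enum => zA ->; rewrite !inE orbb.
by apply: contraNneq yA => ->.
Qed.

(** The star embedding with [U] empty: one centre and a gadget for each edge of [Fb]. The centre is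
    taken at the larger threshold [t1], because its typical neighbours are the candidates for all
    other vertices of [F]. *)
Lemma heavy_center z0 gs : z0 \in heavy P t1 ->
  (forall g, g \in gs -> parity_gadget P t2 g /\ z0 \notin gadget_set g) ->
  disjoint_gadgets gs -> size gs < nedges Fb.
Proof.
move=> hz hgs hpw; rewrite ltnNge; apply/negP=> hsz.
have [h3 h2 h1 hn] := scales; case: hfree.
apply: (@star_embedding G P t1 t2 t3 f hdeg hcut hheavy f0 ft3 ft2 ft1 ftn
      Fb cb l hl hf hcb set0 z0 (fun _ => z0) gs) => //.
- by move=> u v; rewrite inE.
- by move=> u v; rewrite inE.
- by move: hz; rewrite !inE; apply: leq_trans; lia.
- by move=> u; rewrite inE.
- by move=> g /hgs[].
- by move=> g /hgs[_ h]; split=> // u; rewrite inE.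
- by rewrite setC0 arcsTT -mul2n leq_mul2l hsz.
move=> b; have := heavy_typical hcut hheavy b hz.
set A := [set _ in _ | _]; have -> : A = nbr z0 :&: typical P t3 b.
  apply/setP=> x; rewrite in_set [in RHS]in_setI in_nbr andbC; congr (_ && _).
  by case: (adj z0 x) => //=; apply/'forall_implyP=> u; rewrite inE.
by nia.
Qed.

Definition miss (v : G) : nat := #|~: nbr v|.

(** A centre can use the other heavy vertices as gadgets, hence the first bound. It can also use
    inner edges outside [heavy P t2], so these have a bounded cover. Outside [heavy P t1] the graph
    is then bipartite up to [12 * (f * t1)] arcs, and comparison with [hlow] gives the second
    bound. *)
Lemma heavy_deficit :
  #|heavy P t2| <= nedges Fb /\
  4 * (\sum_(v in heavy P t1) miss v) + 2 * (k * #|G|)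
    <= 2 * (#|heavy P t1| * #|G|) + 29 * (f * t1).
Proof.
have [h3 h2 h1 hn] := scales; have /set0Pn[z0 hz0] := some_heavy.
have W12 : heavy P t1 \subset heavy P t2.
  by apply/subsetP=> v; rewrite !inE; apply: leq_trans; lia.
have z02 := subsetP W12 z0 hz0.
have cW2 : #|heavy P t2| <= nedges Fb.
  pose A := heavy P t2 :\ z0.
  have := @heavy_center z0 [seq (z, z) | z <- enum A] hz0.
  rewrite size_map -cardE (cardsD1 z0 (heavy P t2)) z02 add1n; apply; last exact: disjoint_diag.
  move=> g gA; split; first by apply: gadget_diag gA; apply: subsetDl.
  by apply: in_gadget_diag gA; rewrite !inE eqxx.
split=> //.
set W := heavy P t1; have cW : #|W| <= f.
  by apply: leq_trans (subset_leq_card W12) _; apply: leq_trans cW2 _.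
pose r : rel G := fun u v => [&& adj u v, (u \in P) == (v \in P), u \notin heavy P t2 & v \notin heavy P t2].
have [[gs [sz gr pw]]|[K cK hK]] := matching_or_cover r (nedges Fb).
  exfalso; have := @heavy_center z0 gs hz0; rewrite sz ltnn => hct; suff: false by [].
  apply: hct => //.
  move=> g /gr /and4P[a1 /eqP a2 a3 a4]; split.
    by right; split=> //; move: a3 a4; rewrite !inE -!ltnNge.
  by rewrite !inE negb_or; apply/andP; split; [apply: contraNneq a3|apply: contraNneq a4] => <-.
have side b : arcs (part P b :\: W) (part P b :\: W) <= 6 * (f * t1).
  apply: leq_trans (_ : 2 * (#|K :|: heavy P t2| * t1) <= _).
    apply: arcs_cover => [u v|u].
      rewrite !in_setD !in_part !in_setU => /andP[_ /eqP ub] /andP[_ /eqP vb] uv.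
      case: (boolP (u \in heavy P t2)) => [|u2]; first by rewrite orbT.
      case: (boolP (v \in heavy P t2)) => [|v2]; first by rewrite !orbT.
      by rewrite !orbF; apply: hK; rewrite /r uv u2 v2 ub vb eqxx.
    rewrite in_setD in_part => /andP[uW /eqP ub]; move: uW; rewrite inE -ltnNge => /ltnW.
    apply: leq_trans; rewrite /inn ub subset_leq_card //.
    by apply: setIS; apply: subsetDl.
  have : #|K :|: heavy P t2| <= 3 * f by apply: leq_trans (leq_card_setU _ _) _; lia.
  by nia.
have dA : [disjoint part P true :\: W & part P false :\: W].
  by apply/pred0P=> x /=; rewrite !inE; case: (x \in P); rewrite ?andbF.
have eA : (part P true :\: W) :|: (part P false :\: W) = ~: W.
  by apply/setP=> x; rewrite !inE; case: (x \in P); rewrite ?andbF ?andbT ?orbF.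
have cA : #|part P true :\: W| + #|part P false :\: W| = #|~: W|.
  by rewrite -eA cardsU (disjoint_setI0 dA) cards0 subn0.
have eC : arcs (~: W) (~: W) = arcs (part P true :\: W) (part P true :\: W)
    + arcs (part P false :\: W) (part P false :\: W)
    + 2 * arcs (part P true :\: W) (part P false :\: W).
  by rewrite -eA arcsDl // !arcsDr // (arcsC (part P false :\: W) (part P true :\: W)); lia.
have eT : @arcs G setT setT = arcs W setT + arcs (~: W) W + arcs (~: W) (~: W).
  by rewrite -{1}(setUCr W) arcsDl ?disjointC // -[in arcs (~: W) setT](setUCr W) arcsDr ?disjointC //; lia.
have sW : arcs (~: W) W <= arcs W setT by rewrite arcsC arcsSr // subsetT.
have mW : arcs W setT + \sum_(v in W) miss v = #|W| * #|G|.
  rewrite /arcs -big_split /= -sum_nat_const; apply: eq_bigr => v _.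
  by rewrite setIT /miss cardsC.
have hx := leq_arcs_mul (part P true :\: W) (part P false :\: W).
have [sq _] := nat_AGM2 #|part P true :\: W| #|part P false :\: W|; rewrite cA in sq.
have s1 := side true; have s2 := side false.
have cC := cardsC W.
have k2 : k ^ 2 <= f * t1 by rewrite expnS expn1 leq_mul //; lia.
have w2 : #|W| ^ 2 <= f * t1 by rewrite expnS expn1 leq_mul //; lia.
have nn : #|G| ^ 2 = #|~: W| ^ 2 + 2 * (#|W| * #|~: W|) + #|W| ^ 2.
  by rewrite -cC; nia.
have jn : #|W| * #|G| = #|W| ^ 2 + #|W| * #|~: W| by rewrite -cC mulnDr -mulnn.
have ft1' : 0 < f * t1 by rewrite muln_gt0 f0; lia.
by move: hlow; lia.
Qed.

(** A part has about [#|G| / 2] typical vertices, and the deficits remove at most about half of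
    them. The allowance [#|G|] is needed when there is one heavy vertex too many and a total deficit
    of about [#|G| / 2] is split between two halves. *)
Lemma typical_common (A : {set G}) b : 4 * (\sum_(v in A) miss v) <= #|G| + 29 * (f * t1) ->
  f * (t2 + 7 * t3) <= #|[set x in typical P t3 b | [forall v in A, adj v x]]|.
Proof.
move=> hA; have [h3 h2 h1 hn] := scales.
have := common_nbrs (typical P t3 b) A id.
have : \sum_(v in A) #|typical P t3 b :\: nbr v| <= \sum_(v in A) miss v.
  by apply: leq_sum => v _; apply: subset_leq_card; rewrite setDE subsetIr.
have := typical_lb hdeg hheavy f0 ft3 ft2 ft1 ftn b.
set x := #|[set _ in _ | _]|; set y := \sum_(v in A) _; set z := \sum_(v in A) miss v in hA *.
have a1 : f * t2 <= f * t1 by nia.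
have a2 : f * t3 <= f * t1 by nia.
by clear -hA a1 a2 h1 h2 h3 hn ft1 ft2 ftn; nia.
Qed.

Definition inner_edge_gadget (g : G * G) : Prop :=
  [/\ adj g.1 g.2, (g.1 \in P) = (g.2 \in P), g.1 \notin heavy P t2 & g.2 \notin heavy P t2].

Lemma gadgets_cat (A : {set G}) (gs : seq (G * G)) :
  A \subset heavy P t2 -> (forall g, g \in gs -> inner_edge_gadget g) -> disjoint_gadgets gs ->
  let gs' := [seq (z, z) | z <- enum A] ++ gs in
  [/\ forall g, g \in gs' -> parity_gadget P t2 g, disjoint_gadgets gs', size gs' = #|A| + size gs
    & forall g y, g \in gs' -> y \in heavy P t2 -> y \notin A -> y \notin gadget_set g].
Proof.
move=> sA hgs pw gs'; split.
- move=> g; rewrite mem_cat => /orP[/gadget_diag|/hgs[a1 a2 a3 a4]]; first exact.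
  by right; split=> //; move: a3 a4; rewrite !inE -!ltnNge.
- rewrite /disjoint_gadgets pairwise_cat -/(disjoint_gadgets _) disjoint_diag -/(disjoint_gadgets gs) pw !andbT.
  apply/allrelP=> g h /mapP[z]; rewrite mem_enum => /(subsetP sA) zh -> /hgs[_ _ a3 a4].
  rewrite disjoints_subset; apply/subsetP=> x; rewrite !inE orbb => /eqP ->.
  by rewrite negb_or; apply/andP; split; [apply: contraNneq a3|apply: contraNneq a4] => <-.
- by rewrite size_cat size_map -cardE.
move=> g y; rewrite mem_cat => /orP[gA _ yA|/hgs[_ _ a3 a4] yh _]; first exact: in_gadget_diag gA.
by rewrite !inE negb_or; apply/andP; split; [apply: contraNneq a3|apply: contraNneq a4] => <-.
Qed.

Lemma rim_case (I0 : {set G}) (gs : seq (G * G)) :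
  I0 \subset heavy P t2 -> #|I0| = #|[set u | cb u]| ->
  4 * (\sum_(v in I0) miss v) <= #|G| + 29 * (f * t1) ->
  (forall g, g \in gs -> inner_edge_gadget g) -> disjoint_gadgets gs ->
  #|heavy P t2| - #|I0| + size gs < #|[set u | ~~ cb u]|.
Proof.
move=> sI cI hI hgs pw; rewrite ltnNge; apply/negP=> hsz.
have /set0Pn[x0 _] := some_heavy.
have [|psi [psiI psiB]] := @inj_into Fb G [set u | cb u] I0 _ x0; first by rewrite cI.
have [g1 g2 g3 g4] := gadgets_cat (subsetDl (heavy P t2) I0) hgs pw.
case: hfree; apply: (@rim_embedding G P t1 t2 t3 f hdeg hcut hheavy f0 ft3 ft2 ft1 ftn
      Fb cb l hl hf hcb x0 psi _ psiI _ g1 _ g2).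
- by move=> u cu; apply: (subsetP sI); apply: psiB; rewrite inE.
- move=> g u gg cu; have uI : psi u \in I0 by apply: psiB; rewrite inE.
  by apply: (g4 g _ gg); rewrite ?in_setD ?uI //; apply: (subsetP sI).
- by rewrite g3 cardsD (setIidPr sI).
move=> b; apply: leq_trans (typical_common b hI) _; apply: subset_leq_card.
apply/subsetP=> x; rewrite inE => /andP[xQ /'forall_implyP hx]; rewrite inE xQ /=.
by apply/'forall_implyP=> u uI; apply: hx; apply: psiB.
Qed.

(** All heavy vertices off the star serve as gadgets, together with [gs]. Since [U] is independent,
    the number of edges of [Fb] avoiding it is [nedges Fb] minus the degrees in [U]. *)
Lemma star_case (U : {set Fb}) (z0 : G) (psi : Fb -> G) (gs : seq (G * G)) :
  4 * (\sum_(v in heavy P t2) miss v) <= #|G| + 29 * (f * t1) ->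
  {in U &, forall u v, ~~ adj u v} -> {in U &, injective psi} ->
  z0 \in heavy P t2 -> (forall u, u \in U -> psi u \in heavy P t2 /\ adj z0 (psi u)) ->
  (forall g, g \in gs -> inner_edge_gadget g) -> disjoint_gadgets gs ->
  #|heavy P t2| + \sum_(u in U) #|nbr u| + size gs < nedges Fb + 1 + #|U|.
Proof.
move=> hM Uind psiI hz0 hpsi hgs pw; rewrite ltnNge; apply/negP=> hsz.
pose R := z0 |: psi @: U.
have cR : #|R| = 1 + #|U|.
  rewrite cardsU1 card_in_imset //; suff -> : z0 \notin psi @: U by [].
  by apply/imsetP=> -[u uU e]; have [_] := hpsi u uU; rewrite -e adj_irr.
have sR : R \subset heavy P t2.
  by apply/subsetP=> x /setU1P[->|/imsetP[u /hpsi[hu _] ->]].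
have [g1 g2 g3 g4] := gadgets_cat (subsetDl (heavy P t2) R) hgs pw.
have eU : arcs (~: U) (~: U) + 2 * \sum_(u in U) #|nbr u| = 2 * nedges Fb.
  have UU : arcs U U = 0.
    rewrite /arcs big1 // => u uU; apply: eq_card0 => v; rewrite !inE.
    by apply/negP=> /andP[uv vU]; have := Uind u v uU vU; rewrite uv.
  have -> : \sum_(u in U) #|nbr u| = arcs U setT by apply: eq_bigr => u _; rewrite setIT.
  rewrite (mul2n (nedges Fb)) -arcsTT -[in RHS](setUCr U) arcsDl ?disjointC // !arcsDr ?disjointC //.
  rewrite -[in arcs U setT](setUCr U) arcsDr ?disjointC // UU (arcsC (~: U) U); lia.
case: hfree; apply: (@star_embedding G P t1 t2 t3 f hdeg hcut hheavy f0 ft3 ft2 ft1 ftn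
      Fb cb l hl hf hcb U z0 psi _ Uind psiI hz0 hpsi g1 _ g2).
- have gR g x : g \in [seq (z, z) | z <- enum (heavy P t2 :\: R)] ++ gs -> x \in R -> x \notin gadget_set g.
    by move=> gg xR; apply: (g4 g x gg); rewrite ?(subsetP sR) // in_setD xR.
  move=> g gg; split=> [|u uU]; apply: (gR g _ gg); rewrite !inE ?eqxx //.
  by rewrite imset_f ?orbT.
- rewrite g3 cardsD (setIidPr sR) cR; have := subset_leq_card sR; rewrite cR.
  by move: hsz eU; clear; lia.
move=> b; apply: leq_trans (typical_common b hM) _; apply: subset_leq_card.
apply/subsetP=> x; rewrite inE => /andP[xQ /'forall_implyP hx]; rewrite inE xQ /= hx //=.
by apply/'forall_implyP=> u uI; apply: hx; have [] := hpsi u uI.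
Qed.

Lemma heavy_subset : heavy P t1 \subset heavy P t2.
Proof.
have [h3 h2 h1 hn] := scales.
by apply/subsetP=> v; rewrite !inE; apply: leq_trans; lia.
Qed.

Lemma heavy_lb : k <= #|heavy P t1|.
Proof.
rewrite leqNgt; apply/negP=> lt; have [_ h] := heavy_deficit.
have [h3 h2 h1 hn] := scales.
have : (#|heavy P t1| + 1) * #|G| <= k * #|G| by rewrite leq_mul2r addn1 lt orbT.
rewrite mulnDl mul1n; have ft1' : 0 < f * t1 by rewrite muln_gt0 f0; lia.
by move: h ftn; clear -ft1'; lia.
Qed.

(** Both thresholds now give the same set, squeezed between at least and at most [k] vertices. The
    linear terms of [heavy_deficit] cancel, so the heavy vertices have almost full degree. *)
Lemma heavy_full : #|heavy P t2| <= k ->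
  #|heavy P t2| = k /\ 4 * (\sum_(v in heavy P t2) miss v) <= 29 * (f * t1).
Proof.
move=> c2; have c1 := heavy_lb; have s12 := heavy_subset.
have e12 : heavy P t1 = heavy P t2.
  by apply/eqP; rewrite eqEcard s12 (leq_trans c2 c1).
have ck : #|heavy P t2| = k by apply/eqP; rewrite eqn_leq c2 -e12 c1.
split=> //; have [_] := heavy_deficit; rewrite e12 ck.
by clear; lia.
Qed.

Lemma structured_star :
  4 * (\sum_(v in heavy P t2) miss v) <= 29 * (f * t1) -> #|heavy P t2| = k ->
  forall (U : {set Fb}) z0 psi, {in U &, forall u v, ~~ adj u v} ->
        {in U &, injective psi} -> z0 \in heavy P t2 ->
        (forall u, u \in U -> psi u \in heavy P t2 /\ adj z0 (psi u)) ->
        k + \sum_(u in U) #|nbr u| < nedges Fb + 1 + #|U|.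
Proof.
move=> hM ck U z0 psi h1 h2 h3 h4.
have := @star_case U z0 psi [::]; rewrite addn0 ck; apply=> //.
by apply: leq_trans hM (leq_addl _ _).
Qed.

Lemma one_gadget x y : x \notin heavy P t2 -> y \notin heavy P t2 ->
  (x \in P) = (y \in P) -> adj x y -> forall g, g \in [:: (x, y)] -> inner_edge_gadget g.
Proof. by move=> hx hy hs xy g; rewrite inE => /eqP ->. Qed.

(** An inner edge outside the heavy set would be one more gadget, completing the star embedding with
    [U] empty. *)
Lemma structured_edges : k = nedges Fb -> join_structure Fb k P (heavy P t2).
Proof.
move=> ke; have [c2 _] := heavy_deficit; rewrite -ke in c2.
have [ck hM] := heavy_full c2; split=> //; last exact: structured_star.
move=> x y hx hy hs; apply/negP=> xy.
have /card_gt0P[z0 hz0] : 0 < #|heavy P t2| by rewrite ck.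
have := @star_case set0 z0 (fun _ => z0) [:: (x, y)].
rewrite big_set0 cards0 ck !addn0 /= ke ltnn => h; suff: false by [].
apply: h => //; try by [move=> u; rewrite inE | move=> u v; rewrite inE].
  by apply: leq_trans hM (leq_addl _ _).
exact: one_gadget.
Qed.

(** The star embedding still allows one heavy vertex too many. The rim embedding, with half of the
    heavy vertices on a colour class and half as gadgets, excludes it; an inner edge would replace
    the missing gadget. *)
Lemma structured_cycles : k.+1 = nedges Fb ->
  #|[set u | cb u]|.*2 = nedges Fb -> #|[set u | ~~ cb u]| = #|[set u | cb u]| -> join_structure Fb k P (heavy P t2).
Proof.
move=> ke cI cJ; have [c2 hD] := heavy_deficit; have c1 := heavy_lb; have s12 := heavy_subset.
have {}c2 : #|heavy P t2| <= k.
  rewrite leqNgt; apply/negP=> lt; have e2 : #|heavy P t2| = nedges Fb by lia.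
  have [A sA cA] := exists_subset_card (leq_trans hIk c1).
  suff [I0 [sI cI0 hI0]] : exists I0 : {set G}, [/\ I0 \subset heavy P t2, #|I0| = #|[set u | cb u]|
      & 4 * (\sum_(v in I0) miss v) <= #|G| + 29 * (f * t1)].
    by have := @rim_case I0 [::] sI cI0 hI0; rewrite /= => /(_ ltac:(by []) ltac:(by [])); lia.
  have sA2 := subset_trans sA s12.
  have eM : \sum_(v in heavy P t1) miss v
      = \sum_(v in A) miss v + \sum_(v in heavy P t1 :\: A) miss v.
    by rewrite (big_setID A) /= (setIidPr sA).
  rewrite eM in hD.
  set x := \sum_(v in A) _ in hD; set y := \sum_(v in _ :\: _) _ in hD.
  have [j1|j1] := ltnP k #|heavy P t1|; last first.
    exists A; split=> //; have ej : #|heavy P t1| = k by lia.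
    by rewrite -/x; move: hD; rewrite ej; clear; lia.
  have ej : #|heavy P t1| = k.+1 by have := subset_leq_card s12; lia.
  rewrite ej mulSn in hD.
  (* The vertices of [heavy P t1] may miss [#|G| / 2] vertices in total, so the half with the
     smaller deficit goes on the colour class. *)
  have [xy|yx] := leqP x y; first by exists A; split=> //; rewrite -/x; move: hD xy; clear; lia.
  exists (heavy P t1 :\: A); split.
  - exact: subset_trans (subsetDl _ _) s12.
  - by rewrite cardsD (setIidPr sA) cA ej; lia.
  - by rewrite -/y; move: hD yx; clear; lia.
have [ck hM] := heavy_full c2; split=> //; last exact: structured_star.
move=> x y hx hy hs; apply/negP=> xy.
have [|I0 sI cI0] := @exists_subset_card _ (heavy P t2) #|[set u | cb u]|; first by rewrite ck.
have hI0 : 4 * (\sum_(v in I0) miss v) <= #|G| + 29 * (f * t1).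
  apply: leq_trans (leq_trans hM (leq_addl _ _)); rewrite leq_mul2l /=.
  by rewrite [X in _ <= X](big_setID I0) /= (setIidPr sI) leq_addr.
have := @rim_case I0 [:: (x, y)] sI cI0 hI0 (one_gadget hx hy hs xy) isT.
by rewrite /= cI0 ck cJ; lia.
Qed.

End Structure.

(** * Counting and the reduction to large minimum degree *)

Lemma sum_constT (T : finType) c : \sum_(x : T) c = #|T| * c.
Proof. by rewrite sum_nat_const. Qed.

Lemma arcs_gjoin (A B : sgraph) : @arcs (gjoin A B) setT setT =
  @arcs A setT setT + @arcs B setT setT + 2 * (#|A| * #|B|).
Proof.
have dl (u : A) : #|@nbr (gjoin A B) (inl u)| = #|nbr u| + #|B|.
  rewrite -!sum1_card big_sumType /=; congr (_ + _).
    apply: eq_bigl => v; rewrite (@in_nbr (gjoin A B)) (@gjoin_adj A B (inl u) (inl v)).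
    by rewrite ?in_nbr.
  apply: eq_bigl => v; rewrite (@in_nbr (gjoin A B)) (@gjoin_adj A B (inl u) (inr v)).
    by rewrite ?in_nbr.
have dr (u : B) : #|@nbr (gjoin A B) (inr u)| = #|A| + #|nbr u|.
  rewrite -!sum1_card big_sumType /=; congr (_ + _).
    apply: eq_bigl => v; rewrite (@in_nbr (gjoin A B)) (@gjoin_adj A B (inr u) (inl v)).
    by rewrite ?in_nbr.
  apply: eq_bigl => v; rewrite (@in_nbr (gjoin A B)) (@gjoin_adj A B (inr u) (inr v)).
    by rewrite ?in_nbr.
rewrite -!sum_degE big_sumType /=.
under eq_bigr do rewrite dl; under [X in _ + X]eq_bigr do rewrite dr.
rewrite !big_split /= !sum_constT (mulnC #|B|); move: (#|A| * #|B|) => z.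
by rewrite -!addnA; congr (_ + _); rewrite addnA addnC addnn mul2n.
Qed.

Lemma edgeless_adj m (x y : edgeless m) : adj x y = false.
Proof. by rewrite /= /sclosure andbF. Qed.

Lemma arcs_edgeless m : @arcs (edgeless m) setT setT = 0.
Proof.
rewrite /arcs big1 // => v _; apply: eq_card0 => u.
by rewrite in_setI in_nbr edgeless_adj.
Qed.

Lemma card_turan2 m : #|turan2 m| = m.
Proof. by rewrite card_sum !card_ord addnC uphalf_half -addnA addnn odd_double_half. Qed.

Lemma arcs_turan2 m : @arcs (turan2 m) setT setT = 2 * (m./2 * uphalf m).
Proof. by rewrite arcs_gjoin !arcs_edgeless !card_ord. Qed.

Definition extremal_arcs (c k n : nat) : nat :=
  c + 2 * (k * (n - k)) + 2 * ((n - k)./2 * uphalf (n - k)).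

Lemma arcs_extremal (H : sgraph) n :
  @arcs (gjoin H (turan2 (n - #|H|))) setT setT
  = extremal_arcs (@arcs H setT setT) #|H| n.
Proof. by rewrite arcs_gjoin arcs_turan2 card_turan2 /extremal_arcs; lia. Qed.

(** The increment is twice the degree threshold used in the reduction to large minimum degree. *)
Lemma extremal_arcsS c k n : k <= n ->
  extremal_arcs c k n.+1 = extremal_arcs c k n + 2 * (k + (n.+1 - k)./2).
Proof.
move=> kn; rewrite /extremal_arcs subSn //; set m := n - k.
have -> : m.+1./2 = uphalf m by [].
have -> : uphalf m.+1 = m./2.+1 by [].
nia.
Qed.

Lemma extremal_arcs_lb c k n : k <= n ->
  n ^ 2 + 2 * (k * n) <= 2 * extremal_arcs c k n + 3 * k ^ 2 + 1.
Proof.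
move=> kn; rewrite /extremal_arcs; have := subnKC kn; set m := n - k => <-.
have := odd_double_half m; have : uphalf m = odd m + m./2 by rewrite uphalf_half.
case: (odd m) => /=; rewrite ?add0n ?add1n -muln2; nia.
Qed.

Lemma arcs_induced (G : sgraph) (C : {set G}) :
  @arcs (induced C) setT setT = arcs C C.
Proof.
rewrite -sum_degE /arcs (big_sub C (fun v => #|nbr v :&: C|)) /=; apply: eq_bigr => u _.
rewrite -(card_imset (@nbr (induced C) u) val_inj); apply: eq_card => y.
apply/imsetP/idP => [[v]|].
  by rewrite (@in_nbr (induced C)) induced_adj => uv ->; rewrite inE in_nbr uv (valP v).
rewrite inE in_nbr => /andP[uy yC]; exists (Sub y yC); rewrite ?SubK //.
by rewrite (@in_nbr (induced C)) induced_adj SubK.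
Qed.

Lemma arcs_del (G : sgraph) (v : G) :
  @arcs G setT setT = arcs (~: [set v]) (~: [set v]) + 2 * #|nbr v|.
Proof.
have a1 B : arcs [set v] B = #|nbr v :&: B| by rewrite /arcs big_set1.
have vv : #|nbr v :&: [set v]| = 0.
  by apply: eq_card0 => x; rewrite !inE; case: eqP => [->|]; rewrite ?andbF ?adj_irr.
have nv : #|nbr v| = #|nbr v :&: ~: [set v]|.
  by rewrite -(cardsID [set v] (nbr v)) vv setDE.
rewrite -{1 2}(setUCr [set v]) arcsDl ?disjointC // !arcsDr ?disjointC //.
by rewrite -!(arcsC [set v]) !a1 vv -nv; lia.
Qed.

Lemma induced_free (F G : sgraph) (C : {set G}) : free F G -> free F (induced C).
Proof.
move=> fr [h [hI hA]]; apply: fr; exists (fun x => val (h x)); split.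
  by move=> x y /val_inj /hI.
by move=> x y /hA; rewrite induced_adj.
Qed.

(* Deleting a vertex of degree below that of the extremal graph increases the
   surplus over the extremal number by one, which cannot go on for long. *)
Lemma min_degree_reduction (Fo : sgraph) (c k N : nat) (good : sgraph -> Prop) : k <= N ->
  (forall G : sgraph, N <= #|G| -> free Fo G -> (forall v : G, k + (#|G| - k)./2 <= #|nbr v|) ->
     extremal_arcs c k #|G| <= @arcs G setT setT ->
     @arcs G setT setT = extremal_arcs c k #|G| /\ good G) ->
  exists n0, forall G : sgraph, n0 <= #|G| -> free Fo G ->
     extremal_arcs c k #|G| <= @arcs G setT setT ->
     @arcs G setT setT = extremal_arcs c k #|G| /\ good G.
Proof.
move=> kN main.
have low (G : sgraph) d (v : G) : #|G| = N + d.+1 -> #|nbr v| < k + (#|G| - k)./2 ->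
    @arcs (induced (~: [set v])) setT setT <= extremal_arcs c k (N + d) + 2 * (N ^ 2 - d) ->
    @arcs G setT setT + 2 <= extremal_arcs c k #|G| + 2 * (N ^ 2 - d).
  move=> cG dv; rewrite arcs_induced (arcs_del v) cG (addnS N) extremal_arcsS; last by lia.
  by rewrite cG addnS in dv; lia.
(* On [N] vertices the surplus is at most [N ^ 2]; each further vertex lowers the bound by two,
   until truncated subtraction makes it zero. *)
have bound d : forall G : sgraph, #|G| = N + d -> free Fo G ->
    @arcs G setT setT <= extremal_arcs c k #|G| + 2 * (N ^ 2 - d).
  elim: d => [|d IH] G cG fr.
    apply: leq_trans (leq_arcs_mul _ _) _; rewrite cardsT cG addn0 mulnn; lia.
  have [/forallP hd|] := boolP [forall v : G, k + (#|G| - k)./2 <= #|nbr v|].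
    have [h|h] := leqP (extremal_arcs c k #|G|) (@arcs G setT setT); last by lia.
    by have [-> _] := main G ltac:(lia) fr hd h; apply: leq_addr.
  rewrite negb_forall => /existsP[v]; rewrite -ltnNge => dv.
  have cI : #|induced (~: [set v])| = N + d.
    rewrite card_sig; have := cardsC1 v; rewrite cG addnS /= => <-; exact: eq_card.
  have := IH _ cI (induced_free fr); rewrite cI => hI.
  by have := low G d v cG dv hI; lia.
exists (N + (N ^ 2).+1) => G nG fr ex; apply: main => //; first by lia.
move=> v; rewrite leqNgt; apply/negP=> dv.
have [d cG] : exists d, #|G| = N + d.+1.
  by exists (#|G| - N).-1; lia.
have cI : #|induced (~: [set v])| = N + d.
  rewrite card_sig; have := cardsC1 v; rewrite cG addnS /= => <-; exact: eq_card.
have := bound d _ cI (induced_free fr); rewrite cI => hI.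
have := low G d v cG dv hI; have -> : N ^ 2 - d = 0 by lia.
by lia.
Qed.

Lemma isomorphic_sym (G H : sgraph) : isomorphic G H -> isomorphic H G.
Proof.
move=> [h [[g hK gK] hA]]; exists g; split; first by exists h.
by move=> x y; rewrite -hA !gK.
Qed.

Lemma arcs_full (G : sgraph) (A B : {set G}) : #|A| * #|B| <= arcs A B ->
  {in A & B, forall x y, adj x y}.
Proof.
move=> full x y xA yB; apply: contraTT full => nxy; rewrite -ltnNge.
rewrite /arcs (bigD1 x) //= -sum_nat_const [X in _ < X](bigD1 x) //= -addSn leq_add //.
  apply: proper_card; apply/properP; split; first exact: subsetIr.
  by exists y => //; rewrite inE in_nbr (negbTE nxy).
by apply: leq_sum => z _; rewrite subset_leq_card ?subsetIr.
Qed.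

Lemma balanced_product a b m : a + b = m ->
  a * b <= m./2 * uphalf m /\
  (m./2 * uphalf m <= a * b -> (a = m./2 /\ b = uphalf m) \/ (b = m./2 /\ a = uphalf m)).
Proof.
move=> <-; wlog ab : a b / a <= b.
  move=> hw; have [ab|/ltnW ba] := leqP a b; first exact: hw.
  have [h1 h2] := hw b a ba; rewrite addnC mulnC; split=> // h.
  by have [] := h2 h; [right|left].
have := odd_double_half (a + b); have : uphalf (a + b) = odd (a + b) + (a + b)./2 by rewrite uphalf_half.
set p := (a + b)./2; set q := uphalf _; case: (odd _) => /= hq hp; rewrite -muln2 in hp.
  split=> [|h]; first by nia.
  have e : a = p by nia.
  by left; split; lia.
split=> [|h]; first by nia.
have e : a = p by nia.
  by left; split; lia.
Qed.

Lemma isomorphic_join_turan (G H : sgraph) (W V1 V2 : {set G}) (g : H -> G) :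
  #|W| = #|H| -> injective g -> (forall x, g x \in W) ->
  (forall x y, adj (g x) (g y) = adj x y) ->
  [disjoint W & V1] -> [disjoint W & V2] -> [disjoint V1 & V2] -> 
  #|W| + #|V1| + #|V2| = #|G| ->
  #|V1| = (#|G| - #|H|)./2 -> #|V2| = uphalf (#|G| - #|H|) ->
  {in W & V1, forall x y, adj x y} -> {in W & V2, forall x y, adj x y} ->
  {in V1 & V2, forall x y, adj x y} ->
  {in V1 &, forall x y, ~~ adj x y} -> {in V2 &, forall x y, ~~ adj x y} ->
  isomorphic G (gjoin H (turan2 (#|G| - #|H|))).
Proof.
move=> cW gI gW gA d1 d2 d3 cG c1 c2 a1 a2 a3 n1 n2; apply: isomorphic_sym.
pose h (x : gjoin H (turan2 (#|G| - #|H|))) : G := match x with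
  | inl u => g u
  | inr (inl i) => enum_val (cast_ord (esym c1) i)
  | inr (inr j) => enum_val (cast_ord (esym c2) j)
  end.
have h1 i : h (inr (inl i)) \in V1 by apply: enum_valP.
have h2 i : h (inr (inr i)) \in V2 by apply: enum_valP.
have dis (A B : {set G}) x y : [disjoint A & B] -> x \in A -> y \in B -> x <> y.
  by move=> /pred0P dAB xA yB e; have := dAB x; rewrite /= xA e yB.
have hI : injective h.
  move=> [u|[i|i]] [v|[j|j]] e; try by
    [case: (dis _ _ _ _ d1 (gW _) (h1 _) e) | case: (dis _ _ _ _ d2 (gW _) (h2 _) e)
    |case: (dis _ _ _ _ d3 (h1 _) (h2 _) e) | case: (dis _ _ _ _ d1 (gW _) (h1 _) (esym e))
    |case: (dis _ _ _ _ d2 (gW _) (h2 _) (esym e)) |case: (dis _ _ _ _ d3 (h1 _) (h2 _) (esym e))].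
  - by rewrite (gI _ _ e).
  - by move/enum_val_inj/cast_ord_inj: e => ->.
  - by move/enum_val_inj/cast_ord_inj: e => ->.
exists h; split.
  apply: inj_card_bij hI _; rewrite card_sum card_turan2 -cG cW; lia.
move=> [u|[i|i]] [v|[j|j]]; rewrite !gjoin_adj ?edgeless_adj.
- exact: gA.
- exact: a1 (gW u) (h1 j).
- exact: a2 (gW u) (h2 j).
- by rewrite adj_sym; apply: a1 (gW v) (h1 i).
- exact/negbTE/(n1 _ _ (h1 i) (h1 j)).
- exact: a3 (h1 i) (h2 j).
- by rewrite adj_sym; apply: a2 (gW v) (h2 i).
- by rewrite adj_sym; apply: a3 (h1 j) (h2 i).
- exact/negbTE/(n2 _ _ (h2 i) (h2 j)).
Qed.

(** The arcs split into those inside [W], between [W] and the rest, and across the rest. Each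
    summand is bounded by its value in the candidate, so a total at least as large forces equality
    everywhere, including the balance of the two sides. *)
Lemma finish_extremal (G H : sgraph) (P W : {set G}) :
  #|W| = #|H| ->
  (forall x y, x \notin W -> y \notin W -> (x \in P) = (y \in P) -> ~~ adj x y) ->
  arcs W W <= @arcs H setT setT ->
  (arcs W W = @arcs H setT setT ->
     exists g : H -> G, [/\ injective g, forall x, g x \in W & forall x y, adj (g x) (g y) = adj x y]) ->
  extremal_arcs (@arcs H setT setT) #|H| #|G| <= @arcs G setT setT ->
  @arcs G setT setT = extremal_arcs (@arcs H setT setT) #|H| #|G| /\
  isomorphic G (gjoin H (turan2 (#|G| - #|H|))).
Proof.
move=> cW noE aW hg; set c := @arcs H setT setT in aW hg *; set k := #|H| in cW *.
rewrite /extremal_arcs; set m := #|G| - k => ex.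
pose V b := part P b :\: W.
have inV b x : (x \in V b) = (x \notin W) && ((x \in P) == b) by rewrite in_setD in_part.
have dV : [disjoint V true & V false].
  by apply/pred0P=> x /=; rewrite !inV; case: (x \in P); rewrite ?andbF.
have dW b : [disjoint W & V b].
  by apply/pred0P=> x /=; rewrite inV; case: (x \in W).
have eV : V true :|: V false = ~: W.
  by apply/setP=> x; rewrite in_setU !inV !inE; case: (x \in P); rewrite ?andbF ?andbT ?orbF.
have cV : #|V true| + #|V false| = #|~: W|.
  by rewrite -eV cardsU (disjoint_setI0 dV) cards0 subn0.
have cC := cardsC W; rewrite cW in cC.
have cm : #|V true| + #|V false| = m by rewrite cV /m; lia.
have nV b : {in V b &, forall x y, ~~ adj x y}.
  by move=> x y; rewrite !inV => /andP[xW /eqP xP] /andP[yW /eqP yP]; apply: noE; rewrite ?xP ?yP.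
have aV b : arcs (V b) (V b) = 0.
  rewrite /arcs big1 // => x xV; apply: eq_card0 => y; rewrite inE in_nbr.
  by apply/negP=> /andP[xy yV]; have := nV b x y xV yV; rewrite xy.
have eG : @arcs G setT setT = arcs W W + 2 * (arcs W (V true) + arcs W (V false))
    + 2 * arcs (V true) (V false).
  rewrite -{1 2}(setUCr W) arcsDl ?disjointC // !arcsDr ?disjointC // -eV !arcsDr // !arcsDl //.
  by rewrite !aV (arcsC (V true) W) (arcsC (V false) W) (arcsC (V false)); lia.
have b1 := leq_arcs_mul W (V true); have b2 := leq_arcs_mul W (V false).
have b3 := leq_arcs_mul (V true) (V false); rewrite cW in b1 b2.
have [b4 b5] := balanced_product cm.
have km : k * #|V true| + k * #|V false| = k * m by rewrite -mulnDr cm.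
have e0 : arcs W W = c by move: ex; rewrite eG; lia.
have e1 : k * #|V true| <= arcs W (V true) by move: ex; rewrite eG; lia.
have e2 : k * #|V false| <= arcs W (V false) by move: ex; rewrite eG; lia.
have e3 : #|V true| * #|V false| <= arcs (V true) (V false) by move: ex; rewrite eG; lia.
have e4 : m./2 * uphalf m <= #|V true| * #|V false| by move: ex; rewrite eG; lia.
split; first by move: ex; rewrite eG; lia.
have [g [gI gW gA]] := hg e0.
have f1 : {in W & V true, forall x y, adj x y} by apply: arcs_full; rewrite cW.
have f2 : {in W & V false, forall x y, adj x y} by apply: arcs_full; rewrite cW.
have f3 : {in V true & V false, forall x y, adj x y} by apply: arcs_full.
case: (b5 e4) => [[c1 c2]|[c2 c1]].
  by apply: (@isomorphic_join_turan G H W (V true) (V false) g) => //; lia.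
apply: (@isomorphic_join_turan G H W (V false) (V true) g) => //.
- by rewrite disjoint_sym.
- by lia.
- by move=> x y xV yV; rewrite adj_sym; apply: f3.
Qed.

(** * The extremal graphs are free *)

Lemma arcs_compl_lb (G : sgraph) (U : {set G}) :
  2 * nedges G <= arcs (~: U) (~: U) + 2 * \sum_(u in U) #|nbr u|.
Proof.
have -> : \sum_(u in U) #|nbr u| = arcs U setT by apply: eq_bigr => u _; rewrite setIT.
rewrite (mul2n (nedges G)) -arcsTT -{1}(setUCr U) arcsDl ?disjointC //.
rewrite -[in arcs (~: U) setT](setUCr U) arcsDr ?disjointC // (arcsC (~: U) U).
have : arcs U (~: U) <= arcs U setT by rewrite arcsSr // subsetT.
lia.
Qed.

Section Freeness.
Variables (Fb H : sgraph) (m : nat).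
Local Notation F := (gjoin (complete 1) Fb).
Variable l : oedge F -> nat.
Hypothesis hl : forall p, odd (l p) /\ 5 <= l p.
Local Notation w := (inl ord0 : F).

Variable h : ballooning l -> gjoin H (turan2 m).
Hypothesis hI : injective h.
Hypothesis hA : forall x y, adj x y -> adj (h x) (h y).

Definition in_left (x : ballooning l) : bool := if h x is inl _ then true else false.

Let tau (x : ballooning l) : bool := if h x is inr (inl _) then true else false.

Lemma tau_adj x y : adj x y -> ~~ in_left x -> ~~ in_left y -> tau y = ~~ tau x.
Proof.
move/hA; rewrite /in_left /tau.
case: (h x) => [//|[i|i]]; case: (h y) => [//|[j|j]] //; rewrite gjoin_adj => + _ _ //.
  by rewrite gjoin_adj edgeless_adj.
by rewrite gjoin_adj edgeless_adj.
Qed.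

Definition path_vertex (p : oedge F) (i : 'I_(l p - 2)) : ballooning l :=
  inr (Tagged (fun p => 'I_(l p - 2)) i).

Lemma ballooning_adj (x y : ballooning l) : x != y -> balloon_rel x y -> adj x y.
Proof. by move=> ne h0; rewrite /= /sclosure ne h0. Qed.

(** Off the small part the host is bipartite, while the cycle of [p] is odd: along the new path
    [tau] alternates, which contradicts the edge between its ends. *)
Lemma left_hits_cycle p :
  [|| in_left (inl (val p).1), in_left (inl (val p).2)
    | [exists i : 'I_(l p - 2), in_left (path_vertex i)]].
Proof.
have [op l5] := hl p.
apply: contraT; rewrite !negb_or negb_exists => /and3P[n1 n2 /forallP nv].
have a12 : @adj (ballooning l) (inl (val p).1) (inl (val p).2).
  have /andP[ad _] := valP p; apply: ballooning_adj => //.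
  by apply: contraTneq ad => -[->]; rewrite adj_irr.
have lt0 : 0 < l p - 2 by clear -l5; lia.
have lt1 : l p - 3 < l p - 2 by clear -l5; lia.
have b1 := @tau_adj (inl (val p).1) (path_vertex (Ordinal lt0)).
have b2 := @tau_adj (inl (val p).2) (path_vertex (Ordinal lt1)).
have alt i (lti : i < l p - 2) : tau (path_vertex (Ordinal lti)) = odd i (+) tau (path_vertex (Ordinal lt0)).
  elim: i lti => [|i IH] lti; first by rewrite (bool_irrelevance lti lt0).
  have lti' : i < l p - 2 by apply: ltnW.
  rewrite (@tau_adj (path_vertex (Ordinal lti'))) ?nv ?IH //=; first by case: (odd i); case: (tau _).
  apply: ballooning_adj; last by rewrite /= !eqxx.
  apply/eqP=> /(congr1 (fun x : ballooning l => if x is inr z then nat_of_ord (tagged z) else 0)).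
  exact: n_Sn.
have e1 : tau (path_vertex (Ordinal lt0)) = ~~ tau (inl (val p).1).
  by apply: b1 => //; apply: ballooning_adj => //=; rewrite !eqxx.
have e2 : tau (path_vertex (Ordinal lt1)) = ~~ tau (inl (val p).2).
  by apply: b2 => //; apply: ballooning_adj => //=; rewrite !eqxx orbT.
have e3 := tau_adj a12 n1 n2.
have ol : odd (l p - 3) = false by rewrite oddB ?op //; clear -l5; lia.
move: e2; rewrite alt ol /= e1 e3; by case: (tau _).
Qed.

Lemma card_left : #|[set x | in_left x]| <= #|H|.
Proof.
have sub : h @: [set x | in_left x] \subset [set inl u | u : H].
  apply/subsetP=> y /imsetP[x]; rewrite inE /in_left.
  by case ex: (h x) => [u|//] _ ->; apply/imsetP; exists u.
rewrite -(card_imset _ hI); apply: leq_trans (subset_leq_card sub) _.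
by apply: leq_trans (leq_imset_card _ _) _.
Qed.

Lemma oedge_of (u v : F) : adj u v -> exists p : oedge F,
  (val p = (u, v)) \/ (val p = (v, u)).
Proof.
move=> uv; case: (ltngtP (enum_rank u) (enum_rank v)) => lt.
- have hp : adj (u, v).1 (u, v).2 && (enum_rank (u, v).1 < enum_rank (u, v).2) by rewrite uv lt.
  by exists (Sub (u, v) hp); left; rewrite SubK.
- have hp : adj (v, u).1 (v, u).2 && (enum_rank (v, u).1 < enum_rank (v, u).2).
    by rewrite adj_sym uv lt.
  by exists (Sub (v, u) hp); right; rewrite SubK.
- by move/val_inj/enum_rank_inj: lt uv => ->; rewrite adj_irr.
Qed.

(** The cycles on the spokes share only the centre. If it is not in the small part, each of the
    [#|Fb|] cycles has its own vertex there; [own] sends such a vertex to the rim end of its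
    spoke. *)
Lemma center_in_left : #|H| < #|Fb| -> in_left (inl w).
Proof.
move=> lt; apply: contraT => nw; move: lt; rewrite ltnNge => /negP[].
pose own (x : ballooning l) : option Fb := match x with
  | inl (inr v) => Some v
  | inl (inl _) => None
  | inr z => match val (tag z) with
             | (inl _, inr v) | (inr v, inl _) => Some v
             | _ => None
             end
  end.
apply: leq_trans card_left; apply: leq_trans (leq_imset_card own _).
have SI : injective (@Some Fb) by move=> a b [].
rewrite -[#|Fb|]cardsT -(card_imset _ SI); apply: subset_leq_card.
apply/subsetP=> y /imsetP[v _ ->]; apply/imsetP.
have wv : @adj F w (inr v) by rewrite gjoin_adj.
have [p hp] := oedge_of wv; have := left_hits_cycle p.
case hv : (in_left (inl (inr v))); first by exists (inl (inr v)); rewrite ?inE.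
have -> : in_left (inl (val p).1) = false by case: hp => -> //=; apply/negbTE.
have -> : in_left (inl (val p).2) = false by case: hp => -> //=; apply/negbTE.
move=> /= /existsP[i hi]; exists (path_vertex i); first by rewrite inE.
by rewrite /own /=; case: hp => ->.
Qed.

(** Converse of the star embedding: the cycles on edges of [Fb] avoiding [U] are hit in their new
    vertices, distinct for distinct edges, and these come on top of the centre and [U]. *)
Lemma star_in_left (U := [set u : Fb | in_left (inl (inr u))]) : in_left (inl w) ->
  nedges Fb + 1 + #|U| <= #|H| + \sum_(u in U) #|nbr u|.
Proof.
move=> hw.
pose D (x : F) : bool := if x is inr u then u \in U else true.
pose E := [set p : oedge F | ~~ D (val p).1 && ~~ D (val p).2].
have cE : arcs (~: U) (~: U) <= 2 * #|E|.
  rewrite mul2n (@oedge_count F (fun a b => ~~ D a && ~~ D b)); last by move=> a b; rewrite andbC.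
  pose S := [set q : Fb * Fb | adj q.1 q.2 && ((q.1 \notin U) && (q.2 \notin U))].
  pose ir (q : Fb * Fb) : F * F := (inr q.1, inr q.2).
  have irI : injective ir by move=> [a b] [c d] [-> ->].
  apply: leq_trans (_ : #|S| <= _).
    rewrite (@card_pairs Fb (fun a b => adj a b && ((a \notin U) && (b \notin U)))).
    rewrite arcs_sum big_mkcond /=; apply: leq_sum => u _; rewrite in_setC.
    case: (u \in U) => //=; rewrite big_mkcond /=; apply: leq_sum => v _; rewrite in_setC.
    by case: (v \in U); rewrite //= andbT.
  rewrite -(card_imset _ irI); apply: subset_leq_card; apply/subsetP=> q /imsetP[[u v] uvS ->].
  move: uvS; rewrite [_ \in S]inE => /andP[uv /andP[uU vU]]; rewrite inE /ir /fst /snd gjoin_adj.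
  by apply/andP; split=> //; apply/andP; split.
have key : 1 + #|U| + #|E| <= #|H|.
  apply: leq_trans card_left.
  pose own (x : ballooning l) : option (Fb + oedge F) := match x with
    | inl (inr v) => Some (inl v)
    | inl (inl _) => None
    | inr z => Some (inr (tag z))
    end.
  apply: leq_trans (leq_imset_card own _).
  pose T1 : {set option (Fb + oedge F)} := [set Some (inl u) | u in U].
  pose T2 : {set option (Fb + oedge F)} := [set Some (inr p) | p in E].
  have c1 : #|T1| = #|U| by rewrite card_imset // => a b [].
  have c2 : #|T2| = #|E| by rewrite card_imset // => a b [].
  have cT : #|None |: (T1 :|: T2)| = 1 + #|U| + #|E|.
    rewrite cardsU1 cardsU c1 c2 (_ : T1 :&: T2 = set0) ?cards0 ?subn0.
      rewrite (_ : None \notin T1 :|: T2) ?addnA // in_setU negb_or.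
      by apply/andP; split; apply/imsetP=> -[].
    apply/setP=> y; rewrite in_setI in_set0; apply/negP=> /andP[/imsetP[a _ ->] /imsetP[b _]].
    by [].
  rewrite -cT; apply: subset_leq_card; apply/subsetP=> y /setU1P[->|/setUP[]].
  - by apply/imsetP; exists (inl w); rewrite ?inE.
  - by case/imsetP=> u uU ->; apply/imsetP; exists (inl (inr u)); rewrite // inE; move: uU; rewrite inE.
  case/imsetP=> p pE ->; apply/imsetP; move: pE; rewrite inE => /andP[d1 d2].
  have D_left x : in_left (inl x) -> D x.
    by case: x => [//|u] hu; rewrite /D inE.
  have := left_hits_cycle p.
  have -> : in_left (inl (val p).1) = false by apply/negbTE; apply: contra d1; apply: D_left.
  have -> : in_left (inl (val p).2) = false by apply/negbTE; apply: contra d2; apply: D_left.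
  by move=> /= /existsP[i hi]; exists (path_vertex i); rewrite ?inE.
by have := arcs_compl_lb U; clear -cE key; lia.
Qed.

End Freeness.

Lemma extremal_free (Fb H : sgraph) m (l : oedge (gjoin (complete 1) Fb) -> nat) :
  (forall p, odd (l p) /\ 5 <= l p) -> #|H| < #|Fb| ->
  (forall (U : {set Fb}) (z0 : H) (psi : Fb -> H), {in U &, injective psi} ->
     (forall u, u \in U -> adj z0 (psi u)) ->
     #|H| + \sum_(u in U) #|nbr u| < nedges Fb + 1 + #|U|) ->
  free (ballooning l) (gjoin H (turan2 m)).
Proof.
move=> hl lt star [h [hI hA]]; have hw := center_in_left hl hI hA lt.
pose U := [set u : Fb | in_left h (inl (inr u))].
have [z0 hz0] : exists z0, h (inl (inl ord0)) = inl z0.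
  by move: hw; rewrite /in_left; case: (h _) => [z _|//]; exists z.
pose psi (u : Fb) := if h (inl (inr u)) is inl z then z else z0.
have hpsi u : u \in U -> h (inl (inr u)) = inl (psi u).
  by rewrite inE /in_left /psi; case: (h _).
have := star_in_left hl hI hA hw; rewrite -/U /= leqNgt => /negP[].
apply: (star U z0 psi).
  move=> u v uU vU e; have : h (inl (inr u)) = h (inl (inr v)) by rewrite !hpsi // e.
  by move/hI=> [].
move=> u uU; have /hA : @adj (ballooning l) (inl (inl ord0)) (inl (inr u)).
  exact: ballooning_adj.
by rewrite hz0 (hpsi u uU) gjoin_adj.
Qed.

(** * The graph induced on the heavy vertices *)

Section NearMatching.
Variable t : nat.
Local Notation M := (gunion (matching t) (complete 1)).

Lemma near_matching_adj (x y : M) :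
  adj x y = if x is inl ib then y == inl (ib.1, ~~ ib.2) else false.
Proof.
case: x y => [[i b]|i] [[j c]|j] //=; rewrite /sclosure /= ?andbF //; last by rewrite !ord1 eqxx.
have il (a a' : 'I_t * bool) : (inl a == inl a' :> 'I_t * bool + 'I_1) = (a == a').
  by apply: inj_eq => ? ? [].
by rewrite !il !xpair_eqE (eq_sym j i); case: (i == j); case: b; case: c.
Qed.

Lemma near_matching_deg (x : M) : #|nbr x| = if x is inl _ then 1 else 0.
Proof.
case: x => [ib|i]; last by apply: eq_card0 => y; rewrite in_nbr near_matching_adj.
pose z : svertex M := inl (ib.1, ~~ ib.2); transitivity #|[set z]|; last exact: cards1.
by apply: eq_card => y; rewrite in_nbr near_matching_adj in_set1.
Qed.

Lemma card_near_matching : #|M| = (2 * t).+1.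
Proof. by rewrite card_sum card_prod !card_ord card_bool; lia. Qed.

Lemma arcs_near_matching : @arcs M setT setT = 2 * t.
Proof.
rewrite -sum_degE; under eq_bigr do rewrite near_matching_deg.
rewrite big_sumType /= [X in _ + X]big1 // sum1_card card_prod card_ord card_bool; lia.
Qed.

Variables (G : sgraph) (W : {set G}).
Hypothesis cW : #|W| = (2 * t).+1.
Hypothesis deg1 : forall z0 z1 z2, z0 \in W -> z1 \in W -> z2 \in W ->
  adj z0 z1 -> adj z0 z2 -> z1 = z2.

Let A := [set v in W | nbr v :&: W != set0].
Let sg v := odflt v [pick u in nbr v :&: W].

Lemma partner_eq v u : v \in W -> u \in W -> adj v u -> sg v = u.
Proof.
move=> vW uW vu; rewrite /sg; case: pickP => [z|/(_ u)]; last by rewrite !inE vu uW.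
by rewrite !inE => /andP[vz zW]; apply: (deg1 vW).
Qed.

Lemma partner v : v \in A -> [/\ sg v \in A, adj v (sg v) & sg (sg v) = v].
Proof.
rewrite inE => /andP[vW /set0Pn[u]]; rewrite !inE => /andP[vu uW].
rewrite (partner_eq vW uW vu); split=> //; last by apply: partner_eq; rewrite // adj_sym.
by apply/andP; split=> //; apply/set0Pn; exists v; rewrite !inE adj_sym vu.
Qed.

Lemma arcs_matched : arcs W W = #|A|.
Proof.
rewrite /arcs -sum1_card [RHS]big_mkcond [LHS]big_mkcond /=; apply: eq_bigr => v _.
rewrite [v \in A]inE; case: (boolP (v \in W)) => //= vW; case: ifP => [/set0Pn[u]|].
  rewrite inE in_nbr => /andP[vu uW]; rewrite -(cards1 u); apply: eq_card => x.
  rewrite in_set1 inE in_nbr; apply/andP/eqP => [[vx xW]|-> //]; exact: (deg1 vW).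
by move=> /negbT; rewrite negbK => /eqP ->; rewrite cards0.
Qed.

(** The number of arcs is even and at most [#|W|], which is odd. *)
Lemma near_matching_bound : arcs W W <= 2 * t.
Proof.
have ev := arcsTT (induced W); rewrite arcs_induced in ev.
have : #|A| <= #|W| by apply: subset_leq_card; apply/subsetP=> x; rewrite inE => /andP[].
by rewrite -arcs_matched ev cW -mul2n; lia.
Qed.

(** From each matched pair the vertex of smaller rank becomes the first end; one vertex of [W] is
    left over for the isolated vertex. *)
Lemma near_matching_embedding : arcs W W = 2 * t ->
  exists g : M -> G, [/\ injective g, forall x, g x \in W & forall x y, adj (g x) (g y) = adj x y].
Proof.
rewrite arcs_matched => cA.
have sAW v : v \in A -> v \in W by rewrite inE => /andP[].
pose R := [set v in A | enum_rank v < enum_rank (sg v)].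
have RA v : v \in R -> v \in A by rewrite inE => /andP[].
have sgR v : v \in R -> sg v \notin R.
  move=> vR; have [_ _ e] := partner (RA v vR); move: vR; rewrite !inE e => /andP[_ lt].
  by rewrite negb_and -leqNgt (ltnW lt) orbT.
have cR : #|R| = t.
  have e : A :\: R = sg @: R.
    apply/setP=> v; rewrite in_setD; apply/andP/imsetP => [[vR vA]|[u uR ->]]; last first.
      by split; [apply: sgR|have [] := partner (RA u uR)].
    have [sA vs e] := partner vA; exists (sg v); rewrite ?e // inE sA e /=.
    move: vR; rewrite inE vA /= -leqNgt leq_eqVlt => /orP[/eqP/val_inj/enum_rank_inj ee|//].
    by move: vs; rewrite ee adj_irr.
  have : #|A :\: R| = #|R|.
    rewrite e card_in_imset // => u v uR vR /(congr1 sg).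
    by have [_ _ ->] := partner (RA u uR); have [_ _ ->] := partner (RA v vR).
  by have := cardsID R A; rewrite (setIidPr _); [lia|apply/subsetP].
have [z zW zA] : exists2 z, z \in W & z \notin A by apply: exists_notin; rewrite cA cW.
pose r (i : 'I_t) := enum_val (cast_ord (esym cR) i).
have rR i : r i \in R by apply: enum_valP.
have rI : injective r by move=> i j /enum_val_inj/cast_ord_inj.
pose g (x : M) : G := if x is inl ib then (if ib.2 then sg (r ib.1) else r ib.1) else z.
have gA ib : g (inl ib) \in A.
  by rewrite /g; case: ib.2; [have [] := partner (RA _ (rR ib.1))|apply: RA].
have gW x : g x \in W by case: x => [ib|i] //; apply: sAW.
have gsg ib : sg (g (inl ib)) = g (inl (ib.1, ~~ ib.2)).
  by case: ib => i [] //=; have [] := partner (RA _ (rR i)).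
have gI : injective g.
  move=> [[i b]|i] [[j c]|j] e; last by rewrite !ord1.
  - suff [-> ->] : i = j /\ b = c by [].
    move: e; rewrite /g /=; case: b; case: c => e.
    + split=> //; apply: rI; have := congr1 sg e.
      by have [_ _ ->] := partner (RA _ (rR i)); have [_ _ ->] := partner (RA _ (rR j)).
    + by have := sgR _ (rR i); rewrite e rR.
    + by have := sgR _ (rR j); rewrite -e rR.
    + by split=> //; apply: rI.
  - by move: zA; rewrite -[z]/(g (inr j)) -e gA.
  - by move: zA; rewrite -[z]/(g (inr i)) e gA.
exists g; split=> // x y; rewrite near_matching_adj; case: x => [ib|i].
  rewrite -(inj_eq gI) -gsg; apply/idP/eqP => [xy|->].
    by apply/esym/partner_eq.
  by have [] := partner (gA ib).
apply/negbTE; apply: contra zA => zy; rewrite inE zW; apply/set0Pn.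
by exists (g y); rewrite inE in_nbr zy gW.
Qed.
End NearMatching.

Lemma enum_embedding (G : sgraph) (W : {set G}) (k : nat) (r : rel 'I_k) : #|W| = k ->
  (forall (g : 'I_k -> G), injective g -> (forall i, g i \in W) ->
     forall i j, adj (g i) (g j) = @adj (graph_of_rel r) i j) ->
  exists g : graph_of_rel r -> G,
    [/\ injective g, forall x, g x \in W & forall x y, adj (g x) (g y) = adj x y].
Proof.
move=> cW hr; pose g (i : 'I_k) := enum_val (cast_ord (esym cW) i).
have gI : injective g by move=> i j /enum_val_inj/cast_ord_inj.
have gW i : g i \in W by apply: enum_valP.
by exists g; split=> //; apply: hr.
Qed.

Lemma arcs_complete k : @arcs (complete k) setT setT = k * k.-1.
Proof.
rewrite -sum_degE; under eq_bigr => x _.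
  have -> : #|nbr x| = k.-1.
    have := cardsC1 x; rewrite card_ord => <-; apply: eq_card => y.
    by rewrite in_nbr complete_adj !inE eq_sym.
  over.
by rewrite sum_nat_const card_ord.
Qed.

Lemma arcs_self_bound (G : sgraph) (W : {set G}) :
  arcs W W <= #|W| * #|W|.-1 /\
  (arcs W W = #|W| * #|W|.-1 -> {in W &, forall x y, x != y -> adj x y}).
Proof.
have cD v : v \in W -> #|nbr v :&: W| <= #|W :\ v| /\ #|W|.-1 = #|W :\ v|.
  move=> vW; split; last by rewrite (cardsD1 v W) vW.
  apply: subset_leq_card; apply/subsetP=> u; rewrite !inE => /andP[vu ->].
  by rewrite andbT eq_sym (adj_neq vu).
have bd v : v \in W -> #|nbr v :&: W| <= #|W|.-1 by move=> /cD[h ->].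
split=> [|eqW x y xW yW xy]; first by rewrite -sum_nat_const; apply: leq_sum.
apply: contraT => nxy; suff : arcs W W < #|W| * #|W|.-1 by rewrite eqW ltnn.
rewrite /arcs (bigD1 x) //= -sum_nat_const [X in _ < X](bigD1 x) //= -addSn leq_add //.
  have [_ ->] := cD x xW; apply: proper_card; apply/properP; split.
    apply/subsetP=> u; rewrite !inE => /andP[xu ->]; by rewrite andbT eq_sym (adj_neq xu).
  by exists y; rewrite ?inE ?(negbTE nxy) // eq_sym xy.
by apply: leq_sum => v /andP[vW _]; apply: bd.
Qed.

(** Along a new path a third colour alternates with the colour of the first end. The last inner
    vertex has even index [l p - 3], hence the third colour, which also differs from that of the
    second end. *)
Lemma ballooning_color (F : sgraph) (l : oedge F -> nat) (kF : F -> 'I_3) :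
  (forall p, odd (l p) /\ 5 <= l p) -> (forall u v, adj u v -> kF u != kF v) ->
  exists kB : ballooning l -> 'I_3, forall x y, adj x y -> kB x != kB y.
Proof.
move=> hl kP; pose third (a b : 'I_3) := odflt a [pick c | (c != a) && (c != b)].
have thirdP a b : (third a b != a) && (third a b != b).
  rewrite /third; case: pickP => [//|no]; exfalso.
  have : #|[set: 'I_3]| <= #|[set a; b]|.
    apply: subset_leq_card; apply/subsetP=> c _; have := no c; rewrite !inE.
    by case: (c == a); case: (c == b).
  by rewrite cardsT card_ord cards2; case: (_ != _).
pose kB (x : F + new_vertex l) := match x with
  | inl u => kF u
  | inr z => let p := tag z in if odd (tagged z) then kF (val p).1
             else third (kF (val p).1) (kF (val p).2)
  end.
have kR x y : balloon_rel x y -> kB x != kB y.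
  case: x y => [u|[p i]] [v|[q j]] //=; first exact: kP.
  - have [op l5] := hl q; have /andP[t1 t2] := thirdP (kF (val q).1) (kF (val q).2).
    case/orP=> /andP[/eqP -> /eqP ->] /=; first by rewrite eq_sym.
    have -> : odd (l q - 3) = false by rewrite oddB ?op //; clear -l5; lia.
    by rewrite eq_sym.
  - case/andP=> /eqP epq; move: j; rewrite -epq => j /eqP <- /=.
    have /andP[t1 t2] := thirdP (kF (val p).1) (kF (val p).2).
    by case: (odd i) => //=; rewrite eq_sym.
exists kB => x y /andP[_ /orP[|] /kR //]; by rewrite eq_sym.
Qed.

Lemma sum_inn (G : sgraph) (P : {set G}) : \sum_(v : G) inn P v = inner_arcs P.
Proof.
rewrite /inner_arcs /arcs (bigID (mem P)) /=; congr (_ + _).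
  apply: eq_bigr => v vP; rewrite /inn vP; congr #|pred_of_set (_ :&: _)|.
  by apply/setP=> x; rewrite in_part eqb_id.
apply: eq_big => [v|v vP]; first by rewrite inE.
rewrite /inn (negbTE vP); congr #|pred_of_set (_ :&: _)|.
by apply/setP=> x; rewrite in_part inE; case: (x \in P).
Qed.

(** * Choice of the constants *)

Section MainStructure.
Variables (Fb : sgraph) (cb : Fb -> bool) (k c : nat).
Local Notation F := (gjoin (complete 1) Fb).
Variable l : oedge F -> nat.
Hypothesis hl : forall p, odd (l p) /\ 5 <= l p.
Hypothesis hcb : forall u v, adj u v -> cb u != cb v.
Hypothesis hke : k <= nedges Fb.
Hypothesis hk0 : 0 < k.
Hypothesis hIk : #|[set u | cb u]| <= k.
Hypothesis hkind : k = nedges Fb \/ [/\ k.+1 = nedges Fb,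
  #|[set u | cb u]|.*2 = nedges Fb & #|[set u | ~~ cb u]| = #|[set u | cb u]|].

Lemma main_structure : exists2 N, k <= N & forall G : sgraph, N <= #|G| ->
  free (ballooning l) G -> (forall v : G, k + (#|G| - k)./2 <= #|nbr v|) ->
  extremal_arcs c k #|G| <= @arcs G setT setT ->
  exists P W : {set G}, join_structure Fb k P W.
Proof.
pose f := #|ballooning l| + nedges Fb.
have f0 : 0 < f by rewrite /f; lia.
pose q := 100 * f; have q0 : 0 < q by rewrite /q; lia.
have s0 : 0 < #|ballooning l|.
  by apply/card_gt0P; exists (inl (inl ord0)).
(* With this factor the inner arcs number at most [n ^ 2 / (4 * q ^ 6)], which is at most [t3 ^ 2]
   as [n <= 2 * (q ^ 3 * t3)]; hence at most [t3] vertices have inner degree at least [t3]. *)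
have R0 : 0 < 4 * (q ^ 3) ^ 2 by rewrite muln_gt0 !expn_gt0 q0.
have [n1 hn1] := stability s0 R0.
pose kF (x : F) : 'I_3 := match x with
  | inl _ => ord0
  | inr u => if cb u then inord 1 else inord 2
  end.
have d1 : (ord0 : 'I_3) != inord 1 by rewrite -val_eqE /= inordK.
have d2 : (ord0 : 'I_3) != inord 2 by rewrite -val_eqE /= inordK.
have d3 : (inord 1 : 'I_3) != inord 2 by rewrite -val_eqE /= !inordK.
have [|kB hkB] := @ballooning_color F l kF hl.
  move=> [i|u] [j|v]; rewrite gjoin_adj /kF.
  - by rewrite complete_adj !ord1 eqxx.
  - by case: (cb v).
  - by case: (cb u); rewrite eq_sym.
  - by move=> /hcb; case: (cb u); case: (cb v) => // _; rewrite eq_sym.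
(* The summand [q ^ 4] gives [t3 = n %/ q ^ 3 >= q]. *)
exists (n1 + q ^ 4 + k); first by lia.
move=> G nG fr hd ex; set n := #|G| in nG hd ex *.
have kn : k <= n by clear -nG; lia.
(* [0 < k] compensates for the rounding in [(n - k)./2]. *)
have hdeg (v : G) : #|G| <= 2 * #|nbr v|.
  have := hd v; have := odd_double_half (n - k); rewrite -/n -muln2.
  have : odd (n - k) <= 1 by case: (odd _).
  by clear -hk0 kn; lia.
have [||P [hP P1 P2]] := hn1 G _ hdeg; first by clear -nG; lia.
  by move=> A cA hA; apply: fr; apply: (contains_tripartite hkB cA).
pose t1 := n %/ q; pose t2 := t1 %/ q; pose t3 := t2 %/ q.
have e3 : t3 = n %/ q ^ 3 by rewrite /t3 /t2 /t1 -!divnMA expnS expnS expn1 mulnA.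
have q30 : 0 < q ^ 3 by rewrite expn_gt0 q0.
have ft3 : q <= t3.
  by rewrite e3 leq_divRL // -expnS; clear -nG; lia.
have n3 : n <= 2 * (q ^ 3 * t3).
  have := divn_eq n (q ^ 3); have := ltn_pmod n q30; rewrite -e3.
  have : q ^ 3 <= q ^ 3 * t3 by rewrite leq_pmulr //; clear -ft3 q0; lia.
  by rewrite (mulnC t3); move: (q ^ 3 * t3) (n %% q ^ 3) (q ^ 3) => a b d; clear; lia.
have hheavy : #|heavy P t3| <= t3.
  have h1 : #|heavy P t3| * t3 <= inner_arcs P.
    rewrite -sum_inn (bigID (mem (heavy P t3))) /=; apply: leq_trans (leq_addr _ _).
    by rewrite -sum_nat_const; apply: leq_sum => v; rewrite inE.
  have h2 : inner_arcs P <= t3 * t3.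
    rewrite -(leq_pmul2l R0); apply: leq_trans hP _.
    apply: leq_trans (_ : (2 * (q ^ 3 * t3)) ^ 2 <= _); first by rewrite leq_sqr.
    by rewrite !expnMn -mulnn mulnA.
  have t30 : 0 < t3 by clear -ft3 q0; lia.
  by rewrite -(leq_pmul2r t30); apply: leq_trans h1 h2.
have hcut v : inn P v <= crs P v.
  have pT : part P true = P by apply/setP=> x; rewrite in_part eqb_id.
  have pF : part P false = ~: P by apply/setP=> x; rewrite in_part inE; case: (x \in P).
  rewrite /inn /crs; case: (boolP (v \in P)) => vP /=; rewrite pT pF; [exact: P1|exact: P2].
have tr a : 100 * (f * (a %/ q)) <= a by rewrite mulnA mulnC; apply: leq_trunc_div.
have hf : #|ballooning l| <= f by apply: leq_addr.
have hef : nedges Fb <= f by apply: leq_addl.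
have hlow : #|G| ^ 2 + 2 * (k * #|G|) <= 2 * @arcs G setT setT + 3 * k ^ 2 + 1.
  by have := extremal_arcs_lb c kn; rewrite -/n; move: ex; clear; lia.
exists P, (heavy P t2).
case: hkind => [ke|[ke cI cJ]].
  exact: (@structured_edges G P t1 t2 t3 f hdeg hcut hheavy f0 ft3 (tr _) (tr _) (tr _)
    Fb cb k l hl hf hcb fr hef hke hk0 hIk hlow ke).
exact: (@structured_cycles G P t1 t2 t3 f hdeg hcut hheavy f0 ft3 (tr _) (tr _) (tr _)
    Fb cb k l hl hf hcb fr hef hke hk0 hIk hlow ke cI cJ).
Qed.
End MainStructure.

(** * The theorem *)

Lemma isomorphic_card (G H : sgraph) : isomorphic G H -> #|G| = #|H|.
Proof. by case=> h [hb _]; apply: bij_eq_card hb. Qed.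

Lemma isomorphic_arcs (G H : sgraph) : isomorphic G H ->
  @arcs G setT setT = @arcs H setT setT.
Proof.
case=> h [hb hA]; rewrite -!sum_degE [RHS](reindex h) /=; last exact: onW_bij.
by apply: eq_bigr => x _; rewrite (iso_deg hb hA).
Qed.

Lemma isomorphic_free (F G H : sgraph) : isomorphic G H -> free F H -> free F G.
Proof.
move=> [h [hb hA]] fr [g [gI gA]]; apply: fr; exists (fun x => h (g x)); split.
  by move=> x y /(bij_inj hb) /gI.
by move=> x y /gA; rewrite hA.
Qed.

Lemma EX_singleton (Fo H : sgraph) :
  (forall m, free Fo (gjoin H (turan2 m))) ->
  (exists n0, forall G : sgraph, n0 <= #|G| -> free Fo G ->
     extremal_arcs (@arcs H setT setT) #|H| #|G| <= @arcs G setT setT ->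
     @arcs G setT setT = extremal_arcs (@arcs H setT setT) #|H| #|G| /\
     isomorphic G (gjoin H (turan2 (#|G| - #|H|)))) ->
  exists n0, forall n, n0 <= n -> EX_is_singleton n Fo (gjoin H (turan2 (n - #|H|))).
Proof.
move=> frH [n0 hn0]; exists (n0 + #|H|) => n hn G.
set Hn := gjoin H _; have aH : @arcs Hn setT setT = extremal_arcs (@arcs H setT setT) #|H| n.
  exact: arcs_extremal.
have cH : #|Hn| = n by rewrite card_sum card_turan2; clear -hn; lia.
have leE (A B : sgraph) : (nedges A <= nedges B) = (@arcs A setT setT <= @arcs B setT setT).
  by rewrite !arcsTT leq_double.
have n0n : n0 <= n by clear -hn; lia.
split=> [[cG fr mx]|iso].
  have := mx Hn cH (frH _); rewrite leE aH => h; rewrite /gorder in cG.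
  by have [|//|_] := hn0 G _ fr; rewrite cG.
have cG := isomorphic_card iso; rewrite cH in cG.
split=> // [|G' cG' fr']; first exact: isomorphic_free iso (frH _).
rewrite leE (isomorphic_arcs iso) aH leqNgt; apply/negP=> lt; rewrite /gorder in cG'.
have [||e _] := hn0 G' _ fr'; rewrite ?cG' //; first exact: ltnW.
by move: lt; rewrite e cG' ltnn.
Qed.

Section Assembly.
Variables (Fb H : sgraph) (cb : Fb -> bool).
Variable l : oedge (gjoin (complete 1) Fb) -> nat.
Hypothesis hl : forall p, odd (l p) /\ 5 <= l p.
Hypothesis hcb : forall u v, adj u v -> cb u != cb v.
Hypothesis hke : #|H| <= nedges Fb.
Hypothesis hk0 : 0 < #|H|.
Hypothesis hIk : #|[set u | cb u]| <= #|H|.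
Hypothesis hkind : #|H| = nedges Fb \/ [/\ #|H|.+1 = nedges Fb,
  #|[set u | cb u]|.*2 = nedges Fb & #|[set u | ~~ cb u]| = #|[set u | cb u]|].
Hypothesis hHF : #|H| < #|Fb|.
Hypothesis star : forall (U : {set Fb}) (z0 : H) (psi : Fb -> H), {in U &, injective psi} ->
     (forall u, u \in U -> adj z0 (psi u)) ->
     #|H| + \sum_(u in U) #|nbr u| < nedges Fb + 1 + #|U|.
Hypothesis hW : forall (G : sgraph) (P W : {set G}), join_structure Fb #|H| P W ->
  arcs W W <= @arcs H setT setT /\
  (arcs W W = @arcs H setT setT ->
     exists g : H -> G, [/\ injective g, forall x, g x \in W & forall x y, adj (g x) (g y) = adj x y]).

Lemma extremal_singleton :
  exists n0, forall n, n0 <= n ->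
    EX_is_singleton n (ballooning l) (gjoin H (turan2 (n - #|H|))).
Proof.
apply: EX_singleton => [m|]; first exact: extremal_free.
have [N kN hN] := main_structure (@arcs H setT setT) hl hcb hke hk0 hIk hkind.
apply: (min_degree_reduction kN) => G nG fr hd ex.
have [P [W hPW]] := hN G nG fr hd ex.
have [w1 w2] := hW hPW; have [cW noE _] := hPW.
exact: finish_extremal cW noE w1 w2 ex.
Qed.
End Assembly.

(** * The three cases *)

Section Cases.
Variable Fb : sgraph.
Variable l : oedge (gjoin (complete 1) Fb) -> nat.
Hypothesis hl : forall p, odd (l p) /\ 5 <= l p.
Hypothesis Fb0 : 0 < #|Fb|.
Variable cb : Fb -> bool.
Hypothesis hcb : forall u v, adj u v -> cb u != cb v.
Hypothesis deg0 : forall u : Fb, 0 < #|nbr u|.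
Hypothesis hI : 2 * #|[set u | cb u]| <= #|Fb|.

Lemma sum_deg_const d : (forall u : Fb, #|nbr u| = d) -> 2 * nedges Fb = #|Fb| * d.
Proof.
move=> hd; rewrite mul2n -arcsTT -sum_degE; under eq_bigr do rewrite hd.
exact: sum_constT.
Qed.

Lemma order_le_edges : #|Fb| <= 2 * nedges Fb.
Proof.
rewrite mul2n -arcsTT -sum_degE -[X in X <= _]muln1 -sum_constT; exact: leq_sum.
Qed.

Lemma sum_deg_U d (U : {set Fb}) : (forall u : Fb, #|nbr u| = d) -> \sum_(u in U) #|nbr u| = #|U| * d.
Proof. by move=> hd; rewrite -sum_nat_const; apply: eq_bigr. Qed.

(** With all degrees 1 the sum over [U] is [#|U|], so the star inequality holds for every [U] and
    nothing restricts the graph on [W]. *)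
Lemma complete_case : (forall u : Fb, #|nbr u| = 1) -> exists n0, forall n, n0 <= n ->
  EX_is_singleton n (ballooning l) (gjoin (complete (nedges Fb)) (turan2 (n - nedges Fb))).
Proof.
move=> d1; have e2 := sum_deg_const d1; rewrite muln1 in e2.
have ck : #|complete (nedges Fb)| = nedges Fb by exact: card_ord.
have := @extremal_singleton Fb (complete (nedges Fb)) cb l hl hcb.
rewrite ck; apply; try by [left | move: hI Fb0 e2; clear; lia].
  by move=> U z0 psi _ _; rewrite (sum_deg_U U d1) muln1; clear; lia.
move=> G P W [cW _ _]; rewrite arcs_complete -{1 2}cW; have [b1 b2] := arcs_self_bound W.
split=> // eW; apply: (enum_embedding cW) => g gI gW i j; rewrite complete_adj.
rewrite cW in b2; have [->|ne] := eqVneq i j; first by rewrite adj_irr.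
by apply: b2 => //; rewrite ?(inj_eq gI) // eW cW.
Qed.

(** For [U] a single vertex of degree at least 2 the star inequality fails with [k = nedges Fb], so
    [W] spans no edge. *)
Lemma edgeless_case : nedges Fb < #|Fb| -> (exists u : Fb, 2 <= #|nbr u|) ->
  exists n0, forall n, n0 <= n ->
  EX_is_singleton n (ballooning l) (gjoin (edgeless (nedges Fb)) (turan2 (n - nedges Fb))).
Proof.
move=> lt [u0 hu0]; have ck : #|edgeless (nedges Fb)| = nedges Fb by exact: card_ord.
have oe := order_le_edges.
have := @extremal_singleton Fb (edgeless (nedges Fb)) cb l hl hcb.
rewrite ck; apply; try by [left | move: hI Fb0 lt oe; clear; lia].
  move=> U z0 psi _ hU; have -> : U = set0.
    by apply/setP=> u; rewrite inE; apply/negP=> /hU; rewrite edgeless_adj.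
  by rewrite big_set0 cards0; clear; lia.
move=> G P W [cW _ st].
have ind x y : x \in W -> y \in W -> adj x y = false.
  move=> xW yW; apply/negP=> xy; have := st [set u0] x (fun=> y).
  rewrite big_set1 cards1 => h; have : nedges Fb + #|nbr u0| < nedges Fb + 1 + 1.
    apply: h => //; first by move=> u v /set1P -> /set1P ->; rewrite adj_irr.
    by move=> u v /set1P -> /set1P ->.
  by move: hu0; clear; lia.
have aW : arcs W W = 0.
  rewrite /arcs big1 // => x xW; apply: eq_card0 => y; rewrite inE in_nbr.
  by apply/negP=> /andP[xy yW]; rewrite ind in xy.
rewrite arcs_edgeless aW; split=> // _; apply: (enum_embedding cW) => g gI gW i j.
by rewrite edgeless_adj ind.
Qed.

Lemma regular_bipartition d : 0 < d -> (forall u : Fb, #|nbr u| = d) ->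
  #|[set u | ~~ cb u]| = #|[set u | cb u]|.
Proof.
move=> d0 hd; set J := [set u | ~~ cb u]; set I := [set u | cb u].
have aI : arcs I J = #|I| * d.
  rewrite -sum_nat_const; apply: eq_bigr => u; rewrite inE => cu; rewrite -(hd u).
  apply: eq_card => v; rewrite inE; apply: andb_idr; rewrite in_nbr => /hcb.
  by rewrite inE cu; case: (cb v).
have aJ : arcs J I = #|J| * d.
  rewrite -sum_nat_const; apply: eq_bigr => u; rewrite inE => cu; rewrite -(hd u).
  apply: eq_card => v; rewrite inE; apply: andb_idr; rewrite in_nbr => /hcb.
  by rewrite inE (negbTE cu); case: (cb v).
by apply/eqP; rewrite -(eqn_pmul2r d0) -aI -aJ arcsC.
Qed.

(** With all degrees 2 and [k = nedges Fb - 1], the star inequality holds exactly for [#|U| <= 1]. A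
    vertex of [W] with two neighbours in [W] would allow [#|U| = 2], so the graph on [W] has maximum
    degree 1. *)
Lemma matching_case : (forall u : Fb, #|nbr u| = 2) -> exists n0, forall n, n0 <= n ->
  EX_is_singleton n (ballooning l)
    (gjoin (gunion (matching (#|Fb|./2 - 1)) (complete 1)) (turan2 (n - #|Fb| + 1))).
Proof.
move=> d2; have e2 := sum_deg_const d2.
have cJ := regular_bipartition (d := 2) isT d2.
have cIJ : #|[set u | cb u]| + #|[set u | ~~ cb u]| = #|Fb|.
  by rewrite -(cardsC [set u | cb u]); congr (_ + _); apply: eq_card => u; rewrite !inE.
have e1 : nedges Fb = #|Fb| by move: e2; clear; lia.
have [u0 _] := card_gt0P Fb0.
have cN : #|u0 |: nbr u0| = 3 by rewrite cardsU1 in_nbr adj_irr d2.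
have c4 : 4 <= #|Fb|.
  by have := max_card (mem (u0 |: nbr u0)); rewrite cN; move: cIJ cJ; clear; lia.
set t := #|Fb|./2 - 1; pose H := gunion (matching t) (complete 1).
have ct : (2 * t).+2 = #|Fb|.
  have := odd_double_half #|Fb|; have : odd #|Fb| = false by rewrite -cIJ cJ addnn odd_double.
  by move=> -> /=; rewrite /t -muln2; move: c4; clear; lia.
have cH : #|H| = (2 * t).+1 by exact: card_near_matching.
have cHF : #|H|.+1 = #|Fb| by rewrite cH.
suff [n0 hn0] : exists n0, forall n, n0 <= n ->
    EX_is_singleton n (ballooning l) (gjoin H (turan2 (n - #|H|))).
  exists (n0 + #|Fb|) => n hn; have -> : n - #|Fb| + 1 = n - #|H| by move: hn cHF; clear; lia.
  by apply: hn0; move: hn; clear; lia.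
apply: (@extremal_singleton Fb H cb l hl hcb); try by move: cHF e1 c4 cIJ cJ; clear; lia.
- by right; split; rewrite ?cJ //; move: cHF e1 cIJ cJ; rewrite -?muln2; clear; lia.
- move=> U z0 psi psiI hU; rewrite (sum_deg_U U d2).
  have : #|U| <= 1.
    rewrite -(card_in_imset psiI); apply: leq_trans (_ : #|nbr z0| <= 1).
      by apply: subset_leq_card; apply/subsetP=> y /imsetP[u /hU zu ->]; rewrite in_nbr.
    by rewrite near_matching_deg; case: (z0).
  by move: cHF e1; clear; lia.
move=> G P W [cW _ st]; rewrite cH in cW.
have deg1 z0 z1 z2 : z0 \in W -> z1 \in W -> z2 \in W -> adj z0 z1 -> adj z0 z2 -> z1 = z2.
  move=> w0 w1 w2 a1 a2; apply/eqP; apply: contraT => ne.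
  (* An independent pair is needed; [u0] and its two neighbours are only three of at least four
     vertices. *)
  have [|u1 _ nu1] := @exists_notin _ [set: Fb] (u0 |: nbr u0); first by rewrite cardsT cN.
  move: nu1; rewrite in_setU1 in_nbr negb_or => /andP[n10 n01].
  have := st [set u0; u1] z0 (fun u => if u == u0 then z1 else z2).
  rewrite (sum_deg_U _ d2) cards2 eq_sym n10 => h.
  suff : #|H| + 2 * 2 < nedges Fb + 1 + 2 by move: cHF e1; clear; lia.
  apply: h => //.
  - by move=> u v /set2P[] -> /set2P[] ->; rewrite ?adj_irr // adj_sym.
  - move=> u v /set2P[] -> /set2P[] ->; rewrite ?eqxx ?(negbTE n10) // => e.
      by rewrite e eqxx in ne.
    by rewrite e eqxx in ne.
  - by move=> u _; case: ifP.
by rewrite arcs_near_matching; split; [apply: near_matching_bound|apply: near_matching_embedding].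
Qed.

End Cases.

Theorem theorem1p3 (Fb : sgraph) (hFb0 : 0 < gorder Fb)
    (hFb : each_component
             (fun C => (tree C /\ 2 <= gorder C) \/ even_cycle C) Fb)
    (l : oedge (gjoin (complete 1) Fb) -> nat)
    (hl : forall p, odd (l p) /\ 5 <= l p) :
  let Fo := ballooning l in
  exists n0 : nat, forall n : nat, n0 <= n ->
    [/\ each_component even_cycle Fb ->
          EX_is_singleton n Fo
            (gjoin (gunion (matching ((gorder Fb)./2 - 1)) (complete 1))
                   (turan2 (n - gorder Fb + 1))),
        each_component single_edge Fb ->
          EX_is_singleton n Fo
            (gjoin (complete (nedges Fb)) (turan2 (n - nedges Fb)))
      & ~ each_component even_cycle Fb -> ~ each_component single_edge Fb ->
          EX_is_singleton n Fo
            (gjoin (edgeless (nedges Fb)) (turan2 (n - nedges Fb)))].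
Proof.
move=> Fo; have deg0 := deg_gt0 hFb.
have [cb [hcb hI]] : exists cb : Fb -> bool, (forall u v, adj u v -> cb u != cb v) /\
    2 * #|[set u | cb u]| <= #|Fb|.
  have [cb hcb] := bipartite_color hFb.
  have cIJ : #|[set u | cb u]| + #|[set u | ~~ cb u]| = #|Fb|.
    by rewrite -(cardsC [set u | cb u]); congr (_ + _); apply: eq_card => u; rewrite !inE.
  (* The smaller class is taken: it has at most half of [#|Fb|] vertices, which fits on the heavy
     vertices. *)
  have [le|lt] := leqP (2 * #|[set u | cb u]|) #|Fb|; first by exists cb.
  exists (fun u => ~~ cb u); split=> [u v /hcb|]; first by case: (cb u); case: (cb v).
  by move: cIJ lt; clear; lia.
(* [n0] is chosen before the case is known, so the cases are told apart by decidable conditions on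
   degrees and edge numbers, which the assumptions on the components imply. *)
have cond (b : bool) (Q : nat -> Prop) :
    (b -> exists n0, forall n, n0 <= n -> Q n) -> exists n0, b -> forall n, n0 <= n -> Q n.
  by case: b => [/(_ isT)[n0 h]|_]; [exists n0|exists 0].
have [n1 h1] := cond [forall u : Fb, #|nbr u| == 2] _ (fun hd =>
  matching_case hl hFb0 hcb (fun u => eqP (forallP hd u))).
have [n2 h2] := cond [forall u : Fb, #|nbr u| == 1] _ (fun hd =>
  complete_case hl hFb0 hcb hI (fun u => eqP (forallP hd u))).
have [n3 h3] := cond ((nedges Fb < #|Fb|) && [exists u : Fb, 2 <= #|nbr u|]) _ (fun hd =>
  edgeless_case hl hFb0 hcb deg0 hI (proj1 (andP hd)) (existsP (proj2 (andP hd)))).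
exists (n1 + n2 + n3) => n hn; split=> [ev|se|nev nse].
- apply: h1; last by move: hn; clear; lia.
  by apply/forallP=> u; rewrite (even_cycle_deg u ev).
- apply: h2; last by move: hn; clear; lia.
  by apply/forallP=> u; rewrite (single_edge_deg u se).
apply: h3; last by move: hn; clear; lia.
rewrite (not_even_cycle_edges hFb nev) /=; apply/existsP.
exact: not_single_edge_deg hFb nse.
Qed.
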